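(* Let $k$ be an algebraically closed field and $\Lambda$ an indecomposable finite dimensional selfinjective $k$-algebra with Jacobson radical $\mathfrak{r}$. Let $H$ be a graded subalgebra of the Hochschild cohomology ring $\mathrm{HH}^*(\Lambda)$ such that $H$ is a commutative Noetherian ring with $H^0=\mathrm{HH}^0(\Lambda)=Z(\Lambda)$, and suppose that $\mathrm{Ext}^*_\Lambda(\Lambda/\mathfrak{r},\Lambda/\mathfrak{r})$ is a finitely generated $H$-module. Let $M$ be a finitely generated left $\Lambda$-module. If the variety $V_H(M)$ of $M$ is a line, or equivalently, if the complexity of $M$ is $1$, then $M$ is a direct sum of periodic modules and a projective module.
   Context: $\mathrm{HH}^*(\Lambda)=\bigoplus_{i\ge 0}\mathrm{Ext}^i_{\Lambda^e}(\Lambda,\Lambda)$ with $\Lambda^e=\Lambda\otimes_k\Lambda^{\mathrm{op}}$. For finitely generated left $\Lambda$-modules $M,N$, $\mathrm{Ext}^*_\Lambda(M,N)=\bigoplus_{i\ge 0}\mathrm{Ext}^i_\Lambda(M,N)$ is a graded $\mathrm{HH}^*(\Lambda)$-module (hence an $H$-module) via the graded ring homomorphism $\mathrm{HH}^*(\Lambda)\to\mathrm{Ext}^*_\Lambda(M,M)$ induced by $-\otimes_\Lambda M$ followed by Yoneda product. The variety of $M$ is $V_H(M)=\{\mathfrak{m}\in\mathrm{MaxSpec}\,H\mid \mathrm{Ann}_H\mathrm{Ext}^*_\Lambda(M,\Lambda/\mathfrak{r})\subseteq\mathfrak{m}\}$, where $\mathrm{MaxSpec}\,H$ is the maximal ideal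 spectrum of $H$. Under the hypotheses of the claim, $\dim V_H(M)=c_\Lambda(M)$, the complexity of $M$. The complexity is $c_\Lambda(M)=\min\{b\in\mathbb{N}_0\mid \exists a\in\mathbb{R}\text{ such that }\dim_k Q_n\le a n^{b-1}\ \forall n\ge 0\}$, where $\cdots\to Q_n\to Q_{n-1}\to\cdots\to Q_0\to M\to 0$ is a minimal projective resolution of $M$. A module $X$ is periodic (meaning $\Omega$-periodic) if $\Omega^n_\Lambda(X)\simeq X$ for some $n\ge 1$, where $\Omega_\Lambda$ is the syzygy (kernel of a projective cover). *)

(* Defs.v *)
From HB Require Import structures.
From mathcomp Require Import all_boot all_order all_algebra all_field.
From mathcomp Require Import generic_quotient ring_quotient.
From mathcomp Require Import boolp classical_sets functions.
From mathcomp Require Import reals.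

Set Implicit Arguments.
Unset Strict Implicit.
Unset Printing Implicit Defensive.

Import GRing.Theory.

Local Open Scope classical_set_scope.
Local Open Scope ring_scope.
Local Open Scope quotient_scope.

Section LmodQuotient.
Variables (R : nzRingType) (V : lmodType R) (S : {pred V}).
Hypothesis S_submod : submod_closed S.

(* S, carrying the proof that it is a submodule. *)
Definition submod_pred of submod_closed S : {pred V} := fun x => x \in S.
Local Notation U := (submod_pred S_submod).

Lemma submod_pred_zmod : zmod_closed U.
Proof. exact: GRing.submod_closedB S_submod. Qed.
HB.instance Definition _ := GRing.isZmodClosed.Build V U submod_pred_zmod.

Definition lquot : Type := (@Quotient.quot V U).
HB.instance Definition _ := GRing.Zmodule.on lquot.

Definition lquot_pi (x : V) : lquot := \pi_(@Quotient.quot V U) x.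

Lemma lquot_piE (x y : V) : lquot_pi x = lquot_pi y <-> x - y \in S.
Proof.
rewrite /lquot_pi; split => [/eqP|h]; first by rewrite -Quotient.idealrBE.
by apply/eqP; rewrite -Quotient.idealrBE.
Qed.

Lemma lquot_pi_surj (x : lquot) : lquot_pi (repr (x : (@Quotient.quot V U))) = x.
Proof. exact: reprK. Qed.

Lemma lquot_piD : {morph lquot_pi : x y / x + y}.
Proof. by move=> x y; rewrite /lquot_pi raddfD. Qed.

Definition lquot_scale (a : R) (x : lquot) : lquot :=
  lquot_pi (a *: repr (x : (@Quotient.quot V U))).

Lemma lquot_scaleE a x : lquot_scale a (lquot_pi x) = lquot_pi (a *: x).
Proof.
apply/lquot_piE; rewrite -scalerBr; have [S0 Slin] := S_submod.
rewrite -[_ *: _]addr0; apply: Slin => //.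
by apply/lquot_piE; rewrite lquot_pi_surj.
Qed.

Lemma lquot_scaleA a b x :
  lquot_scale a (lquot_scale b x) = lquot_scale (a * b) x.
Proof. by rewrite -(lquot_pi_surj x) !lquot_scaleE scalerA. Qed.

Lemma lquot_scale1 : left_id 1 lquot_scale.
Proof. by move=> x; rewrite -(lquot_pi_surj x) lquot_scaleE scale1r. Qed.

Lemma lquot_scaleDr : right_distributive lquot_scale +%R.
Proof.
move=> a x y; rewrite -(lquot_pi_surj x) -(lquot_pi_surj y).
by rewrite -lquot_piD !lquot_scaleE -lquot_piD scalerDr.
Qed.

Lemma lquot_scaleDl x : {morph lquot_scale^~ x : a b / a + b}.
Proof.
move=> a b; rewrite -(lquot_pi_surj x) !lquot_scaleE.
by rewrite -lquot_piD scalerDl.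
Qed.

HB.instance Definition _ := GRing.Zmodule_isLmodule.Build R lquot
  lquot_scaleA lquot_scale1 lquot_scaleDr lquot_scaleDl.

End LmodQuotient.

Section Modules.
Variable R : nzRingType.
Implicit Types M N X Y P K : lmodType R.

Definition submodule M (U : set M) : Prop :=
  U 0 /\ forall a x y, U x -> U y -> U (a *: x + y).

Definition finitely_generated M : Prop :=
  exists s : seq M, forall x,
    exists c : nat -> R, x = \sum_(i < size s) c i *: s`_i.

Definition surjective (S T : Type) (f : S -> T) : Prop :=
  forall y, exists x, f x = y.

Definition exact_at X Y N (f : X -> Y) (g : Y -> N) : Prop :=
  forall y, g y = 0 <-> exists x, f x = y.

Definition lmod_iso M N : Prop := exists f : {linear M -> N}, bijective f.

Definition projective P : Prop :=
  forall X Y (g : {linear X -> Y}) (f : {linear P -> Y}),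
    surjective g -> exists h : {linear P -> X}, forall p, g (h p) = f p.

Definition injective_module N : Prop :=
  forall X Y (i : {linear X -> Y}) (f : {linear X -> N}),
    injective i -> exists g : {linear Y -> N}, forall x, g (i x) = f x.

(* The kernel of f is a superfluous (small) submodule of P: U + ker f = P
   forces U = P. *)
Definition superfluous_kernel P N (f : P -> N) : Prop :=
  forall U : set P, submodule U ->
    (forall p, exists2 u, U u & f (p - u) = 0) -> forall p, U p.

Definition projective_cover P M (p : {linear P -> M}) : Prop :=
  [/\ projective P, surjective p & superfluous_kernel p].

(* K is isomorphic to the kernel of a projective cover of X. *)
Definition is_syzygy X K : Prop :=
  exists (P : lmodType R) (p : {linear P -> X}) (i : {linear K -> P}),
    [/\ projective_cover p, injective i & exact_at i p].

(* Y is isomorphic to the n-th syzygy of X. *)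
Fixpoint is_nth_syzygy (n : nat) X Y : Prop :=
  if n is n'.+1 then exists2 Z : lmodType R, is_syzygy X Z & is_nth_syzygy n' Z Y
  else lmod_iso X Y.

Definition periodic X : Prop := exists2 n, (0 < n)%N & is_nth_syzygy n X X.

Definition sum_of_periodic_and_projective M : Prop :=
  exists (n : nat) (X : 'I_n -> lmodType R) (P : lmodType R)
         (u : forall i, {linear X i -> M}) (v : {linear P -> M}),
    [/\ forall i, periodic (X i), projective P
      & bijective (fun xp : (forall i, X i) * P =>
                     \sum_i u i (xp.1 i) + v xp.2)].

Definition minimal_projective_resolution M (Q : nat -> lmodType R)
    (e : {linear Q 0 -> M}) (d : forall n, {linear Q n.+1 -> Q n}) : Prop :=
  [/\ forall n, finitely_generated (Q n) /\ projective (Q n),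
      surjective e, exact_at (d 0) e, forall n, exact_at (d n.+1) (d n)
    & superfluous_kernel e /\ forall n, superfluous_kernel (d n)].

Definition left_ideal (I : set R) : Prop := @submodule R^o I.

Definition maximal_left_ideal (m : set R) : Prop :=
  [/\ left_ideal m, ~ m 1
    & forall J, left_ideal J -> m `<=` J -> ~ J 1 -> J `<=` m].

Definition jacobson_radical : {pred R^o} :=
  [pred x | `[< forall m, maximal_left_ideal m -> m x >]].

Lemma jacobson_radical_submod : submod_closed jacobson_radical.
Proof.
split=> [|a x y /asboolP hx /asboolP hy]; apply/asboolP => m mm;
  have [[m0 mD] _ _] := mm; first exact: m0.
by apply: mD; [exact: hx | exact: hy].
Qed.

Definition mod_radical : lmodType R := lquot jacobson_radical_submod.

End Modules.

Section CommutativeRing.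
Variable H : comNzRingType.

Definition noetherian : Prop :=
  forall I : set H, left_ideal I -> exists s : seq H,
    (forall x, x \in s -> I x) /\
    forall x, I x -> exists c : nat -> H, x = \sum_(i < size s) c i * s`_i.

Definition MaxSpec : set (set H) := [set m | maximal_left_ideal m].

Definition zariski_locus (S : set H) : set (set H) :=
  [set m | MaxSpec m /\ S `<=` m].

Definition zariski_closed (Z : set (set H)) : Prop :=
  exists S, Z = zariski_locus S.

Definition zariski_irreducible (Z : set (set H)) : Prop :=
  Z !=set0 /\ forall A B, zariski_closed A -> zariski_closed B ->
    Z `<=` A `|` B -> Z `<=` A \/ Z `<=` B.

Definition has_irreducible_chain (V : set (set H)) (n : nat) : Prop :=
  exists Z : nat -> set (set H),
    (forall i, (i <= n)%N ->
       [/\ zariski_closed (Z i), zariski_irreducible (Z i) & Z i `<=` V]) /\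
    (forall i, (i < n)%N -> Z i `<` Z i.+1).

(* Krull dimension of a Zariski closed V: as V is closed, the closed subsets of
   the space V are the Zariski closed sets contained in V. *)
Definition variety_dim (V : set (set H)) (n : nat) : Prop :=
  has_irreducible_chain V n /\ ~ has_irreducible_chain V n.+1.

End CommutativeRing.

Section Algebra.
Variables (k : fieldType) (A : falgType k).

Definition two_sided_ideal (I : {vspace A}) : bool :=
  (({:A} * I <= I) && (I * {:A} <= I))%VS.

Definition indecomposable_algebra : Prop :=
  forall I J : {vspace A}, two_sided_ideal I -> two_sided_ideal J ->
    (I + J = {:A})%VS -> (I :&: J = 0)%VS -> I = 0%VS \/ J = 0%VS.

Definition selfinjective : Prop := injective_module A^o.

(* dim_k M = n, where k acts on M through k -> A *)
Definition has_kdim (M : lmodType A) (n : nat) : Prop :=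
  exists b : 'I_n -> M, forall x,
    exists! c : {ffun 'I_n -> k}, x = \sum_i (c i)%:A *: b i.

(* n ^ (b - 1) at n = 0 is 0 for b > 1 and undefined for b = 0, hence 0 < n. *)
Definition growth_bound (R : realType) (Q : nat -> lmodType A) (b : nat) :
    Prop :=
  exists a : R, forall n, (0 < n)%N ->
    exists2 d, has_kdim (Q n) d & d%:R <= a * n%:R ^ (b%:Z - 1).

Definition complexity (R : realType) (M : lmodType A) (c : nat) : Prop :=
  exists (Q : nat -> lmodType A) (e : {linear Q 0 -> M})
         (d : forall n, {linear Q n.+1 -> Q n}),
    [/\ minimal_projective_resolution e d, growth_bound R Q c
      & forall b, growth_bound R Q b -> (c <= b)%N].

End Algebra.

(* The bar resolution B_n = A (x) A^{(x) n} (x) M of M over A (tensor products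
   over k) gives Hom_A(B_n, N) = Hom_k(A^{(x) n} (x) M, N): an n-cochain is a
   k-multilinear function of a_1, ..., a_n in A and m in M. A cochain g of the
   total complex is a finite sum of such functions, and g s m is its component
   of degree size s evaluated at s = [:: a_1; ...; a_n] and m. *)
Section BarComplex.
Variables (k : fieldType) (A : falgType k).

(* [:: a_0; ...; a_i * a_{i+1}; ...; a_n] *)
Definition contract (i : nat) (s : seq A) : seq A :=
  take i s ++ s`_i * s`_i.+1 :: drop i.+2 s.

Definition ext_cochain (M N : lmodType A) (g : seq A -> M -> N) : Prop :=
  [/\ forall s1 s2 c x y m,
        g (s1 ++ (c *: x + y) :: s2) m
        = c%:A *: g (s1 ++ x :: s2) m + g (s1 ++ y :: s2) m,
      forall s c x y, g s (c%:A *: x + y) = c%:A *: g s x + g s y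
    & exists n, forall s m, (n <= size s)%N -> g s m = 0].

Definition ext_diff (M N : lmodType A) (g : seq A -> M -> N) : seq A -> M -> N :=
  fun s m => if s is a :: t then
      a *: g t m
      + \sum_(i < size t) (-1) ^+ i.+1 *: g (contract i s) m
      + (-1) ^+ size s *: g (belast a t) (last a t *: m)
    else 0.

Definition yoneda_cochain (L M N : lmodType A)
    (g : seq A -> M -> N) (h : seq A -> L -> M) : seq A -> L -> N :=
  fun s m => \sum_(i < (size s).+1) g (take i s) (h (drop i s) m).

(* Hochschild cochains: Hom over A (x) A^op from the bar resolution of A to A
   is Hom_k(A^{(x) n}, A) in degree n. *)
Definition hh_cochain (f : seq A -> A) : Prop :=
  (forall s1 s2 c x y,
     f (s1 ++ (c *: x + y) :: s2) = c *: f (s1 ++ x :: s2) + f (s1 ++ y :: s2))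
  /\ exists n, forall s, (n <= size s)%N -> f s = 0.

Definition hh_diff (f : seq A -> A) : seq A -> A :=
  fun s => if s is a :: t then
      a * f t
      + \sum_(i < size t) (-1) ^+ i.+1 * f (contract i s)
      + (-1) ^+ size s * (f (belast a t) * last a t)
    else 0.

Definition cup_cochain (f f' : seq A -> A) : seq A -> A :=
  fun s => \sum_(i < (size s).+1) f (take i s) * f' (drop i s).

Definition one_cochain : seq A -> A := fun s => (size s == 0)%:R.

(* - (x)_A M : Hom(B_n, A) -> Hom(B_n (x)_A M, M) *)
Definition tensor_cochain (M : lmodType A) (f : seq A -> A) : seq A -> M -> M :=
  fun s m => f s *: m.

Definition sft (T : Type) (a : A) (g : seq A -> T) : seq A -> T := fun s => g (a :: s).

Lemma yoneda_nil (L M N : lmodType A) (g : seq A -> M -> N) (h : seq A -> L -> M) m :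
  yoneda_cochain g h [::] m = g [::] (h [::] m).
Proof. by rewrite /yoneda_cochain big_ord1. Qed.

Lemma yoneda_cons (L M N : lmodType A) (g : seq A -> M -> N) (h : seq A -> L -> M) a s m :
  yoneda_cochain g h (a :: s) m =
  g [::] (h (a :: s) m) + yoneda_cochain (sft a g) h s m.
Proof. by rewrite /yoneda_cochain big_ord_recl. Qed.

Local Arguments ext_diff : simpl never.

Lemma ext_diff0 (M N : lmodType A) (g : seq A -> M -> N) m :
  ext_diff g [::] m = 0.
Proof. by []. Qed.

Lemma ext_diff1 (M N : lmodType A) (g : seq A -> M -> N) a m :
  ext_diff g [:: a] m = a *: g [::] m - g [::] (a *: m).
Proof. by rewrite /ext_diff /= big_ord0 addr0 expr1 scaleN1r. Qed.

Lemma ext_diff_cons2 (M N : lmodType A) (g : seq A -> M -> N) a b s m :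
  ext_diff g [:: a, b & s] m =
  a *: g (b :: s) m - g (a * b :: s) m - ext_diff (sft a g) (b :: s) m
  + b *: g (a :: s) m.
Proof.
rewrite /ext_diff [size (b :: s)]/= big_ord_recl /=.
rewrite {1}/contract /= drop0 expr1 scaleN1r /sft.
rewrite (eq_bigr (fun i : 'I_(size s) =>
  - ((-1) ^+ i.+1 *: g (a :: contract i (b :: s)) m))); last first.
  by move=> i _; rewrite exprS mulN1r scaleNr.
rewrite sumrN [(-1) ^+ (size s).+2]exprS mulN1r scaleNr.
set x1 := a *: _; set x2 := g (a * b :: s) m; set x3 := \sum_(i < _) _.
set x4 := _ *: g (a :: _) _; set x5 := b *: _.
by rewrite -(addrA x5) opprD !addrA (addrAC _ _ x5) subrK opprD !addrA.
Qed.


Definition sgn_cochain (M N : lmodType A) (g : seq A -> M -> N) :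
    seq A -> M -> N :=
  fun s m => (-1) ^+ size s *: g s m.

Definition additive_cochain (M N : lmodType A) (g : seq A -> M -> N) :=
  forall s x y, g s (x - y) = g s x - g s y.

Lemma yonedaDl (L M N : lmodType A) (g g' : seq A -> M -> N) (h : seq A -> L -> M) s m :
  yoneda_cochain (fun s m => g s m + g' s m) h s m =
  yoneda_cochain g h s m + yoneda_cochain g' h s m.
Proof. by rewrite /yoneda_cochain -big_split. Qed.

Lemma yonedaZl (L M N : lmodType A) (g : seq A -> M -> N) (h : seq A -> L -> M) (a : A) s m :
  yoneda_cochain (fun s m => a *: g s m) h s m = a *: yoneda_cochain g h s m.
Proof. by rewrite /yoneda_cochain scaler_sumr. Qed.

Lemma yonedaNl (L M N : lmodType A) (g : seq A -> M -> N) (h : seq A -> L -> M) s m :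
  yoneda_cochain (fun s m => - g s m) h s m = - yoneda_cochain g h s m.
Proof. by rewrite /yoneda_cochain sumrN. Qed.

Lemma ext_diffD (M N : lmodType A) (g g' : seq A -> M -> N) s m :
  ext_diff (fun s m => g s m + g' s m) s m = ext_diff g s m + ext_diff g' s m.
Proof.
case: s => [|a t]; rewrite /ext_diff ?addr0 //.
under eq_bigr do rewrite scalerDr.
rewrite big_split /= !scalerDr.
by rewrite !addrA [LHS](ACl (1*3*5*2*4*6))%AC.
Qed.

Lemma ext_diffZ (M N : lmodType A) (c : k) (g : seq A -> M -> N) s m :
  ext_diff (fun s m => c%:A *: g s m) s m = c%:A *: ext_diff g s m.
Proof.
have comm (a : A) x : a *: (c%:A *: x) = c%:A *: (a *: x) :> N.
  by rewrite !scalerA -scalerAr mulr1 -scalerAl mul1r.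
case: s => [|a t]; rewrite /ext_diff ?scaler0 //.
by rewrite !scalerDr scaler_sumr !comm; under eq_bigr do rewrite comm.
Qed.

Lemma ext_diffN (M N : lmodType A) (g : seq A -> M -> N) s m :
  ext_diff (fun s m => - g s m) s m = - ext_diff g s m.
Proof.
have := ext_diffZ (-1) g s m; rewrite !scaleN1r => <-.
by congr (ext_diff _ s m); apply/funext => ?; apply/funext => ?; rewrite !scaleN1r.
Qed.

Lemma additive_sgn (M N : lmodType A) (u : M -> N) n x :
  (forall x y, u (x - y) = u x - u y) -> u ((-1) ^+ n *: x) = (-1) ^+ n *: u x.
Proof.
move=> uB; have u0 : u 0 = 0 by rewrite -(subrr 0) uB subrr.
have uN y : u (- y) = - u y by rewrite -[- y]add0r uB u0 add0r.
elim: n x => [|n IH] x; first by rewrite !expr0 !scale1r.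
by rewrite exprS -!scalerA !scaleN1r uN IH.
Qed.

Lemma ext_diff_comp (L M N : lmodType A) (u : M -> N) (h : seq A -> L -> M) b s m :
  (forall x y, u (x - y) = u x - u y) ->
  ext_diff (fun s m => u (h s m)) (b :: s) m =
  b *: u (h s m) + u (ext_diff h (b :: s) m) - u (b *: h s m).
Proof.
move=> uB; have u0 : u 0 = 0 by rewrite -(subrr 0) uB subrr.
have uN y : u (- y) = - u y by rewrite -[- y]add0r uB u0 add0r.
have uD x y : u (x + y) = u x + u y by rewrite -[y in LHS]opprK uB uN opprK.
rewrite /ext_diff !uD (big_morph u uD u0).
rewrite -!addrA; congr (_ + _); rewrite [RHS]addrC -!addrA addNr addr0.
rewrite (additive_sgn _ _ uB); congr (_ + _).
by apply: eq_bigr => i _; rewrite (additive_sgn _ _ uB).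
Qed.

Lemma leibniz (L M N : lmodType A) (g : seq A -> M -> N) (h : seq A -> L -> M) :
  additive_cochain g ->
  forall s m, ext_diff (yoneda_cochain g h) s m =
    yoneda_cochain (ext_diff g) h s m
    + yoneda_cochain (sgn_cochain g) (ext_diff h) s m.
Proof.
move=> gB s; have [n] := ubnP (size s); elim: n s g gB => // n IH.
have g0 (g : seq A -> M -> N) (gB : additive_cochain g) s : g s 0 = 0.
  by rewrite -(subrr 0) gB subrr.
case=> [|a [|b s]] g gB sn m.
- by rewrite !yoneda_nil /sgn_cochain /= g0 // scaler0 addr0.
- rewrite ext_diff1 !yoneda_nil !yoneda_cons !yoneda_nil.
  rewrite /sft !ext_diff1 !ext_diff0 /sgn_cochain /= expr0 !scale1r (g0 _ gB [:: a]).
  by rewrite scaler0 addr0 add0r gB addrA subrK.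
have gaB : additive_cochain (sft a g) by move=> ? ? ?; rewrite /sft gB.
have uB : forall x y, g [::] (x - y) = g [::] x - g [::] y by move=> *; apply: gB.
have uN y : g [::] (- y) = - g [::] y by rewrite -[- y]add0r uB (g0 _ gB) add0r.
have uD x y : g [::] (x + y) = g [::] x + g [::] y.
  by rewrite -[y in LHS]opprK uB uN opprK.
rewrite ext_diff_cons2 !(yoneda_cons g h).
have -> : sft a (yoneda_cochain g h) = fun s m =>
    g [::] (sft a h s m) + yoneda_cochain (sft a g) h s m.
  by apply/funext => s'; apply/funext => m'; rewrite -yoneda_cons.
rewrite ext_diffD (ext_diff_comp _ _ _ _ uB) IH //.
rewrite (yoneda_cons (ext_diff g)) ext_diff0 add0r (yoneda_cons (sft a (ext_diff g))).
have -> x : sft a (ext_diff g) [::] x = a *: g [::] x - g [::] (a *: x).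
  exact: ext_diff1.
have -> : sft b (sft a (ext_diff g)) = fun s m =>
    (a *: sft b g s m + - sft (a * b) g s m)
    + - (sft b (ext_diff (sft a g)) s m) + b *: sft a g s m.
  by apply/funext => s'; apply/funext => m'; rewrite -ext_diff_cons2.
rewrite !yonedaDl !yonedaNl !yonedaZl.
rewrite (yoneda_cons (sgn_cochain g)) [sgn_cochain g [::] _]/sgn_cochain expr0 scale1r.
have -> : sft a (sgn_cochain g) = fun s m => - sgn_cochain (sft a g) s m.
  apply/funext => s'; apply/funext => m'.
  by rewrite /sft /sgn_cochain /= exprS mulN1r scaleNr.
rewrite yonedaNl ext_diff_cons2.
move: (ext_diff (sft a h) (b :: s) m) => D; rewrite !(uD, uB) !uN /sft.
rewrite (yoneda_cons (ext_diff (sft a g))) ext_diff0 add0r.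
rewrite !scalerDr !opprD !opprK !addrA.
rewrite [LHS](ACl (10*5*1*2*3*4*6*7*8*9*11))%AC /= subrr add0r.
by rewrite [RHS](ACl (7*2*1*3*8*4*9*10*5*11*6))%AC /= subrr add0r.
Qed.

Lemma ext_cochain_add (M N : lmodType A) (g : seq A -> M -> N) :
  ext_cochain g -> additive_cochain g.
Proof.
move=> [_ lin _] s x y.
have := lin s (-1) y x; rewrite scaleN1r !scaleN1r => e.
by rewrite addrC e addrC.
Qed.

Lemma ext_cochain_g0 (M N : lmodType A) (g : seq A -> M -> N) s :
  ext_cochain g -> g s 0 = 0.
Proof. by move=> /ext_cochain_add gB; rewrite -(subrr 0) gB subrr. Qed.

Lemma scaleA_comm (M : lmodType A) (c : k) (a : A) (x : M) :
  a *: (c%:A *: x) = c%:A *: (a *: x).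
Proof. by rewrite !scalerA -scalerAr mulr1 -scalerAl mul1r. Qed.

Lemma yoneda_is_cochain (L M N : lmodType A)
    (g : seq A -> M -> N) (h : seq A -> L -> M) :
  ext_cochain g -> ext_cochain h -> ext_cochain (yoneda_cochain g h).
Proof.
move=> Cg Ch; have g0 s := ext_cochain_g0 s Cg.
case: Cg Ch => [gm gl [n1 gs]] [hm hl [n2 hs]]; split.
- move=> s1; elim: s1 g gm gl {g0 gs} => [|a s1 IH] g gm gl s2 c x y m /=.
    have /= hm0 := hm [::] s2 c x y m.
    rewrite !yoneda_cons hm0 gl scalerDr -!addrA; congr (_ + _).
    rewrite addrCA; congr (_ + _).
    rewrite -yonedaZl -yonedaDl; congr (yoneda_cochain _ h s2 m).
    by apply/funext => s; apply/funext => z; exact: (gm [::]).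
  rewrite !yoneda_cons -!cat_cons hm gl scalerDr IH.
  - by rewrite !addrA (ACl (1*3*2*4))%AC.
  - by move=> *; rewrite /sft -!cat_cons gm.
  - by move=> *; rewrite /sft gl.
- move=> s c x y; rewrite /yoneda_cochain scaler_sumr -big_split.
  by apply: eq_bigr => i _; rewrite hl gl.
- exists (n1 + n2)%N => s m hsz; rewrite /yoneda_cochain big1 // => i _.
  have isz : (i <= size s)%N by rewrite -ltnS.
  have [n1i|in1] := leqP n1 i; first by rewrite gs // size_takel.
  rewrite hs ?g0 // size_drop leq_subRL //.
  by apply: leq_trans hsz; rewrite leq_add2r ltnW.
Qed.

Lemma size_contract i s : (i < (size s).-1)%N -> size (contract i s) = (size s).-1.
Proof.
move=> h; have h' : (i.+2 <= size s)%N by case: (size s) h.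
rewrite /contract size_cat /= size_takel ?(ltnW (ltnW h')) // size_drop.
by rewrite addnS -addSn; move: h'; case: (size s) => [|[|n]] //= ?; rewrite subSS addSn subnKC.
Qed.

Lemma ext_diff_sgn (M N : lmodType A) (g : seq A -> M -> N) s m :
  ext_diff (sgn_cochain g) s m = - sgn_cochain (ext_diff g) s m.
Proof.
have comm n (a : A) (x : N) : a *: ((-1) ^+ n *: x) = (-1) ^+ n *: (a *: x).
  by rewrite !scalerA commr_sign.
case: s => [|a t]; first by rewrite /sgn_cochain !ext_diff0 scaler0 oppr0.
have e : - (-1) ^+ (size t).+1 = (-1) ^+ size t :> A.
  by rewrite exprS mulN1r opprK.
rewrite /sgn_cochain /ext_diff size_belast [size (a :: t)]/= -scaleNr e.
rewrite !scalerDr scaler_sumr (comm _ a) [(-1) ^+ _.+1 *: (_ *: g _ _)]comm.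
congr (_ + _ + _).
by apply: eq_bigr => i _; rewrite comm size_contract.
Qed.

Lemma sgn_is_cochain (M N : lmodType A) (g : seq A -> M -> N) :
  ext_cochain g -> ext_cochain (sgn_cochain g).
Proof.
move=> [gm gl [n gs]]; have sgnE i : (-1) ^+ i = ((-1) ^+ i)%:A :> A.
  by rewrite -[LHS]mulr1 -signr_odd -(signr_odd k); case: odd; rewrite ?expr0 ?expr1 ?scale1r ?scaleN1r ?mul1r ?mulN1r.
split.
- move=> *; rewrite /sgn_cochain gm !size_cat /= scalerDr; congr (_ + _).
  by rewrite sgnE scaleA_comm.
- by move=> *; rewrite /sgn_cochain gl scalerDr; congr (_ + _); rewrite scaleA_comm.
- by exists n => s m h; rewrite /sgn_cochain gs // scaler0.
Qed.

Lemma sgn_cochainK (M N : lmodType A) (g : seq A -> M -> N) :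
  sgn_cochain (sgn_cochain g) = g.
Proof.
apply/funext => s; apply/funext => m; rewrite /sgn_cochain scalerA -expr2.
by rewrite sqrr_sign scale1r.
Qed.

Lemma ext_cochainB (M N : lmodType A) (g g' : seq A -> M -> N) :
  ext_cochain g -> ext_cochain g' -> ext_cochain (g - g').
Proof.
move=> [gm gl [n gs]] [gm' gl' [n' gs']]; split.
- move=> *; rewrite !fctE gm gm' scalerBr opprD !addrA.
  by rewrite (ACl (1*3*2*4))%AC.
- move=> *; rewrite !fctE gl gl' scalerBr opprD !addrA.
  by rewrite (ACl (1*3*2*4))%AC.
- exists (n + n')%N => s m h; rewrite !fctE gs ?gs' ?subr0 //.
    exact: leq_trans (leq_addl _ _) h.
  exact: leq_trans (leq_addr _ _) h.
Qed.

Lemma ext_cochain0 (M N : lmodType A) : ext_cochain (0 : seq A -> M -> N).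
Proof.
have z c : 0 = c%:A *: 0 + 0 :> N by rewrite scaler0 addr0.
split; first by move=> s1 s2 c *; exact: (z c).
  by move=> s c *; exact: (z c).
by exists 0%N.
Qed.

Lemma ext_diffB (M N : lmodType A) (g g' : seq A -> M -> N) :
  ext_diff (g - g') = ext_diff g - ext_diff g'.
Proof.
apply/funext => s; apply/funext => m; rewrite !fctE -ext_diffN -ext_diffD.
by congr (ext_diff _ s m).
Qed.

Lemma ext_diff_zero (M N : lmodType A) : ext_diff (0 : seq A -> M -> N) = 0.
Proof. by have := @ext_diffB M N 0 0; rewrite !subrr. Qed.

Section Ext.
Variables M N : lmodType A.

Definition ext_cocycle_pred : {pred (seq A -> M -> N)} :=
  [pred g | `[< ext_cochain g /\ ext_diff g = 0 >]].

Lemma ext_cocycle_zmod : zmod_closed ext_cocycle_pred.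
Proof.
split=> [|g g' /asboolP [Cg dg] /asboolP [Cg' dg']]; apply/asboolP.
  by split; [exact: ext_cochain0 | exact: ext_diff_zero].
by split; [exact: ext_cochainB | rewrite ext_diffB dg dg' subrr].
Qed.
HB.instance Definition _ :=
  GRing.isZmodClosed.Build _ ext_cocycle_pred ext_cocycle_zmod.

Record ext_cocycle := ExtCocycle {
  ext_cocycle_val :> seq A -> M -> N;
  _ : ext_cocycle_val \in ext_cocycle_pred }.
HB.instance Definition _ := [isSub for ext_cocycle_val].
HB.instance Definition _ := [Choice of ext_cocycle by <:].
HB.instance Definition _ := [SubChoice_isSubZmodule of ext_cocycle by <:].

Definition ext_coboundary : {pred ext_cocycle} :=
  [pred z : ext_cocycle |
     `[< exists2 g : seq A -> M -> N, ext_cochain g & val z = ext_diff g >]].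

Lemma ext_coboundary_zmod : zmod_closed ext_coboundary.
Proof.
split=> [|z z' /asboolP [g Cg zE] /asboolP [g' Cg' zE']]; apply/asboolP.
  by exists 0; [exact: ext_cochain0 | rewrite ext_diff_zero].
by exists (g - g'); [exact: ext_cochainB | rewrite ext_diffB -zE -zE'].
Qed.
HB.instance Definition _ :=
  GRing.isZmodClosed.Build _ ext_coboundary ext_coboundary_zmod.

Definition Ext : Type := @Quotient.quot ext_cocycle ext_coboundary.
HB.instance Definition _ := GRing.Zmodule.on Ext.

Definition ext_class (z : ext_cocycle) : Ext :=
  \pi_(@Quotient.quot ext_cocycle ext_coboundary) z.
Definition ext_repr (x : Ext) : ext_cocycle :=
  repr (x : @Quotient.quot ext_cocycle ext_coboundary).

Lemma ext_classP (z z' : ext_cocycle) :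
  ext_class z = ext_class z' <->
  exists2 g : seq A -> M -> N, ext_cochain g & val z - val z' = ext_diff g.
Proof.
rewrite /ext_class; split => [/eqP|h].
  by rewrite -Quotient.idealrBE => /asboolP.
by apply/eqP; rewrite -Quotient.idealrBE; apply/asboolP.
Qed.

Lemma ext_reprK (x : Ext) : ext_class (ext_repr x) = x.
Proof. exact: reprK. Qed.

End Ext.

Lemma yoneda_is_cocycle (L M N : lmodType A)
    (g : ext_cocycle M N) (h : ext_cocycle L M) :
  yoneda_cochain g h \in @ext_cocycle_pred L N.
Proof.
have /asboolP [Cg dg] := valP g; have /asboolP [Ch dh] := valP h.
apply/asboolP; split; first exact: yoneda_is_cochain.
apply/funext => s; apply/funext => m.
rewrite leibniz; last exact: ext_cochain_add.
rewrite /yoneda_cochain dg dh !big1 ?addr0 // => i _.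
exact: (ext_cochain_g0 _ (sgn_is_cochain Cg)).
Qed.

Definition yoneda_cocycle (L M N : lmodType A)
    (g : ext_cocycle M N) (h : ext_cocycle L M) : ext_cocycle L N :=
  ExtCocycle (yoneda_is_cocycle g h).

Definition yoneda (L M N : lmodType A) (x : Ext M N) (y : Ext L M) : Ext L N :=
  ext_class (yoneda_cocycle (ext_repr x) (ext_repr y)).

Lemma yonedaE (L M N : lmodType A)
    (g : ext_cocycle M N) (h : ext_cocycle L M) :
  yoneda (ext_class g) (ext_class h) = ext_class (yoneda_cocycle g h).
Proof.
set g1 := ext_repr (ext_class g); set h1 := ext_repr (ext_class h).
have /ext_classP[u Cu gu] : ext_class g1 = ext_class g by exact: ext_reprK.
have /ext_classP[v Cv hv] : ext_class h1 = ext_class h by exact: ext_reprK.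
have /asboolP [Cg dg] := valP g; have /asboolP [Ch1 dh1] := valP h1.
have /asboolP [Ch dh] := valP h; have Csg := sgn_is_cochain Cg.
pose w1 := yoneda_cochain u h1; pose w2 := yoneda_cochain (sgn_cochain g) v.
have Cw1 : ext_cochain w1 by exact: yoneda_is_cochain.
have Cw2 : ext_cochain w2 by exact: yoneda_is_cochain.
apply/ext_classP; exists (w1 - (0 - w2)).
  by do !apply: ext_cochainB => //; exact: ext_cochain0.
rewrite !ext_diffB ext_diff_zero sub0r opprK.
apply/funext => s; apply/funext => m.
rewrite !fctE !leibniz; try exact: ext_cochain_add.
rewrite sgn_cochainK dh1 -gu -hv.
have -> : ext_diff (sgn_cochain (val g)) = 0.
  by apply/funext => ?; apply/funext => ?; rewrite ext_diff_sgn dg /sgn_cochain scaler0 oppr0.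
rewrite /yoneda_cochain /=.
rewrite [X in _ + X + _]big1 => [|i _]; last first.
  exact: (ext_cochain_g0 _ (sgn_is_cochain Cu)).
rewrite [X in _ + (X + _)]big1 // addr0 add0r -big_split -sumrB /=.
apply: eq_bigr => i _; rewrite !fctE ext_cochain_add //.
by rewrite addrA subrK.
Qed.

Lemma tensor_is_cochain (M : lmodType A) (f : seq A -> A) :
  hh_cochain f -> ext_cochain (@tensor_cochain M f).
Proof.
move=> [fm [n fs]]; split.
- by move=> *; rewrite /tensor_cochain fm scalerDl scalerA mulr_algl.
- by move=> *; rewrite /tensor_cochain scalerDr scaleA_comm.
- by exists n => s m h; rewrite /tensor_cochain fs // scale0r.
Qed.

Lemma hh_cochain_tensor (f : seq A -> A) :
  ext_cochain (@tensor_cochain A^o f) -> hh_cochain f.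
Proof.
have e s : tensor_cochain f s (1 : A^o) = f s by rewrite /tensor_cochain [LHS]mulr1.
move=> [fm _ [n fs]]; split.
  by move=> s1 s2 c x y; have := fm s1 s2 c x y 1; rewrite !e => ->; congr (_ + _); exact: mulr_algl.
by exists n => s h; rewrite -e fs.
Qed.

Lemma tensor_diff (M : lmodType A) (f : seq A -> A) :
  ext_diff (@tensor_cochain M f) = tensor_cochain (hh_diff f).
Proof.
apply/funext => -[|a t]; apply/funext => m; rewrite /tensor_cochain.
  by rewrite ext_diff0 /= scale0r.
rewrite /ext_diff /hh_diff !scalerDl !scalerA !mulrA scaler_suml.
by congr (_ + _ + _); apply: eq_bigr => i _; rewrite scalerA.
Qed.

Lemma tensor_cup (M : lmodType A) (f f' : seq A -> A) :
  @tensor_cochain M (cup_cochain f f') =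
  yoneda_cochain (tensor_cochain f) (tensor_cochain f').
Proof.
apply/funext => s; apply/funext => m.
rewrite /tensor_cochain /yoneda_cochain scaler_suml.
by apply: eq_bigr => i _; rewrite scalerA.
Qed.

Lemma tensor_inj : injective (@tensor_cochain A^o).
Proof.
move=> f f' /(congr1 (fun g s => g s 1)) e; apply/funext => s.
by have := congr1 (fun g => g s) e; rewrite /= /tensor_cochain ![_ *: (1 : A^o)]mulr1.
Qed.

Definition hh_sgn (f : seq A -> A) : seq A -> A :=
  fun s => (-1) ^+ size s * f s.

Lemma tensor_sgn (M : lmodType A) f :
  @tensor_cochain M (hh_sgn f) = sgn_cochain (tensor_cochain f).
Proof.
by apply/funext => s; apply/funext => m; rewrite /tensor_cochain /sgn_cochain scalerA.
Qed.

Lemma hh_sgn_cochain f : hh_cochain f -> hh_cochain (hh_sgn f).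
Proof.
move=> Cf; apply: hh_cochain_tensor; rewrite tensor_sgn.
by apply: sgn_is_cochain; exact: tensor_is_cochain.
Qed.

Lemma hh_sgnK f : hh_sgn (hh_sgn f) = f.
Proof.
by apply/funext => s; rewrite /hh_sgn mulrA -expr2 sqrr_sign mul1r.
Qed.

Lemma cup_is_cochain f f' :
  hh_cochain f -> hh_cochain f' -> hh_cochain (cup_cochain f f').
Proof.
move=> Cf Cf'; apply: hh_cochain_tensor; rewrite tensor_cup.
by apply: yoneda_is_cochain; exact: tensor_is_cochain.
Qed.

Lemma cup0l f : cup_cochain (fun=> 0) f = fun=> 0.
Proof.
by apply/funext => s; rewrite /cup_cochain big1 // => i _; rewrite mul0r.
Qed.

Lemma cup0r f : cup_cochain f (fun=> 0) = fun=> 0.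
Proof.
by apply/funext => s; rewrite /cup_cochain big1 // => i _; rewrite mulr0.
Qed.

Lemma hh_leibniz f f' : hh_cochain f ->
  hh_diff (cup_cochain f f') =
  cup_cochain (hh_diff f) f' + cup_cochain (hh_sgn f) (hh_diff f').
Proof.
move=> Cf; apply: tensor_inj; rewrite -tensor_diff tensor_cup.
apply/funext => s; apply/funext => m; rewrite leibniz; last first.
  by apply: ext_cochain_add; exact: tensor_is_cochain.
rewrite !tensor_diff -tensor_sgn -!tensor_cup.
by rewrite /tensor_cochain !fctE scalerDl.
Qed.

Lemma hh_diff_sgn f : hh_diff (hh_sgn f) = - hh_sgn (hh_diff f).
Proof.
apply: tensor_inj; rewrite -tensor_diff tensor_sgn.
apply/funext => s; apply/funext => m; rewrite ext_diff_sgn.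
by rewrite tensor_diff -tensor_sgn /tensor_cochain !fctE scaleNr.
Qed.

Lemma cup_nil f f' : cup_cochain f f' [::] = f [::] * f' [::].
Proof. by rewrite /cup_cochain big_ord1. Qed.

Lemma cup_cons f f' a s : cup_cochain f f' (a :: s) =
  f [::] * f' (a :: s) + cup_cochain (sft a f) f' s.
Proof. by rewrite /cup_cochain big_ord_recl. Qed.

Lemma cupDl f f' g :
  cup_cochain (f + f') g = cup_cochain f g + cup_cochain f' g.
Proof.
apply/funext => s; rewrite /cup_cochain !fctE -big_split.
by apply: eq_bigr => i _; rewrite ?fctE mulrDl.
Qed.

Lemma cupDr f g g' :
  cup_cochain f (g + g') = cup_cochain f g + cup_cochain f g'.
Proof.
apply/funext => s; rewrite /cup_cochain !fctE -big_split.
by apply: eq_bigr => i _; rewrite ?fctE mulrDr.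
Qed.

Lemma cupZl (c : k) f g : cup_cochain (c *: f) g = c *: cup_cochain f g.
Proof.
apply/funext => s; rewrite /cup_cochain ?fctE [RHS]scaler_sumr.
by apply: eq_bigr => i _; rewrite ?fctE scalerAl.
Qed.

Lemma cupZr (c : k) f g : cup_cochain f (c *: g) = c *: cup_cochain f g.
Proof.
apply/funext => s; rewrite /cup_cochain ?fctE [RHS]scaler_sumr.
by apply: eq_bigr => i _; rewrite ?fctE scalerAr.
Qed.

Lemma cupA : associative cup_cochain.
Proof.
move=> f g h; apply/funext => s; elim: s f g h => [|a s IH] f g h.
  by rewrite !cup_nil mulrA.
have -> : cup_cochain (cup_cochain f g) h (a :: s) =
    f [::] * g [::] * h (a :: s)
    + (f [::] * cup_cochain (sft a g) h s
       + cup_cochain (cup_cochain (sft a f) g) h s).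
  rewrite cup_cons cup_nil; congr (_ + _).
  rewrite /cup_cochain mulr_sumr -big_split; apply: eq_bigr => i _ /=.
  by rewrite [sft a _ _]cup_cons mulrDl mulrA.
by rewrite -IH !cup_cons mulrDr mulrA addrA.
Qed.

Lemma cup1l f : cup_cochain one_cochain f = f.
Proof.
apply/funext => -[|a s]; first by rewrite cup_nil mul1r.
rewrite cup_cons mul1r (_ : sft a one_cochain = fun=> 0) ?cup0l ?addr0 //.
Qed.

Lemma cup1r f : cup_cochain f one_cochain = f.
Proof.
apply/funext => s; elim: s f => [|a s IH] f; first by rewrite cup_nil mulr1.
by rewrite cup_cons IH mulr0 add0r.
Qed.

Lemma one_is_cochain : hh_cochain one_cochain.
Proof.
split=> [s1 s2 c x y|]; last by exists 1%N => -[].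
by rewrite /one_cochain !size_cat /= !addnS scaler0 addr0.
Qed.

Lemma hh_diff_one : hh_diff one_cochain = 0.
Proof.
apply/funext => -[//|a t]; rewrite -[RHS]/(0 : A) /hh_diff /=.
case: t => [|b t].
  by rewrite big_ord0 addr0 /one_cochain /= expr1 mulN1r mulr1 mul1r subrr.
rewrite mulr0 add0r [one_cochain (belast _ _) * _]mul0r mulr0 addr0 big1 // => i _.
by rewrite /one_cochain /contract size_cat /= addnS mulr0.
Qed.

Lemma hh_diff_lin (c : k) f g : hh_diff (c *: f + g) = c *: hh_diff f + hh_diff g.
Proof.
apply/funext => -[|a t]; rewrite !fctE /hh_diff; first by rewrite scaler0 addr0.
rewrite !mulrDr !mulrDl -!scalerAr -!scalerAl !mulrDr !scalerDr scaler_sumr.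
rewrite -!scalerAr.
under eq_bigr do rewrite mulrDr -scalerAr.
rewrite big_split /= !addrA.
by rewrite [LHS](ACl (1*3*5*2*4*6))%AC.
Qed.

Lemma hh_diff_zero : hh_diff 0 = 0.
Proof. by have := hh_diff_lin 1 0 0; rewrite !scale1r !addr0 => /esym/eqP; rewrite -subr_eq0 addrK => /eqP. Qed.

Lemma hh_cochain_lin (c : k) f g :
  hh_cochain f -> hh_cochain g -> hh_cochain (c *: f + g).
Proof.
move=> [fm [n fs]] [gm [n' gs]]; split.
  move=> *; rewrite !fctE fm gm !scalerDr !addrA (ACl (1*3*2*4))%AC.
  by rewrite !scalerA mulrC.
exists (n + n')%N => s h; rewrite !fctE fs ?gs ?scaler0 ?addr0 //.
  exact: leq_trans (leq_addl _ _) h.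
exact: leq_trans (leq_addr _ _) h.
Qed.

Lemma hh_cochain0 : hh_cochain 0.
Proof.
have z c : 0 = c *: 0 + 0 :> A by rewrite scaler0 addr0.
by split; [move=> s1 s2 c *; exact: (z c) | exists 0%N].
Qed.

Definition hh_cocycle_pred : {pred (seq A -> A)} :=
  [pred f | `[< hh_cochain f /\ hh_diff f = 0 >]].

Lemma hh_cocycle_submod : submod_closed hh_cocycle_pred.
Proof.
split=> [|c f g /asboolP [Cf df] /asboolP [Cg dg]]; apply/asboolP.
  by split; [exact: hh_cochain0 | exact: hh_diff_zero].
split; first exact: hh_cochain_lin.
by rewrite hh_diff_lin df dg scaler0 addr0.
Qed.
HB.instance Definition _ :=
  GRing.isSubmodClosed.Build k _ hh_cocycle_pred hh_cocycle_submod.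

Record hh_cocycle := HHCocycle {
  hh_cocycle_val :> seq A -> A;
  _ : hh_cocycle_val \in hh_cocycle_pred }.
HB.instance Definition _ := [isSub for hh_cocycle_val].
HB.instance Definition _ := [Choice of hh_cocycle by <:].
HB.instance Definition _ := [SubChoice_isSubLmodule of hh_cocycle by <:].

Lemma cup_is_cocycle (f g : hh_cocycle) :
  cup_cochain f g \in hh_cocycle_pred.
Proof.
have /asboolP [Cf df] := valP f; have /asboolP [Cg dg] := valP g.
apply/asboolP; split; first exact: cup_is_cochain.
by rewrite hh_leibniz // df dg cup0l cup0r addr0.
Qed.

Definition hh_cup (f g : hh_cocycle) : hh_cocycle :=
  HHCocycle (cup_is_cocycle f g).

Lemma one_is_cocycle : one_cochain \in hh_cocycle_pred.
Proof.
by apply/asboolP; split; [exact: one_is_cochain | exact: hh_diff_one].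
Qed.

Definition hh_one : hh_cocycle := HHCocycle one_is_cocycle.

Definition hh_coboundary : {pred hh_cocycle} :=
  [pred z : hh_cocycle |
     `[< exists2 g : seq A -> A, hh_cochain g & val z = hh_diff g >]].

Lemma hh_coboundary_submod : submod_closed hh_coboundary.
Proof.
split=> [|c z z' /asboolP [g Cg zE] /asboolP [g' Cg' zE']]; apply/asboolP.
  by exists 0; [exact: hh_cochain0 | rewrite hh_diff_zero].
exists (c *: g + g'); first exact: hh_cochain_lin.
by rewrite hh_diff_lin -zE -zE'.
Qed.

Lemma hh_coboundaryMl z w : w \in hh_coboundary -> hh_cup z w \in hh_coboundary.
Proof.
have /asboolP [Cz dz] := valP z => /asboolP [g Cg wE]; apply/asboolP.
have Csz := hh_sgn_cochain Cz.
exists (cup_cochain (hh_sgn z) g); first exact: cup_is_cochain.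
rewrite hh_leibniz // hh_sgnK hh_diff_sgn dz -wE.
rewrite (_ : - hh_sgn 0 = fun=> 0) ?cup0l ?add0r //.
by apply/funext => s; rewrite opprfctE /hh_sgn mulr0 oppr0.
Qed.

Lemma hh_coboundaryMr z w : w \in hh_coboundary -> hh_cup w z \in hh_coboundary.
Proof.
have /asboolP [Cz dz] := valP z => /asboolP [g Cg wE]; apply/asboolP.
exists (cup_cochain g z); first exact: cup_is_cochain.
by rewrite hh_leibniz // dz -wE cup0r addr0.
Qed.

Definition HH : Type := lquot hh_coboundary_submod.
HB.instance Definition _ := GRing.Lmodule.on HH.

Definition hh_class (z : hh_cocycle) : HH := lquot_pi hh_coboundary_submod z.
Definition hh_repr (x : HH) : hh_cocycle :=
  repr (x : @Quotient.quot _ (submod_pred hh_coboundary_submod)).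

Lemma hh_reprK x : hh_class (hh_repr x) = x.
Proof. exact: lquot_pi_surj. Qed.

Lemma hh_classP z w : hh_class z = hh_class w <-> z - w \in hh_coboundary.
Proof. exact: lquot_piE. Qed.

Lemma hh_classD : {morph hh_class : x y / x + y}.
Proof. exact: lquot_piD. Qed.

Lemma hh_classZ c z : hh_class (c *: z) = c *: hh_class z.
Proof. exact/esym/lquot_scaleE. Qed.

Definition hh_mul (x y : HH) : HH := hh_class (hh_cup (hh_repr x) (hh_repr y)).

Lemma hh_mulE z w : hh_mul (hh_class z) (hh_class w) = hh_class (hh_cup z w).
Proof.
set z1 := hh_repr (hh_class z); set w1 := hh_repr (hh_class w).
have /hh_classP hz : hh_class z1 = hh_class z by exact: hh_reprK.
have /hh_classP hw : hh_class w1 = hh_class w by exact: hh_reprK.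
apply/hh_classP.
have [_ hD] := hh_coboundary_submod.
have -> : hh_cup z1 w1 - hh_cup z w = 1 *: hh_cup (z1 - z) w1 + hh_cup z (w1 - w).
  rewrite scale1r; apply: val_inj => /=.
  rewrite -[- val z]scaleN1r -[- val w]scaleN1r cupDl cupDr cupZl cupZr !scaleN1r.
  by rewrite addrA subrK.
by apply: hD; [exact: hh_coboundaryMr | exact: hh_coboundaryMl].
Qed.

Lemma hh_mulA : associative hh_mul.
Proof.
move=> x y z; rewrite -(hh_reprK x) -(hh_reprK y) -(hh_reprK z) !hh_mulE.
by congr hh_class; apply: val_inj; exact: cupA.
Qed.

Lemma hh_mul1l : left_id (hh_class hh_one) hh_mul.
Proof.
move=> x; rewrite -(hh_reprK x) hh_mulE.
by congr hh_class; apply: val_inj; exact: cup1l.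
Qed.

Lemma hh_mul1r : right_id (hh_class hh_one) hh_mul.
Proof.
move=> x; rewrite -(hh_reprK x) hh_mulE.
by congr hh_class; apply: val_inj; exact: cup1r.
Qed.

Lemma hh_mulDl : left_distributive hh_mul +%R.
Proof.
move=> x y z; rewrite -(hh_reprK x) -(hh_reprK y) -(hh_reprK z).
rewrite -hh_classD !hh_mulE -hh_classD.
by congr hh_class; apply: val_inj; exact: cupDl.
Qed.

Lemma hh_mulDr : right_distributive hh_mul +%R.
Proof.
move=> x y z; rewrite -(hh_reprK x) -(hh_reprK y) -(hh_reprK z).
rewrite -hh_classD !hh_mulE -hh_classD.
by congr hh_class; apply: val_inj; exact: cupDr.
Qed.

Lemma hh_one_neq0 : hh_class hh_one != 0.
Proof.
apply/eqP; have -> : (0 : HH) = hh_class 0.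
  by apply: (@addIr _ (hh_class 0)); rewrite -hh_classD !add0r.
move/hh_classP/asboolP => [g _]; rewrite subr0 /= => /(congr1 (@^~ [::])).
by move/eqP; rewrite /one_cochain /hh_diff /= oner_eq0.
Qed.

HB.instance Definition _ := GRing.Zmodule_isNzRing.Build HH
  hh_mulA hh_mul1l hh_mul1r hh_mulDl hh_mulDr hh_one_neq0.

Lemma hh_classM z w : hh_class z * hh_class w = hh_class (hh_cup z w).
Proof. exact: hh_mulE. Qed.

Lemma hh_scalerAl (c : k) (x y : HH) : c *: (x * y) = c *: x * y.
Proof.
rewrite -(hh_reprK x) -(hh_reprK y) -[c *: hh_class (hh_repr x)]hh_classZ.
rewrite !hh_classM -hh_classZ.
by congr hh_class; apply: val_inj; rewrite /= cupZl.
Qed.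

Lemma hh_scalerAr (c : k) (x y : HH) : c *: (x * y) = x * (c *: y).
Proof.
rewrite -(hh_reprK x) -(hh_reprK y) -[c *: hh_class (hh_repr y)]hh_classZ.
rewrite !hh_classM -hh_classZ.
by congr hh_class; apply: val_inj; rewrite /= cupZr.
Qed.

HB.instance Definition _ := GRing.Lmodule_isLalgebra.Build k HH hh_scalerAl.
HB.instance Definition _ := GRing.Lalgebra_isAlgebra.Build k HH hh_scalerAr.

(* HH^n(A) *)
Definition HH_deg (n : nat) : set HH :=
  [set x | exists2 z : hh_cocycle, x = hh_class z
         & forall s, size s != n -> z s = 0].

Lemma tensor_is_cocycle (M : lmodType A) (z : hh_cocycle) :
  tensor_cochain z \in @ext_cocycle_pred M M.
Proof.
have /asboolP [Cz dz] := valP z; apply/asboolP; split.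
  exact: tensor_is_cochain.
rewrite tensor_diff dz; apply/funext => s; apply/funext => m.
by rewrite /tensor_cochain scale0r.
Qed.

Definition tensor_cocycle (M : lmodType A) (z : hh_cocycle) :
  ext_cocycle M M := ExtCocycle (tensor_is_cocycle M z).

(* The homomorphism HH^*(A) -> Ext^*_A(M, M) induced by - (x)_A M. *)
Definition HH_to_Ext (M : lmodType A) (x : HH) : Ext M M :=
  ext_class (tensor_cocycle M (hh_repr x)).

Lemma HH_to_ExtE (M : lmodType A) (z : hh_cocycle) :
  HH_to_Ext M (hh_class z) = ext_class (tensor_cocycle M z).
Proof.
have /hh_classP/asboolP[g Cg zE] : hh_class (hh_repr (hh_class z)) = hh_class z.
  exact: hh_reprK.
apply/ext_classP; exists (tensor_cochain g); first exact: tensor_is_cochain.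
rewrite tensor_diff -zE; apply/funext => s; apply/funext => m.
by rewrite /= /tensor_cochain !fctE scalerBl.
Qed.

(* H acts through the Yoneda product with the image of H in Ext^*_A(M, M); H is
   commutative, so the side does not matter. The products of cochains carry no
   signs: the Koszul signs (-1)^{pq} change neither the graded submodules nor
   the homogeneous annihilators. *)
Definition HH_act (M N : lmodType A) (x : Ext M N) (h : HH) : Ext M N :=
  yoneda x (HH_to_Ext M h).

End BarComplex.

Section SupportVariety.
Variables (k : fieldType) (A : falgType k) (H : comAlgType k).

(* A commutative subalgebra of HH^*(A) is given by an injective algebra
   homomorphism iota : H -> HH^*(A). *)
Variable iota : {lrmorphism H -> HH A}.

(* The image of iota is the direct sum of its homogeneous components. *)
Definition graded_subalgebra : Prop :=
  injective iota /\
  forall h : H, exists (n : nat) (c : nat -> H),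
    h = \sum_(i < n) c i /\ forall i, HH_deg i (iota (c i)).

Definition contains_HH0 : Prop :=
  forall x : HH A, HH_deg 0 x -> exists h, iota h = x.

Definition Ext_finitely_generated (M N : lmodType A) : Prop :=
  exists s : seq (Ext M N), forall x : Ext M N, exists c : nat -> H,
    x = \sum_(i < size s) HH_act s`_i (iota (c i)).

Definition Ann_Ext (M N : lmodType A) : set H :=
  [set h | forall x : Ext M N, HH_act x (iota h) = 0].

Definition support_variety (M : lmodType A) : set (set H) :=
  zariski_locus (Ann_Ext M (mod_radical A)).

(* V_H(M) is a cone, possibly with several components; it is a line in the sense
   of being one-dimensional. *)
Definition is_line (V : set (set H)) : Prop := variety_dim V 1.

End SupportVariety.

(* Main.v *)
(* With [E = Ext(M, A/r)], graded and finitely generated over [H], the variety is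
   a line iff [E] is not eventually zero and [E / xE] is eventually zero for some
   homogeneous [x] of positive degree [d], a parameter; equivalently, iff the
   degrees of [E] are of bounded dimension, not eventually zero. As
   [E^n = Hom(Omega^n M, A/r)] for a minimal resolution, this says that the
   complexity is 1.
   A parameter acts injectively on [E] in large degrees, by Noetherianity. There
   [x] is induced by a map [Omega^(n+d) M -> Omega^n M], which is then surjective;
   the dimensions of the syzygies being bounded, one such map is an isomorphism.
   Over a selfinjective algebra, [Omega] is invertible on modules without
   projective summands, so the isomorphism descends to the nonprojective part [X]
   of [M], giving [Omega^d X = X]. *)
From HB Require Import structures.
Require Import Defs.
From mathcomp Require Import all_boot all_order all_algebra all_field.
From mathcomp Require Import boolp classical_sets functions reals.

Set Implicit Arguments.
Unset Strict Implicit.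
Unset Printing Implicit Defensive.

Import GRing.Theory.
Local Open Scope classical_set_scope.
Local Open Scope ring_scope.

(** * Maximal and prime ideals *)

(** Points of the variety are maximal ideals, so an ideal is seen only through the intersection of
    the maximal ideals above it. The closure [jrad] therefore takes the place of the radical, and
    its homogeneity comes from the action of nonzero scalars by dilation. Dimension at most 1
    follows from a parameter [x] by integrality over [k[x]]. The way back, from bounded degrees to a
    parameter, is a counting argument: two nested relevant primes would give more independent
    monomials in one degree than can act on the generators of [E] without a relation. The
    identification of degree [n] of [E] with maps out of the [n]-th syzygy must respect the
    Hochschild action. On bar cochains this is done by one explicit cocycle of degree 1 for each
    short exact sequence, which commutes with Hochschild classes up to sign and coboundary. The
    descent cannot reach [M], which may have projective summands. It stops at the first syzygy,
    which [M] shares with its nonprojective part [X], and the last cancellation is made against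
    [X]. *)

Section Ideals.
Variable H : comNzRingType.
Implicit Types (I J P m : set H) (a b x y : H).

Lemma lideal0 I : left_ideal I -> I 0. Proof. by case. Qed.

Lemma lidealD I x y : left_ideal I -> I x -> I y -> I (x + y).
Proof. by move=> [_ h] Ix Iy; have := h 1 _ _ Ix Iy; rewrite scale1r. Qed.

Lemma lidealMl I a x : left_ideal I -> I x -> I (a * x).
Proof. by move=> [h0 h] Ix; have := h a _ _ Ix h0; rewrite addr0. Qed.

Lemma lidealMr I a x : left_ideal I -> I x -> I (x * a).
Proof. by rewrite mulrC; exact: lidealMl. Qed.

Lemma lidealN I x : left_ideal I -> I x -> I (- x).
Proof. by move=> hI Ix; rewrite -mulN1r; exact: lidealMl. Qed.

Lemma lidealB I x y : left_ideal I -> I x -> I y -> I (x - y).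
Proof. by move=> hI Ix Iy; apply: lidealD => //; exact: lidealN. Qed.

Lemma lidealP I : I 0 -> (forall x y, I x -> I y -> I (x + y)) ->
  (forall a x, I x -> I (a * x)) -> left_ideal I.
Proof. by move=> h0 hD hM; split=> // a x y Ix Iy; apply: (hD) => //; apply: (hM). Qed.

Lemma lideal_sum I (K : Type) (r : seq K) (p : pred K) (F : K -> H) :
  left_ideal I -> (forall i, p i -> I (F i)) -> I (\sum_(i <- r | p i) F i).
Proof.
move=> hI h; apply: (big_ind I) => // [|x y]; first exact: lideal0.
exact: lidealD.
Qed.

(** The ideal [I + (a)]. *)
Definition adjoin I a : set H := [set h | exists b, I (h - b * a)].

Lemma adjoin_ideal I a : left_ideal I -> left_ideal (adjoin I a).
Proof.
move=> hI; apply: lidealP => [|x y [b hb] [c hc]|d x [b hb]].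
- by exists 0; rewrite mul0r subr0; exact: lideal0.
- by exists (b + c); rewrite mulrDl opprD addrACA; exact: lidealD.
- by exists (d * b); rewrite -mulrA -mulrBr; exact: lidealMl.
Qed.

Lemma adjoin_sub I a : left_ideal I -> I `<=` adjoin I a.
Proof. by move=> hI x Ix; exists 0; rewrite mul0r subr0. Qed.

Lemma adjoin_self I a : left_ideal I -> adjoin I a a.
Proof. by move=> hI; exists 1; rewrite mul1r subrr; exact: lideal0. Qed.

Lemma adjoin_min I J a : left_ideal J -> I `<=` J -> J a -> adjoin I a `<=` J.
Proof.
move=> hJ IJ Ja x [b hb]; rewrite -(subrK (b * a) x).
by apply: lidealD => //; [exact: IJ | exact: lidealMl].
Qed.

Definition prime_ideal P :=
  [/\ left_ideal P, ~ P 1 & forall a b, P (a * b) -> P a \/ P b].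

Lemma maximal_prime m : maximal_left_ideal m -> prime_ideal m.
Proof.
move=> [hm m1 mx]; split=> // a b mab; case: (pselect (m a)) => [|na]; first by left.
right; have [c hc] : adjoin m a 1.
  apply: contrapT => n1; apply: na.
  apply: (mx _ (adjoin_ideal a hm) (@adjoin_sub _ _ hm) n1).
  exact: adjoin_self.
rewrite -[b]mul1r -(subrK (c * a) 1) mulrDl.
by apply: lidealD => //; [exact: lidealMr | rewrite -mulrA; exact: lidealMl].
Qed.

Lemma prime_exp P a n : prime_ideal P -> P (a ^+ n) -> P a.
Proof.
move=> [hP P1 PM]; elim: n => [|n IH]; first by rewrite expr0.
by rewrite exprS => /PM[].
Qed.

Lemma lideal_exp I a n : left_ideal I -> (0 < n)%N -> I a -> I (a ^+ n).
Proof. by case: n => // n hI _ Ia; rewrite exprS; exact: lidealMr. Qed.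

(** Modulo [P] every element is a scalar, so the quotient ring is the field [k]. *)
Lemma scalar_maximal (k : fieldType) (f : {rmorphism k -> H}) P :
  left_ideal P -> ~ P 1 -> (forall h, exists c, P (h - f c)) -> maximal_left_ideal P.
Proof.
move=> hP P1 hc; split=> // J hJ PJ J1 h Jh; have [c hh] := hc h.
have Jc : J (f c) by rewrite -(subKr h (f c)); apply: lidealB => //; exact: PJ.
have [c0|c0] := eqVneq c 0; first by move: hh; rewrite c0 rmorph0 subr0.
by case: J1; rewrite -(rmorph1 f) -(mulVf c0) rmorphM; exact: lidealMl.
Qed.

Hypothesis noeth : noetherian H.

(** The ascending chain condition in the form of maximal elements: a family without one above [I0]
    yields by choice a strictly increasing chain, but finitely many generators of its union already
    lie in one term. *)
Lemma lideal_max (F : set (set H)) I0 : F I0 -> (forall I, F I -> left_ideal I) ->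
  exists I, [/\ F I, I0 `<=` I & forall J, F J -> I `<=` J -> J `<=` I].
Proof.
move=> F0 FI; apply: contrapT => hno.
(* The assumptions on [I] sit under the existential so that [choice] yields a total function on
   sets. *)
have step (I : set H) : exists J, F I -> I0 `<=` I -> [/\ F J, I `<=` J & ~ J `<=` I].
  case: (pselect (F I /\ I0 `<=` I)) => [[FI1 s]|h]; last first.
    by exists I => FI1 s; case: h.
  apply: contrapT => h2; apply: hno; exists I; split=> // J FJ IJ.
  by apply: contrapT => nJ; apply: h2; exists J.
have [nx hnx] := choice step.
pose s n := iter n nx I0.
have sP n : F (s n) /\ I0 `<=` s n.
  elim: n => [|n [h1 h2]]; first by split.
  rewrite [s _]/=; have [h3 h4 _] := hnx _ h1 h2; split=> //.
  exact: subset_trans h4.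
have sS n : s n `<=` s n.+1 by have [h1 h2] := sP n; case: (hnx _ h1 h2).
have smono n j : s n `<=` s (n + j)%N.
  by elim: j => [|j IH]; rewrite ?addn0 // addnS; apply: subset_trans IH _.
pose U : set H := [set h | exists n, s n h].
have hU : left_ideal U.
  have sI n : left_ideal (s n) by apply: FI; case: (sP n).
  apply: lidealP => [|x y [n hn] [n' hn']|a x [n hn]].
  - by exists 0%N; exact: lideal0.
  - exists (n + n')%N; apply: lidealD => //; first exact: (smono n n' x).
    by rewrite addnC; exact: smono.
  - by exists n; exact: lidealMl.
have [g [gU gen]] := noeth hU.
have [n hn] : exists n, forall x, x \in g -> s n x.
  elim: g gU {gen} => [|x g IH] gU; first by exists 0%N.
  have [|n hn] := IH; first by move=> y yg; apply: gU; rewrite inE yg orbT.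
  have [n' hn'] := gU x (mem_head _ _).
  exists (n + n')%N => y; rewrite inE => /orP[/eqP ->|yg].
    by rewrite addnC; exact: smono.
  by apply: smono; exact: hn.
have [h1 h2] := sP n; have [_ _] := hnx _ h1 h2; apply=> x xs.
have [c ->] : exists c : nat -> H, x = \sum_(i < size g) c i * g`_i.
  by apply: gen; exists n.+1.
apply: lideal_sum => [|i _]; first exact: FI.
by apply: lidealMl; [exact: FI | apply: hn; rewrite mem_nth].
Qed.

Lemma maximal_above I : left_ideal I -> ~ I 1 ->
  exists2 m, maximal_left_ideal m & I `<=` m.
Proof.
move=> hI I1.
have [|J [hJ J1]|m [[hm m1] Im mx]] := @lideal_max [set J | left_ideal J /\ ~ J 1] I.
- by [].
- by [].
- by exists m => //; split=> // J hJ mJ J1; exact: mx.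
Qed.

(** The ideal of all functions vanishing on the locus of [I]. Inclusion of [jrad I] in [I] is used
    throughout to say that [I] is closed. *)
Definition jrad I : set H :=
  [set h | forall m, maximal_left_ideal m -> I `<=` m -> m h].

Lemma jrad_ideal I : left_ideal (jrad I).
Proof.
apply: lidealP => [|x y hx hy|a x hx] m mm Im; have [hm _ _] := mm.
- exact: lideal0.
- by apply: lidealD => //; [exact: hx | exact: hy].
- by apply: lidealMl => //; exact: hx.
Qed.

Lemma sub_jrad I : I `<=` jrad I. Proof. by move=> x Ix m _; exact. Qed.

Lemma jradS I J : I `<=` J -> jrad I `<=` jrad J.
Proof. by move=> IJ h hh m mm Jm; apply: hh => //; exact: subset_trans Jm. Qed.

Lemma jrad_idem I : jrad (jrad I) `<=` jrad I.
Proof. by move=> h hh m mm Im; apply: hh => // x hx; exact: hx. Qed.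

(** Maximal ideals are prime, so the locus of [I] is the union of the loci of [I + (a)] and
    [I + (b)]. *)
Lemma jrad_adjoinI I a b : left_ideal I -> I (a * b) ->
  forall h, jrad (adjoin I a) h -> jrad (adjoin I b) h -> jrad I h.
Proof.
move=> hI Iab h ha hb m mm Im; have [hm _ _] := mm.
have [_ _ mP] := maximal_prime mm.
by case: (mP _ _ (Im _ Iab)) => ma; [apply: ha | apply: hb] => //; exact: adjoin_min.
Qed.

(** If neither closed set contains the locus, their equations provide [s] and [t] outside [P]; the
    product vanishes on the whole locus, hence lies in the closed ideal [P], which is prime. *)
Lemma locus_irreducible P : prime_ideal P -> jrad P `<=` P ->
  zariski_irreducible (zariski_locus P).
Proof.
move=> [hP P1 PM] rP; split.
  by have [m mm Pm] := maximal_above hP P1; exists m.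
move=> A B [S ->] [T ->] sub; apply: contrapT => /not_orP [nA nB].
have pick (U : set H) : ~ zariski_locus P `<=` zariski_locus U -> exists2 u, U u & ~ P u.
  move=> nU; apply: contrapT => h; apply: nU => m [mm Pm]; split=> // u Uu.
  by apply: contrapT => nmu; apply: h; exists u => // /Pm.
have [s Ss nPs] := pick _ nA; have [t Tt nPt] := pick _ nB.
have : P (s * t).
  apply: rP => m mm Pm; have [hm _ _] := mm.
  have [|[_ Sm]|[_ Tm]] := sub m; first by [].
    by apply: lidealMr => //; exact: Sm.
  by apply: lidealMl => //; exact: Tm.
by move/PM => [].
Qed.

Definition vanish (Z : set (set H)) : set H := [set h | forall m, Z m -> m h].

Lemma vanish_ideal Z : Z `<=` @MaxSpec H -> left_ideal (vanish Z).
Proof.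
move=> ZM; apply: lidealP => [|x y hx hy|a x hx] m Zm; have [hm _ _] := ZM _ Zm.
- exact: lideal0.
- by apply: lidealD => //; [exact: hx | exact: hy].
- by apply: lidealMl => //; exact: hx.
Qed.

Lemma zariski_closed_max Z : zariski_closed Z -> Z `<=` @MaxSpec H.
Proof. by move=> [S ->] m []. Qed.

Lemma vanishK Z : zariski_closed Z -> zariski_locus (vanish Z) = Z.
Proof.
move=> [S ->]; apply/seteqP; split=> [m [mm h]|m [mm h]].
  by split=> // x Sx; apply: h => m' [_]; exact.
by split=> // x; apply.
Qed.

Lemma vanish_prime Z : zariski_closed Z -> zariski_irreducible Z ->
  prime_ideal (vanish Z).
Proof.
move=> cZ [[m0 Zm0] iZ]; split; first exact/vanish_ideal/zariski_closed_max.
  by move=> /(_ _ Zm0); have [_ ] := zariski_closed_max cZ Zm0.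
move=> a b hab.
have [|||h|h] := iZ (zariski_locus [set a]) (zariski_locus [set b]).
- by exists [set a].
- by exists [set b].
- move=> m Zm; have mm := zariski_closed_max cZ Zm.
  have [_ _ mP] := maximal_prime mm.
  by case: (mP _ _ (hab m Zm)) => ?; [left | right]; split=> // x ->.
- by left=> m /h [_]; apply.
- by right=> m /h [_]; apply.
Qed.

Lemma vanishS (Z Z' : set (set H)) : Z `<=` Z' -> vanish Z' `<=` vanish Z.
Proof. by move=> ZZ h hh m /ZZ; exact: hh. Qed.

End Ideals.

(** The grading is given by its component maps rather than by a family of subgroups; [x] is
    homogeneous of degree [n] when [pE n x = x]. Applied to [H^o], the same definition grades the
    ring itself. *)
Definition graded (H : comNzRingType) (pH : nat -> H -> H) (E : lmodType H)
    (pE : nat -> E -> E) : Prop :=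
  [/\ forall n x y, pE n (x + y) = pE n x + pE n y,
      forall x, exists N, x = \sum_(n < N) pE n x,
      forall m n x, pE m (pE n x) = if m == n then pE n x else 0
    & forall d n h x, pE n (pH d h *: x) =
        if (d <= n)%N then pH d h *: pE (n - d)%N x else 0].

(** * Graded rings and modules *)

Section GradedModule.
Variables (H : comNzRingType) (pH : nat -> H -> H) (E : lmodType H).
Variable pE : nat -> E -> E.
Hypothesis grH : graded pH (pH : nat -> H^o -> H^o).
Hypothesis grE : graded pH pE.

Lemma gradedD n x y : pE n (x + y) = pE n x + pE n y.
Proof. by case: grE. Qed.
Lemma graded0 n : pE n 0 = 0.
Proof. by have := gradedD n 0 0; rewrite addr0 => /eqP; rewrite eq_sym -subr_eq0 addrK => /eqP. Qed.
Lemma gradedN n x : pE n (- x) = - pE n x.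
Proof. by apply/eqP; rewrite -addr_eq0 -gradedD addNr graded0. Qed.
Lemma gradedB n x y : pE n (x - y) = pE n x - pE n y.
Proof. by rewrite gradedD gradedN. Qed.
Lemma graded_sum n (I : Type) (r : seq I) (P : pred I) F :
  pE n (\sum_(i <- r | P i) F i) = \sum_(i <- r | P i) pE n (F i).
Proof. exact: (big_morph _ (gradedD n) (graded0 n)). Qed.
Lemma graded_deg n x m : pE n x = x -> pE m x = if m == n then x else 0.
Proof. by move=> xE; case: grE => _ _ h _; have := h m n x; rewrite xE. Qed.
Lemma graded_idem n x : pE n (pE n x) = pE n x.
Proof. by case: grE => _ _ -> _; rewrite eqxx. Qed.

Lemma graded_bound x : exists N, (forall n, (N <= n)%N -> pE n x = 0) /\
  (forall M, (N <= M)%N -> x = \sum_(n < M) pE n x).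
Proof.
case: grE => _ /(_ x) [N xN] pp _; exists N.
have z n : (N <= n)%N -> pE n x = 0.
  move=> Nn; rewrite xN graded_sum big1 // => i _; rewrite pp.
  by case: eqP => // ni; have := ltn_ord i; rewrite -ni ltnNge Nn.
split=> // M NM; rewrite {1}xN (big_ord_widen M (fun i => pE i x) NM).
rewrite big_mkcond /=; apply: eq_bigr => i _.
by case: ltnP => // h; rewrite z.
Qed.

Lemma graded_ext x y : (forall n, pE n x = pE n y) -> x = y.
Proof.
move=> xy; have [N [_ hx]] := graded_bound x; have [N' [_ hy]] := graded_bound y.
rewrite (hx (N + N')%N) ?leq_addr // (hy (N + N')%N) ?leq_addl //.
exact: eq_bigr.
Qed.

Lemma gradedZ d h n x : pH d h = h ->
  pE n (h *: x) = if (d <= n)%N then h *: pE (n - d)%N x else 0.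
Proof. by move=> hE; case: grE => _ _ _ /(_ d n h x); rewrite hE. Qed.

Lemma gradedZD d h n x : pH d h = h -> pE (n + d)%N (h *: x) = h *: pE n x.
Proof. by move=> hE; rewrite (gradedZ _ _ hE) leq_addl addnK. Qed.

Lemma gradedM d h n x : pH d h = h -> pE n x = x -> pE (n + d)%N (h *: x) = h *: x.
Proof. by move=> hE xE; rewrite gradedZD // xE. Qed.

End GradedModule.

(** * Dilations, homogeneous radicals and homogeneous primes *)

Section GradedRing.
Variables (k : closedFieldType) (H : comAlgType k) (pH : nat -> H -> H).
Hypothesis grH : graded pH (pH : nat -> H^o -> H^o).
Hypothesis pH_scalar : forall c : k, pH 0%N c%:A = c%:A.
Hypothesis noeth : noetherian H.
(** The degree 0 part is local with residue field [k]. For the Hochschild ring this comes from the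
    centre of an indecomposable algebra, see [center_local]. *)
Hypothesis local0 : forall h, pH 0%N h = h -> exists (c : k) n, (h - c%:A) ^+ n = 0.

Lemma degM a b x y : pH a x = x -> pH b y = y -> pH (a + b)%N (x * y) = x * y.
Proof. by move=> xa yb; rewrite addnC; exact: (gradedM grH (E := H^o)). Qed.

Lemma deg1 : pH 0%N 1 = 1.
Proof. by have := pH_scalar 1; rewrite scale1r. Qed.

Lemma degX d x n : pH d x = x -> pH (n * d)%N (x ^+ n) = x ^+ n.
Proof.
move=> xd; elim: n => [|n IH]; first by rewrite expr0 mul0n deg1.
by rewrite exprS mulSn; exact: degM.
Qed.

Lemma degZ (c : k) n h : pH n (c *: h) = c *: pH n h.
Proof.
rewrite -(mulr_algl c h) -(mulr_algl c (pH n h)).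
by have := gradedZ grH n (h : H^o) (pH_scalar c); rewrite leq0n subn0.
Qed.

(** Here the vector is homogeneous and the scalar arbitrary; the last clause of [graded] is the
    opposite case. *)
Lemma gradedZr (E : lmodType H) (pE : nat -> E -> E) (grE : graded pH pE) j n h x :
  pE j x = x -> pE n (h *: x) = if (j <= n)%N then pH (n - j)%N h *: x else 0.
Proof.
move=> xj; have [N [z hN]] := graded_bound grH (h : H^o).
rewrite {1}(hN _ (leqnn N)) scaler_suml (graded_sum grE).
under eq_bigr => i _.
  rewrite (gradedZ grE (d := i) (h := pH i h)); last exact: (graded_idem grH).
  rewrite (graded_deg grE _ xj); over.
case: leqP => jn; last first.
  rewrite big1 // => i _; case: leqP => // ni.
  by case: eqP => [e|_]; [move: jn; rewrite -e ltnNge leq_subr | rewrite scaler0].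
have h1 (i : nat) : ((if (i <= n)%N then pH i h *: (if (n - i)%N == j then x else 0) else 0) =
     if i == (n - j)%N then pH i h *: x else 0).
  case: leqP => ni; first rewrite -(eqn_add2r i) subnK // -(eqn_add2r j i) subnK //.
    by rewrite addnC eq_sym; case: eqP => // _; rewrite scaler0.
  by case: eqP => // e; move: ni; rewrite e ltnNge leq_subr.
under eq_bigr do rewrite h1.
rewrite -big_mkcond; case: (ltnP (n - j) N) => [lt|ge].
  by rewrite (big_pred1 (Ordinal lt)).
by rewrite z // scale0r big1 // => i /eqP e; move: (ltn_ord i); rewrite e ltnNge ge.
Qed.

Definition homog_ideal (J : set H) := left_ideal J /\ forall n h, J h -> J (pH n h).

(** An algebraically closed field is infinite, so some nonzero element is no root of the product of
    the polynomials [X^j - 1]. *)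
Lemma nonroot_powers N : exists2 d : k, d != 0 & forall j, (0 < j <= N)%N -> d ^+ j != 1.
Proof.
pose p : {poly k} := 'X * \prod_(i < N) ('X^(i.+1) - 1).
have p0 : p != 0.
  rewrite mulf_neq0 ?polyX_eq0 //; apply/prodf_neq0 => i _.
  by rewrite monic_neq0 // monicXnsubC.
have /closed_nonrootP [d] := p0; rewrite rootM rootX negb_or => /andP[d0 dp].
exists d => // -[//|j] /= jN; apply: contra dp => /eqP dj.
rewrite /root horner_prod (bigD1 (Ordinal jN)) //=.
by rewrite !hornerE dj subrr mul0r.
Qed.

(** A Vandermonde argument by induction: replacing [c] by [d * c] and subtracting [d ^+ N] times the
    original relation removes the top coefficient and multiplies the others by the nonzero scalars
    [d ^+ i - d ^+ N]. *)
Lemma interpolate (I : set H) (hI : left_ideal I) N (f : nat -> H) :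
  (forall c : k, c != 0 -> I (\sum_(i < N) c ^+ i *: f i)) ->
  forall i, (i < N)%N -> I (f i).
Proof.
have IZ (c : k) x : I x -> I (c *: x) by rewrite -mulr_algl; exact: lidealMl.
elim: N f => [//|N IH] f hf.
have [d d0 dN] := nonroot_powers N.
have low i : (i < N)%N -> I (f i).
  move=> iN; have nz : d ^+ i - d ^+ N != 0.
    rewrite subr_eq0 -(subnKC (ltnW iN)) exprD -[X in X == _]mulr1.
    rewrite (inj_eq (mulfI _)) ?expf_neq0 // eq_sym; apply: dN.
    by rewrite subn_gt0 iN leq_subr.
  have -> : f i = (d ^+ i - d ^+ N)^-1 *: ((d ^+ i - d ^+ N) *: f i).
    by rewrite scalerA mulVf // scale1r.
  apply: (IZ); apply: (IH (fun i => (d ^+ i - d ^+ N) *: f i)) => // c c0.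
  have := lidealB hI (hf _ (mulf_neq0 d0 c0)) (IZ (d ^+ N) _ (hf _ c0)).
  rewrite !big_ord_recr /= scalerDr scaler_sumr opprD addrACA -sumrB.
  rewrite scalerA -exprMn subrr addr0.
  congr I; apply: eq_bigr => j _.
  by rewrite scalerA -scalerBl exprMn -mulrBl mulrC scalerA.
move=> i; rewrite ltnS leq_eqVlt => /orP[/eqP->|]; last exact: low.
have := hf 1 (oner_neq0 _); rewrite big_ord_recr /= expr1n scale1r => h.
have := lidealB hI h (lideal_sum (index_enum 'I_N) (p := xpredT) (F := fun j : 'I_N => 1 ^+ j *: f j) hI _).
rewrite addrAC subrr add0r; apply=> j _; apply: (IZ); exact: low.
Qed.

(** [dilate_bound] picks a degree from which on the components vanish. For nonzero [c], [dilate c]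
    is the ring automorphism of [H] that acts on degree [n] as [c ^+ n]. *)
Definition dilate_bound (h : H) : nat := projT1 (cid (graded_bound grH (h : H^o))).
Definition dilate (c : k) (h : H) : H := \sum_(n < dilate_bound h) c ^+ n *: pH n h.

Lemma deg_dilate c n h : pH n (dilate c h) = c ^+ n *: pH n h.
Proof.
rewrite /dilate /dilate_bound; case: cid => N /= [z _].
rewrite (graded_sum (E := H^o) grH).
have e (i : nat) : pH n (c ^+ i *: pH i h) = if i == n then c ^+ n *: pH n h else 0.
  rewrite degZ (graded_deg grH n (n := i) (x := (pH i h : H^o))); last exact: (graded_idem grH).
  by rewrite eq_sym; case: eqP => [->|_] //; rewrite scaler0.
under eq_bigr do rewrite e.
rewrite -big_mkcond; case: (ltnP n N) => [lt|ge].
  by rewrite (big_pred1 (Ordinal lt)).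
by rewrite [pH n h]z // scaler0 big1 // => i /eqP ei; move: (ltn_ord i); rewrite ei ltnNge ge.
Qed.

Lemma dilateP c h g : (forall n, pH n g = c ^+ n *: pH n h) -> g = dilate c h.
Proof. by move=> hg; apply: (graded_ext grH (x := (g : H^o))) => n; rewrite hg deg_dilate. Qed.

Lemma dilateK c h : c != 0 -> dilate c (dilate c^-1 h) = h.
Proof.
move=> c0; apply/esym/dilateP => n; rewrite deg_dilate scalerA -exprMn.
by rewrite divff // expr1n scale1r.
Qed.

Lemma dilateD c x y : dilate c (x + y) = dilate c x + dilate c y.
Proof.
apply/esym/dilateP => n; rewrite [LHS](gradedD (E := H^o) grH) !deg_dilate.
by rewrite [pH n (x + y)](gradedD (E := H^o) grH) scalerDr.
Qed.

Lemma dilate0 c : dilate c 0 = 0.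
Proof.
have p0 n : pH n 0 = 0 := graded0 (E := H^o) grH n.
by apply/esym/dilateP => n; rewrite p0 scaler0.
Qed.

Lemma dilate_sum c (I : Type) (r : seq I) (F : I -> H) :
  dilate c (\sum_(i <- r) F i) = \sum_(i <- r) dilate c (F i).
Proof. exact: (big_morph _ (dilateD c) (dilate0 c)). Qed.

Lemma dilate_homog c d x : pH d x = x -> dilate c x = c ^+ d *: x.
Proof.
move=> xd; apply/esym/dilateP => n; rewrite degZ (graded_deg (E := H^o) grH n xd).
by case: eqP => [->|_]; rewrite // !scaler0.
Qed.

Lemma dilateM c x y : dilate c (x * y) = dilate c x * dilate c y.
Proof.
have homog d a b : pH d a = a -> dilate c (a * b) = dilate c a * dilate c b.
  move=> ad; rewrite (dilate_homog c ad); apply/esym/dilateP => n.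
  rewrite -scalerAl degZ.
  rewrite ![pH n _](gradedZ (E := H^o) grH n _ ad); case: leqP => dn; last by rewrite !scaler0.
  have mulE (u : H) : (a : H) *: (u : H^o) = a * u by []. rewrite deg_dilate !mulE -scalerAr scalerA -exprD subnKC //.
have [N [_ hN]] := graded_bound grH (x : H^o).
rewrite (hN _ (leqnn N)) mulr_suml !dilate_sum mulr_suml.
by apply: eq_bigr => i _; apply: (homog i); exact: (graded_idem grH).
Qed.

Lemma dilate1 c : dilate c 1 = 1.
Proof. by rewrite (dilate_homog c deg1) expr0 scale1r. Qed.

Lemma dilate_maximal c m : c != 0 -> maximal_left_ideal m ->
  maximal_left_ideal [set h | m (dilate c h)].
Proof.
have pre (b : k) (J : set H) : left_ideal J -> left_ideal [set h | J (dilate b h)].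
  move=> hJ; apply: lidealP => [|x y hx hy|a x hx] /=.
  - by rewrite dilate0; exact: lideal0.
  - by rewrite dilateD; exact: lidealD.
  - by rewrite dilateM; exact: lidealMl.
move=> c0 [hm m1 mx]; split; [exact: pre | by rewrite /= dilate1 |].
move=> J hJ mJ J1 h Jh /=.
apply: (mx [set h | J (dilate c^-1 h)]) => /=.
- exact: pre.
- by move=> g mg; apply: mJ; rewrite /= dilateK.
- by rewrite dilate1.
- by have /= := @dilateK c^-1 h; rewrite invrK invr_eq0 => ->.
Qed.

(** Dilations permute the maximal ideals above the homogeneous ideal [J], so [jrad J] is stable
    under all of them, and interpolation extracts the components of its elements. *)
Lemma jrad_homog J : homog_ideal J -> homog_ideal (jrad J).
Proof.
move=> [hJ Jh]; split; first exact: jrad_ideal.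
have dil c h : c != 0 -> jrad J h -> jrad J (dilate c h).
  move=> c0 rh m mm Jm; apply: (rh _ (dilate_maximal c0 mm)) => x Jx /=.
  have [hm _ _] := mm; apply: lideal_sum => // i _.
  by rewrite -mulr_algl; apply: lidealMl => //; apply: Jm; exact: Jh.
move=> n h rh; have [N [z _]] := graded_bound grH (h : H^o).
case: (ltnP n (dilate_bound h)) => [lt|ge].
  have key := interpolate (jrad_ideal J) (N := dilate_bound h) (f := fun n => pH n h).
  by apply: key lt => c c0; exact: dil.
have -> : pH n h = 0.
  by move: ge; rewrite /dilate_bound; case: cid => ? /= [+ _]; apply.
exact: (lideal0 (jrad_ideal J)).
Qed.

(** Let [i] and [j] be least with [pH i a] and [pH j b] outside [P]. Modulo [P], the component of
    [a * b] in degree [i + j] is the product of these two. *)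
Lemma homog_prime P : homog_ideal P -> ~ P 1 ->
  (forall a b d e, pH d a = a -> pH e b = b -> P (a * b) -> P a \/ P b) ->
  prime_ideal P.
Proof.
move=> [hP Ph] P1 PM; split=> // a b Pab; apply: contrapT => /not_orP[na nb].
have least x : ~ P x -> exists2 i, ~ P (pH i x) & forall j, (j < i)%N -> P (pH j x).
  move=> nx; have ex : exists i, ~~ `[< P (pH i x) >].
    apply: contrapT => h; apply: nx; have [N [_ hN]] := graded_bound grH (x : H^o).
    rewrite (hN _ (leqnn N)); apply: lideal_sum => // i _.
    by apply: contrapT => n; apply: h; exists i; apply/asboolPn.
  case: (ex_minnP ex) => i /asboolPn ni imin; exists i => // j ji.
  by apply: contrapT => n; move: (imin j); rewrite leqNgt ji; apply/implyP; apply/asboolPn.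
have [i nai ai] := least _ na; have [j nbj bj] := least _ nb.
suff : P (pH i a * pH j b).
  move/(PM _ _ i j); case=> //; exact: (graded_idem (E := H^o) grH).
have [N [z hN]] := graded_bound grH (a : H^o).
have := Ph (i + j)%N _ Pab.
rewrite {1}(hN (i.+1 + N)%N) ?leq_addl // mulr_suml (graded_sum (E := H^o) grH).
have li : (i < i.+1 + N)%N by rewrite addSn ltnS leq_addr.
rewrite (bigD1 (Ordinal li)) //=.
have term (l : nat) : pH (i + j)%N (pH l a * b) =
    if (l <= i + j)%N then pH l a * pH (i + j - l)%N b else 0.
  apply: (gradedZ (E := H^o) grH); exact: (graded_idem (E := H^o) grH).
rewrite term leq_addr addKn => h.
rewrite -(addrK (\sum_(l < i.+1 + N | l != Ordinal li) pH (i + j) (pH l a * b)) (pH i a * pH j b)).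
apply: lidealB => //; apply: lideal_sum => // l nl.
rewrite term; case: leqP => lij; last exact: lideal0.
case: (ltngtP l i) => li2.
- by apply: lidealMr => //; exact: ai.
- apply: lidealMl => //; apply: bj.
  by rewrite ltn_subLR // ltn_add2r.
- by case/eqP: nl; apply: val_inj.
Qed.

(** The homogeneous maximal ideal. The degree 0 component is asked to be nilpotent instead of zero
    because degree 0 is a local ring and not necessarily [k]. *)
Definition irrelevant_maximal : set H := [set h | exists n, (pH 0%N h) ^+ n = 0].

Lemma pH0M x y : pH 0%N (x * y) = pH 0%N x * pH 0%N y.
Proof.
have [N [z hN]] := graded_bound grH (x : H^o).
rewrite {1}(hN N.+1) // mulr_suml (graded_sum (E := H^o) grH) big_ord_recl /=.
have term (l : nat) : pH 0%N (pH l x * y) = if (l <= 0)%N then pH l x * pH (0 - l)%N y else 0.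
  apply: (gradedZ (E := H^o) grH); exact: (graded_idem (E := H^o) grH).
by rewrite term big1 ?addr0 // => i _; rewrite term.
Qed.

Lemma nilpotent_ideal (R : comNzRingType) : left_ideal [set x : R | exists n, x ^+ n = 0].
Proof.
apply: lidealP => [|x y [n xn] [m ym]|a x [n xn]]; first by exists 1%N.
  exists (n + m)%N; rewrite exprDn big1 // => i _.
  have [mi|im] := leqP m i; first by rewrite -(subnK mi) exprD ym mulr0 mulr0 mul0rn.
  have ni : (n <= n + m - i)%N by rewrite -addnBA ?leq_addr // ltnW.
  by rewrite -(subnK ni) exprD xn mulr0 mul0r mul0rn.
by exists n; rewrite exprMn xn mulr0.
Qed.

Lemma irrelevant_maximalP : maximal_left_ideal irrelevant_maximal.
Proof.
apply: (scalar_maximal (f := in_alg H)).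
- have hN := nilpotent_ideal H; apply: lidealP => [|x y|a x] /=.
  + by exists 1%N; rewrite expr1; exact: (graded0 (E := H^o) grH 0).
  + move=> hx hy; have [n hn] := lidealD hN hx hy; exists n.
    by rewrite -[RHS]hn; congr (_ ^+ _); exact: (gradedD (E := H^o) grH).
  + by rewrite /irrelevant_maximal /= pH0M; exact: (lidealMl _ hN).
- by move=> [n]; rewrite deg1 expr1n => /eqP; rewrite oner_eq0.
- move=> h; have [|c [n cn]] := local0 (h := pH 0%N h).
    exact: (graded_idem (E := H^o) grH).
  exists c; exists n; rewrite -cn /=; congr (_ ^+ _).
  by rewrite [LHS](gradedB (E := H^o) grH) pH_scalar.
Qed.

(** Let [u] be the degree 0 component of an element of [J], with scalar part [c]. If [c] were
    nonzero, expanding [(u - (u - c)) ^+ n], where [(u - c) ^+ n = 0], would show the unit [c ^+ n]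
    to be a multiple of [u]. *)
Lemma homog_sub_irrelevant J : homog_ideal J -> ~ J 1 -> J `<=` irrelevant_maximal.
Proof.
move=> [hJ Jh] J1 h Jh0; have Jp := Jh 0%N _ Jh0.
have [|c [n cn]] := local0 (h := pH 0%N h); first exact: (graded_idem (E := H^o) grH).
have [c0|c0] := eqVneq c 0.
  by exists n; rewrite -cn c0 scale0r subr0.
case: J1; set u := pH 0%N h in Jp cn.
have ni := nilpotent_ideal H.
have Jn : J (c%:A ^+ n).
  rewrite -[c%:A](subKr u) exprBn_comm; last exact: mulrC.
  rewrite big_ord_recr /= subnn expr0 cn mulr0 mul0rn addr0.
  apply: lideal_sum => // i _.
  rewrite -mulr_natl; apply: lidealMl => //; apply: lidealMr => //; apply: lidealMl => //.
  by apply: lideal_exp => //; rewrite subn_gt0.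
have -> : 1 = (c^-1)%:A ^+ n * c%:A ^+ n :> H.
  by rewrite -exprMn -!in_algE -rmorphM /= mulVf // scale1r expr1n.
exact: lidealMl.
Qed.

Lemma pos_irrelevant y d : (0 < d)%N -> pH d y = y -> irrelevant_maximal y.
Proof.
case: d => // d _ yd; exists 1%N; rewrite expr1.
by rewrite (graded_deg (E := H^o) grH 0 yd).
Qed.

End GradedRing.

(** * Spans over a base ring and Noetherian modules *)

Section Span.
Variables (R H : nzRingType) (f : {rmorphism R -> H}) (E : lmodType H).
Implicit Types (b : seq E) (e : E).

(** The span of [b] over [R] acting through [f]. It serves for [H] over itself, for [k] inside [H]
    or [A], and for [k[X]] acting by evaluation at an element. The recursive form suits induction on
    [b]. *)
Fixpoint fspan b e : Prop :=
  if b is x :: t then exists r, fspan t (e - f r *: x) else e = 0.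

Lemma fspan0 b : fspan b 0.
Proof. by elim: b => //= x b IH; exists 0; rewrite rmorph0 scale0r subr0. Qed.

Lemma fspanD b e e' : fspan b e -> fspan b e' -> fspan b (e + e').
Proof.
elim: b e e' => [|x b IH] e e' /=; first by move=> -> ->; rewrite addr0.
move=> [r hr] [r' hr']; exists (r + r').
by rewrite rmorphD scalerDl opprD addrACA; exact: IH.
Qed.

Lemma fspanZ b r e : fspan b e -> fspan b (f r *: e).
Proof.
elim: b e => [|x b IH] e /=; first by move=> ->; rewrite scaler0.
by move=> [s hs]; exists (r * s); rewrite rmorphM -scalerA -scalerBr; exact: IH.
Qed.

Lemma fspanN b e : fspan b e -> fspan b (- e).
Proof. by move=> h; rewrite -scaleN1r -(rmorphN1 f); exact: fspanZ. Qed.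

Lemma fspan_catl b b' e : fspan b e -> fspan (b ++ b') e.
Proof.
elim: b e => [|x b IH] e /=; first by move=> ->; exact: fspan0.
by move=> [r hr]; exists r; exact: IH.
Qed.

Lemma fspan_catr b b' e : fspan b' e -> fspan (b ++ b') e.
Proof.
elim: b e => //= x b IH e h; exists 0.
by rewrite rmorph0 scale0r subr0; exact: IH.
Qed.

Lemma fspan_mem b x : x \in b -> fspan b x.
Proof.
elim: b => //= y b IH; rewrite inE => /orP[/eqP ->|xb].
  by exists 1; rewrite rmorph1 scale1r subrr; exact: fspan0.
by exists 0; rewrite rmorph0 scale0r subr0; exact: IH.
Qed.

Lemma fspan_sum b (I : Type) (r : seq I) (p : pred I) (F : I -> E) :
  (forall i, p i -> fspan b (F i)) -> fspan b (\sum_(i <- r | p i) F i).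
Proof.
by move=> h; apply: (big_ind (fspan b)) => //; [exact: fspan0 | exact: fspanD].
Qed.

Lemma fspanP b e : fspan b e <->
  exists c : nat -> R, e = \sum_(i < size b) f (c i) *: b`_i.
Proof.
elim: b e => [|x b IH] e /=.
  by split=> [->|[c ->]]; [exists (fun=> 0) | ]; rewrite big_ord0.
split=> [[r /IH [c ce]]|[c ->]].
  exists (fun i => if i is i'.+1 then c i' else r).
  by rewrite big_ord_recl /= -ce addrC subrK.
exists (c 0%N); apply/IH; exists (fun i => c i.+1).
by rewrite big_ord_recl /= addrC addKr.
Qed.

Lemma fspan_trans b b' e : (forall x, x \in b -> fspan b' x) -> fspan b e -> fspan b' e.
Proof.
elim: b e => [|x b IH] e hb /=; first by move=> ->; exact: fspan0.
move=> [r hr]; rewrite -(subrK (f r *: x) e); apply: fspanD.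
  by apply: IH hr => y yb; apply: hb; rewrite inE yb orbT.
by apply/fspanZ/hb; exact: mem_head.
Qed.

End Span.

Section Noetherian.
Variables (H : comNzRingType) (noeth : noetherian H).

Definition idspan (E : lmodType H) := @fspan H H idfun E.

Lemma idspan_fg (E : lmodType H) (b : seq E) : (forall e, idspan b e) -> finitely_generated E.
Proof. by move=> hb; exists b => e; have /(fspanP idfun b e) := hb e. Qed.

Lemma fg_idspan (E : lmodType H) : finitely_generated E -> exists b : seq E, forall e, idspan b e.
Proof. by move=> [b hb]; exists b => e; apply/(fspanP idfun b e); exact: hb. Qed.

(** Induction on the generators: the coefficients at [x] of elements of [G] form a finitely
    generated ideal, and what is left after subtracting lifts of its generators lies in the span of
    the remaining generators. *)
Lemma noetherian_submodule (E : lmodType H) (b : seq E) (G : set E) :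
  submodule G -> (forall e, G e -> idspan b e) ->
  exists2 g : seq E, forall x, x \in g -> G x & forall e, G e -> idspan g e.
Proof.
move=> [G0 GD].
have GB x y : G x -> G y -> G (x - y).
  by move=> Gx Gy; have := GD (-1) y x Gy Gx; rewrite scaleN1r addrC.
have GZ a x : G x -> G (a *: x) by move=> Gx; have := GD a x 0 Gx G0; rewrite addr0.
have GA x y : G x -> G y -> G (x + y) by move=> Gx; have := GD 1 x y Gx; rewrite scale1r.
elim: b G G0 GD GB GZ GA => [|x b IH] G G0 GD GB GZ GA Gb.
  by exists [::] => // e /Gb.
pose I : set H := [set r | exists2 e, G e & idspan b (e - r *: x)].
have hI : left_ideal I.
  apply: lidealP => [|r s [e Ge he] [e' Ge' he']|a r [e Ge he]].
  - by exists 0; rewrite // scale0r subr0; exact: fspan0.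
  - exists (e + e'); first exact: GA.
    by rewrite scalerDl opprD addrACA; exact: fspanD.
  - exists (a *: e); first exact: GZ.
    by rewrite -scalerA -scalerBr; exact: (fspanZ (f := idfun)).
have [s [sI sgen]] := noeth hI.
pose G' : set E := [set e | G e /\ idspan b e].
have [||||||g gG gspan] := IH G'.
- by split=> //; exact: fspan0.
- move=> a y z [Gy by'] [Gz bz]; split; first exact: GD.
  by apply: fspanD => //; exact: (fspanZ (f := idfun)).
- move=> y z [Gy by'] [Gz bz]; split; first exact: GB.
  by apply: fspanD => //; exact: fspanN.
- by move=> a y [Gy by']; split; [exact: GZ | exact: (fspanZ (f := idfun))].
- by move=> y z [Gy by'] [Gz bz]; split; [exact: GA | exact: fspanD].
- by move=> e [].
have hw (r : H) : exists e : E, r \in s -> G e /\ idspan b (e - r *: x).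
  case: (pselect (r \in s)) => [rs|n]; last by exists 0.
  by have [e Ge he] := sI r rs; exists e.
have [w wP] := choice hw.
exists ([seq w r | r <- s] ++ g) => [y|e Ge].
  rewrite mem_cat => /orP[/mapP[r rs ->]|/gG[]//].
  by case: (wP _ rs).
have [r hr] := Gb e Ge.
have [c rc] : exists c : nat -> H, r = \sum_(i < size s) c i * s`_i.
  by apply: sgen; exists e.
pose e1 := \sum_(i < size s) c i *: w s`_i.
have Ge1 : G e1.
  apply: (big_ind G) => // i _; apply: GZ.
  by have [] := wP s`_i (mem_nth _ (ltn_ord i)).
rewrite -(subrK e1 e); apply: fspanD.
  apply: fspan_catr; apply: gspan; split; first exact: GB.
  have -> : e - e1 = (e - r *: x) - \sum_(i < size s) c i *: (w s`_i - s`_i *: x).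
    suff -> : \sum_(i < size s) c i *: (w s`_i - s`_i *: x) = e1 - r *: x.
      by rewrite opprB addrA subrK.
    by under eq_bigr do rewrite scalerBr scalerA; rewrite sumrB -scaler_suml -rc.
  apply: fspanD => //; apply/fspanN/fspan_sum => i _; apply: (fspanZ (f := idfun)).
  by have [] := wP s`_i (mem_nth _ (ltn_ord i)).
apply: fspan_catl; apply: fspan_sum => i _; apply: (fspanZ (f := idfun)).
by apply: fspan_mem; apply: map_f; rewrite mem_nth.
Qed.

End Noetherian.

(** * Dimension of the support and homogeneous parameters *)

Section GradedModuleTheory.
Variables (k : closedFieldType) (H : comAlgType k) (pH : nat -> H -> H).
Hypothesis grH : graded pH (pH : nat -> H^o -> H^o).
Hypothesis pH_scalar : forall c : k, pH 0%N c%:A = c%:A.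
Hypothesis noeth : noetherian H.
Hypothesis local0 : forall h, pH 0%N h = h -> exists (c : k) n, (h - c%:A) ^+ n = 0.
Variables (E : lmodType H) (pE : nat -> E -> E).
Hypothesis grE : graded pH pE.
Hypothesis fgE : finitely_generated E.

(** [multiple x] is the submodule [x E], so [quotient_ann x] is the annihilator of [E / xE], and
    [parameter x] says that [E / xE] vanishes in large degrees. The quotient module itself is never
    formed. *)
Definition multiple (x : H) (e : E) : Prop := exists e', e = x *: e'.
Definition quotient_ann (x : H) : set H := [set h | forall e, multiple x (h *: e)].
Definition module_ann : set H := [set h | forall e : E, h *: e = 0].
Definition parameter (x : H) : Prop :=
  exists N, forall n e, (N <= n)%N -> pE n e = e -> multiple x e.
(** For a closed ideal this means that its locus has a point other than the irrelevant ideal. *)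
Definition relevant (J : set H) : Prop :=
  exists y d, [/\ (0 < d)%N, pH d y = y & ~ J y].

Lemma multiple0 x : multiple x 0. Proof. by exists 0; rewrite scaler0. Qed.
Lemma multipleD x e e' : multiple x e -> multiple x e' -> multiple x (e + e').
Proof. by move=> [u ->] [v ->]; exists (u + v); rewrite scalerDr. Qed.
Lemma multipleZ x h e : multiple x e -> multiple x (h *: e).
Proof. by move=> [u ->]; exists (h *: u); rewrite !scalerA mulrC. Qed.
Lemma multiple_sum x (I : Type) (r : seq I) (p : pred I) (F : I -> E) :
  (forall i, p i -> multiple x (F i)) -> multiple x (\sum_(i <- r | p i) F i).
Proof.
by move=> h; apply: (big_ind (multiple x)) => //; [exact: multiple0 | exact: multipleD].
Qed.

Lemma multiple_homog x d n e : pH d x = x -> multiple x e -> multiple x (pE n e).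
Proof.
move=> xd [u ->]; rewrite (gradedZ grE n u xd); case: leqP => _; last exact: multiple0.
by exists (pE (n - d)%N u).
Qed.

Lemma quotient_ann_ideal x : left_ideal (quotient_ann x).
Proof.
apply: lidealP => [|a b ha hb|a h hh] e; first by rewrite scale0r; exact: multiple0.
  by rewrite scalerDl; apply: multipleD.
by rewrite -scalerA; apply: multipleZ.
Qed.

Lemma quotient_ann_homog x d : pH d x = x -> homog_ideal pH (quotient_ann x).
Proof.
move=> xd; split; first exact: quotient_ann_ideal.
move=> n h hh e; have [N [_ eN]] := graded_bound grE e.
rewrite (eN _ (leqnn N)) scaler_sumr; apply: multiple_sum => i _.
have ie : pE i (pE i e) = pE i e by exact: (graded_idem grE).
have := multiple_homog (i + n)%N xd (hh (pE i e)).
by rewrite (gradedZr grH grE (i + n)%N h ie) leq_addr addKn.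
Qed.

(** Lets the facts about [quotient_ann] cover the annihilator of [E]. *)
Lemma module_annE : module_ann = quotient_ann 0.
Proof.
apply/seteqP; split=> [h hh e|h hh e]; first by rewrite hh; exact: multiple0.
by have [u ->] := hh e; rewrite scale0r.
Qed.

Lemma pH00 n : pH n 0 = 0.
Proof. exact: (graded0 (E := H^o) grH n). Qed.

Lemma module_ann_ideal : left_ideal module_ann.
Proof. by rewrite module_annE; exact: quotient_ann_ideal. Qed.

Lemma module_ann_homog : homog_ideal pH module_ann.
Proof. by rewrite module_annE; apply: (@quotient_ann_homog _ 0%N); exact: pH00. Qed.

Lemma module_ann_sub x : module_ann `<=` quotient_ann x.
Proof. by move=> h hh e; rewrite hh; exact: multiple0. Qed.

Lemma quotient_ann_self x : quotient_ann x x.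
Proof. by move=> e; exists e. Qed.

Lemma homog_gens : exists b : seq (nat * E),
  (forall p, p \in b -> pE p.1 p.2 = p.2) /\ forall e, idspan [seq p.2 | p <- b] e.
Proof.
have [s hs] := fg_idspan fgE.
suff [b [hb sb]] : exists b : seq (nat * E), (forall p, p \in b -> pE p.1 p.2 = p.2) /\
    forall x, x \in s -> idspan [seq p.2 | p <- b] x.
  by exists b; split=> // e; exact: fspan_trans (hs e).
elim: s {hs} => [|x s [b [hb sb]]]; first by exists [::].
have [N [_ xN]] := graded_bound grE x.
exists ([seq (i, pE i x) | i <- iota 0 N] ++ b); split=> [p|y].
  rewrite mem_cat => /orP[/mapP[i _ ->]|/hb//]; exact: (graded_idem grE).
rewrite inE map_cat -map_comp => /orP[/eqP->|/sb]; last exact: fspan_catr.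
rewrite [X in idspan _ X](xN _ (leqnn N)); apply: fspan_catl; apply: fspan_sum => i _.
by apply: fspan_mem; apply/mapP; exists (i : nat); rewrite ?mem_iota ?add0n ?ltn_ord.
Qed.

(** The elements without degree 0 component form a finitely generated ideal, and the components of
    its generators are the required [hs]. Generation is phrased through ideals [I] because it is
    applied to the ideal of scalars that map [E] into a given submodule. *)
Lemma irrelevant_gens : exists hs : seq H,
  (forall g, g \in hs -> exists2 d, (0 < d)%N & pH d g = g) /\
  forall I : set H, left_ideal I -> (forall g, g \in hs -> I g) ->
    forall n h, (0 < n)%N -> pH n h = h -> I h.
Proof.
pose J : set H := [set h | pH 0%N h = 0].
have hJ : left_ideal J.
  apply: lidealP => [|x y|a x]; first exact: pH00.
    move=> x0 y0; rewrite /J /=; apply: etrans (gradedD (E := H^o) grH 0%N x y) _.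
    by rewrite x0 y0 addr0.
  by move=> x0; rewrite /J /= (pH0M grH) x0 mulr0.
have [s [sJ sgen]] := noeth hJ.
suff [hs [h1 h2]] : exists hs : seq H,
  (forall g, g \in hs -> exists2 d, (0 < d)%N & pH d g = g) /\
  forall I : set H, left_ideal I -> (forall g, g \in hs -> I g) -> forall x, x \in s -> I x.
  exists hs; split=> // I hI hsI n h n0 hn.
  have [c ->] : exists c : nat -> H, h = \sum_(i < size s) c i * s`_i.
    apply: sgen; rewrite /J /= (graded_deg (E := H^o) grH 0%N hn).
    by case: n n0 {hn}.
  apply: lideal_sum => // i _; apply: lidealMl => //.
  by apply: (h2 I) => //; rewrite mem_nth.
elim: s sJ {sgen} => [|x s IH] sJ; first by exists [::].
have [|hs [h1 h2]] := IH; first by move=> y ys; apply: sJ; rewrite inE ys orbT.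
have x0 : pH 0%N x = 0 by apply: sJ; exact: mem_head.
have [N [_ xN]] := graded_bound grH (x : H^o).
exists ([seq pH i.+1 x | i <- iota 0 N] ++ hs); split=> [g|I hI hI2 y].
  rewrite mem_cat => /orP[/mapP[i _ ->]|/h1//]; exists i.+1 => //.
  exact: (graded_idem (E := H^o) grH).
rewrite inE => /orP[/eqP->|]; last first.
  by apply: h2 => // g gs; apply: hI2; rewrite mem_cat gs orbT.
rewrite (xN N.+1) // big_ord_recl x0 add0r; apply: lideal_sum => // i _.
apply: hI2; rewrite mem_cat; apply/orP; left; apply/mapP; exists (i : nat) => //.
by rewrite mem_iota add0n ltn_ord.
Qed.

(** The submodule [x E + h_1 E + ... + h_r E]. *)
Fixpoint multispan (x : H) (hs : seq H) (e : E) : Prop :=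
  if hs is h :: t then exists e', multispan x t (e - h *: e') else multiple x e.

Lemma multispan_mult x hs e : multiple x e -> multispan x hs e.
Proof. by elim: hs e => //= h t IH e he; exists 0; rewrite scaler0 subr0; exact: IH. Qed.

Lemma multispanD x hs e e' :
  multispan x hs e -> multispan x hs e' -> multispan x hs (e + e').
Proof.
elim: hs e e' => [|h t IH] e e' /=; first exact: multipleD.
by move=> [u hu] [v hv]; exists (u + v); rewrite scalerDr opprD addrACA; exact: IH.
Qed.

Lemma multispanZ x hs a e : multispan x hs e -> multispan x hs (a *: e).
Proof.
elim: hs e => [|h t IH] e /=; first exact: multipleZ.
move=> [u hu]; exists (a *: u).
by rewrite scalerA mulrC -scalerA -scalerBr; exact: IH.
Qed.

Lemma multispan_mem x hs h e : h \in hs -> multispan x hs (h *: e).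
Proof.
elim: hs => //= g t IH; rewrite inE => /orP[/eqP->|ht].
  by exists e; rewrite subrr; apply: multispan_mult; exact: multiple0.
by exists 0; rewrite scaler0 subr0; exact: IH.
Qed.

Lemma multispan_homog x d hs n e : pH d x = x ->
  (forall g, g \in hs -> exists2 d, (0 < d)%N & pH d g = g) ->
  multispan x hs e -> multispan x hs (pE n e).
Proof.
move=> xd; elim: hs e => [|h t IH] e hom /=; first exact: (multiple_homog n xd).
have [f _ fh] := hom h (mem_head _ _).
have {}IH u : multispan x t u -> multispan x t (pE n u).
  by apply: IH => g gt; apply: hom; rewrite inE gt orbT.
move=> [u /IH]; rewrite (gradedB grE) (gradedZ grE n u fh).
by case: leqP => _ hu; [exists (pE (n - f) u) | exists 0; rewrite scaler0].
Qed.

(** Above the degrees of its generators, [E] lies in the sum of the [h E] for the generators [h] of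
    positive degree. These are removed one at a time: in high degrees, repeated substitution puts a
    power [h ^+ j] in front, and this power maps [E] into [x E]. *)
Lemma nilpotent_parameter x dx : pH dx x = x ->
  (forall y d, (0 < d)%N -> pH d y = y -> exists j, quotient_ann x (y ^+ j)) ->
  parameter x.
Proof.
move=> xd nil; have [hs [hom gen]] := irrelevant_gens.
have : exists N, forall n e, (N <= n)%N -> pE n e = e -> multispan x hs e.
  have [b [hb sb]] := homog_gens.
  (* The sum of the degrees of the generators bounds each of them, and the successor leaves
     coefficients of positive degree. *)
  exists (\sum_(p <- b) p.1).+1 => n e Nn en.
  suff : forall e', idspan [seq p.2 | p <- b] e' -> multispan x hs (pE n e').
    by move=> /(_ e (sb e)); rewrite en.
  elim: b hb Nn {sb} => [|p b IH] hb /=.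
    by move=> _ e' ->; rewrite (graded0 grE); apply: multispan_mult; exact: multiple0.
  rewrite big_cons => Nn e' [r hr]; rewrite -(subrK (r *: p.2) e') (gradedD grE).
  apply: multispanD.
    apply: IH hr => [q qb|]; first by apply: hb; rewrite inE qb orbT.
    by apply: leq_ltn_trans Nn; rewrite leq_addl.
  have ep := hb p (mem_head _ _).
  rewrite (gradedZr grH grE n r ep).
  have pn : (p.1 < n)%N by apply: leq_trans Nn; rewrite ltnS leq_addr.
  rewrite ltnW //.
  apply: (gen [set h | forall e, multispan x hs (h *: e)] _ _ (n - p.1)%N) => /=.
  - apply: lidealP => [|u v hu hv|a u hu] e0 /=.
    + by rewrite scale0r; apply: multispan_mult; exact: multiple0.
    + by rewrite scalerDl; exact: multispanD.
    + by rewrite -scalerA; exact: multispanZ.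
  - by move=> g gh e0; exact: multispan_mem.
  - by rewrite subn_gt0.
  - exact: (graded_idem (E := H^o) grH).
elim: hs hom {gen} => // h t IH hom [N hN]; apply: IH => [g gt|].
  by apply: hom; rewrite inE gt orbT.
have [d d0 dh] := hom h (mem_head _ _).
have [j hj] := nil h d d0 dh.
have homt g : g \in t -> exists2 d, (0 < d)%N & pH d g = g.
  by move=> gt; apply: hom; rewrite inE gt orbT.
(* Each substitution costs [d] degrees, hence the bound [N + i * d] for [i] of them. *)
have iter i n e : (N + i * d <= n)%N -> pE n e = e ->
    exists2 e', pE (n - i * d)%N e' = e' & multispan x t (e - h ^+ i *: e').
  elim: i => [|i IHi] in n e * => le en.
    exists e; first by rewrite mul0n subn0.
    by rewrite expr0 scale1r subrr; apply: multispan_mult; exact: multiple0.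
  have le' : (N + i * d <= n)%N.
    by apply: leq_trans le; rewrite leq_add2l mulSn leq_addl.
  have [e1 e1d he1] := IHi n e le' en.
  have [|e2 /(multispan_homog (n - i * d)%N xd homt)] := hN (n - i * d)%N e1 _ e1d.
    by rewrite leq_subRL ?(leq_trans (leq_addl _ _) le') // addnC.
  rewrite (gradedB grE) e1d (gradedZ grE _ e2 dh).
  have dn : (d <= n - i * d)%N.
    rewrite leq_subRL ?(leq_trans (leq_addl _ _) le') //.
    by apply: leq_trans le; rewrite addnC -mulSn leq_addl.
  rewrite dn => he2; exists (pE (n - i * d - d)%N e2).
    by rewrite mulSn addnC subnDA (graded_idem grE).
  have -> : e - h ^+ i.+1 *: pE (n - i * d - d)%N e2 =
      (e - h ^+ i *: e1) + h ^+ i *: (e1 - h *: pE (n - i * d - d)%N e2).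
    by rewrite scalerBr scalerA -exprSr addrA subrK.
  by apply: multispanD => //; exact: multispanZ.
exists (N + j * d)%N => n e le en; have [e' _ he'] := iter j n e le en.
rewrite -(subrK (h ^+ j *: e') e); apply: multispanD => //.
by apply: multispan_mult; exact: hj.
Qed.

(* If [1 = a + (y - 1) * b] with [a] killing [E / x E], comparing degrees in
   [e = (y - 1) * b * e] mod [x E] gives [y ^+ j *: e = 0] mod [x E] for large [j]. *)
Lemma quotient_relevant x dx : pH dx x = x -> ~ parameter x ->
  exists y d m, [/\ (0 < d)%N, pH d y = y, maximal_left_ideal m,
    quotient_ann x `<=` m & ~ m y].
Proof.
move=> xd npar.
have [y [d [d0 yd nn]]] : exists y d, [/\ (0 < d)%N, pH d y = y &
    forall j, ~ quotient_ann x (y ^+ j)].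
  apply: contrapT => h; apply: npar; apply: (nilpotent_parameter xd) => y d d0 yd.
  apply: contrapT => h'; apply: h; exists y, d; split=> // j hj.
  by apply: h'; exists j.
have hq := quotient_ann_ideal x.
have [|m mm Jm] := maximal_above noeth (adjoin_ideal (y - 1) hq); last first.
  exists y, d, m; split=> //; first exact: subset_trans (adjoin_sub _ hq) Jm.
  have [hm m1 _] := mm => my; apply: m1.
  by rewrite -(subKr y 1); apply: lidealB => //; apply: Jm; exact: adjoin_self.
move=> [b hb].
have killhom n e : pE n e = e -> exists j, forall i, multiple x (y ^+ (j + i)%N *: e).
  move=> en; pose f := b *: e.
  have hf i : multiple x (pE i e - (if (d <= i)%N then y *: pE (i - d)%N f else 0) + pE i f).
    have := multiple_homog i xd (hb e).
    rewrite scalerBl scale1r mulrC -scalerA -/f scalerBl scale1r.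
    by rewrite !(gradedB grE) (gradedZ grE i f yd) opprB addrA addrAC.
  have low i : (i < n)%N -> multiple x (pE i f).
    have [l] := ubnP i; elim: l i => // l IH i il ni.
    have := hf i; rewrite (graded_deg grE i en) (ltn_eqF ni) sub0r.
    case: leqP => di; last by rewrite oppr0 add0r.
    move=> h; rewrite -(addKr (- (y *: pE (i - d) f)) (pE i f)) opprK.
    apply: multipleD => //; apply: multipleZ; apply: IH.
      by apply: (leq_trans _ (il : (i <= l)%N)); rewrite ltn_subrL d0 (leq_trans d0 di).
    by apply: leq_ltn_trans ni; rewrite leq_subr.
  (* The recursion [hf] turns the component of [f] in degree [n + j * d] into [- y ^+ j *: e] modulo
     [x E]; as [f] has finitely many components, large powers of [y] send [e] into [x E]. *)
  have high j : multiple x (pE (n + j * d)%N f + y ^+ j *: e).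
    elim: j => [|j IH].
      rewrite mul0n addn0 expr0 scale1r addrC.
      have := hf n; rewrite en; case: leqP => dn; last by rewrite subr0.
      move=> h; have hl : multiple x (y *: pE (n - d) f).
        by apply/multipleZ/low; rewrite ltn_subrL d0 (leq_trans d0 dn).
      by have := multipleD h hl; rewrite addrAC subrK.
    have := hf (n + j.+1 * d)%N; rewrite (graded_deg grE _ en).
    rewrite -[X in _ == X]addn0 eqn_add2l muln_eq0 /= (gtn_eqF d0) sub0r.
    rewrite mulSn (addnC d) addnA leq_addl addnK => h.
    have := multipleD h (multipleZ y IH).
    by rewrite scalerDr scalerA -exprS addrACA addNr add0r.
  have [N [fN _]] := graded_bound grE f; exists N => i; have := high (N + i)%N.
  rewrite fN ?add0r // -[X in (X <= _)%N]add0n leq_add //.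
  by rewrite -[X in (X <= _)%N]muln1 leq_mul // leq_addr.
have kill e : exists j, forall i, multiple x (y ^+ (j + i)%N *: e).
  have [N [_ eN]] := graded_bound grE e; rewrite (eN _ (leqnn N)).
  elim: N {eN} => [|N [j hj]].
    by exists 0%N => i; rewrite big_ord0 scaler0; exact: multiple0.
  have [j' hj'] := killhom N _ (graded_idem grE N e).
  exists (j + j')%N => i; rewrite big_ord_recr /= scalerDr; apply: multipleD.
    by rewrite -addnA; exact: hj.
  by rewrite (addnC j) -addnA; exact: hj'.
have [s hs] := fg_idspan fgE.
have [j hj] : exists j, forall i e, e \in s -> multiple x (y ^+ (j + i)%N *: e).
  elim: s {hs} => [|e s [j hj]]; first by exists 0%N.
  have [j' hj'] := kill e; exists (j + j')%N => i e'; rewrite inE => /orP[/eqP->|es].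
    by rewrite (addnC j) -addnA; exact: hj'.
  by rewrite -addnA; exact: hj.
apply: (nn j) => e; have := hs e.
elim: s e hj {hs} => [|u s IH] e hj /=; first by move=> ->; rewrite scaler0; exact: multiple0.
move=> [r hr]; rewrite -(subrK (r *: u) e) scalerDr; apply: multipleD.
  by apply: IH => // i e' es; apply: hj; rewrite inE es orbT.
rewrite scalerA mulrC -scalerA; apply: multipleZ.
by have := hj 0%N u (mem_head _ _); rewrite addn0.
Qed.

(** Suppose [a * b] lies in [P] with [a] and [b] homogeneous outside [P]. By maximality the closures
    of [P + (a)] and [P + (b)] are not relevant, so both contain [y]; then so does the closure of
    [P], which is [P]. *)
Lemma maximal_relevant J0 : homog_ideal pH J0 -> jrad J0 `<=` J0 -> relevant J0 ->
  exists P, [/\ homog_ideal pH P, jrad P `<=` P, prime_ideal P, relevant P & J0 `<=` P].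
Proof.
move=> hJ0 rJ0 relJ0.
have [||P [[hP rP relP] J0P Pmax]] := @lideal_max H noeth
   [set J | [/\ homog_ideal pH J, jrad J `<=` J & relevant J]] J0.
- by [].
- by move=> I [[]].
exists P; split=> //; have [lP homP] := hP.
have [y [d [d0 yd ny]]] := relP.
apply: (homog_prime grH) => //; first by move=> P1; apply: ny; rewrite -[y]mulr1; exact: lidealMl.
move=> a b da db aE bE Pab; apply: contrapT => /not_orP[na nb].
have big u e : pH e u = u -> ~ P u -> jrad (adjoin P u) y.
  move=> uE nu; apply: contrapT => nr; apply: nu.
  have hA : homog_ideal pH (adjoin P u).
    split; first exact: adjoin_ideal.
    move=> n h [c hc]; have := homP n _ hc.
    have -> : pH n (h - c * u) = pH n h - pH n (c * u) := gradedB (E := H^o) grH n h (c * u).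
    have -> := gradedZr grH (E := H^o) grH n c uE.
    case: leqP => _ h1; first by exists (pH (n - e)%N c).
    by exists 0; rewrite mul0r.
  apply: (Pmax (jrad (adjoin P u))).
  - split; [exact: (jrad_homog grH pH_scalar) | exact: jrad_idem |].
    by exists y, d.
  - by apply: subset_trans (@sub_jrad _ _); exact: adjoin_sub.
  - by apply: sub_jrad; exact: adjoin_self.
apply: ny; apply: rP; apply: (jrad_adjoinI lP Pab).
- exact: big aE na.
- exact: big bE nb.
Qed.

End GradedModuleTheory.

(** * Integrality over polynomials in one element *)

Section Integral.
Variables (k : closedFieldType) (H : comAlgType k).

(** Over an algebraically closed field [r] splits, and the prime contains one of the linear
    factors. *)
Lemma poly_root_in_prime (P : set H) (x : H) (r : {poly k}) : prime_ideal P -> r != 0 ->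
  P (horner_alg x r) -> exists z : k, P (x - z%:A).
Proof.
move=> [hP P1 PM] r0; have [s ->] := closed_field_poly_normal r.
have l0 : lead_coef r != 0 by rewrite lead_coef_eq0.
rewrite linearZ /= rmorph_prod => hr.
have {}hr : P (\prod_(z <- s) horner_alg x ('X - z%:P)).
  move: (lidealMl ((lead_coef r)^-1)%:A hP hr).
  by rewrite mulrA mulr_algl scalerA mulVf // scale1r mul1r.
elim: s hr => [|z s IH]; first by rewrite big_nil => /P1.
rewrite big_cons => /PM[|//]; rewrite rmorphB /= horner_algX horner_algC => hz.
by exists z.
Qed.

Lemma horner_alg_congr (P : set H) (x : H) (z : k) (r : {poly k}) : left_ideal P ->
  P (x - z%:A) -> P (horner_alg x r - (r.[z])%:A).
Proof.
move=> hP hx; elim/poly_ind: r => [|p c IH].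
  by rewrite rmorph0 horner0 scale0r subr0; exact: lideal0.
rewrite !hornerE rmorphD rmorphM /= horner_algX horner_algC.
rewrite scalerDl opprD addrACA subrr addr0.
have -> : horner_alg x p * x - (p.[z] * z)%:A =
  x * (horner_alg x p - (p.[z])%:A) + (p.[z])%:A * (x - z%:A).
  rewrite mulrBr addrC mulrBr mulr_algl.
  rewrite [(p.[z])%:A * z%:A]mulr_algl scalerA.
  rewrite [x * horner_alg x p]mulrC [x * _%:A]mulrC mulr_algl addrC addrA.
  by rewrite addrNK.
by apply: lidealD => //; apply: lidealMl.
Qed.

(** Modulo [P] the element [x] is the scalar [z], so the integral equation of [h] over [k[x]]
    becomes one over [k], and [h] is a scalar as well. *)
Lemma integral_maximal (P : set H) (x : H) (z : k) : prime_ideal P ->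
  P (x - z%:A) ->
  (forall h, exists2 q : {poly {poly k}}, q \is monic &
     P (map_poly (horner_alg x) q).[h]) ->
  maximal_left_ideal P.
Proof.
move=> pP hx hq; have [hP P1 PM] := pP.
apply: (scalar_maximal (f := in_alg H)) => // h; have [q qm qh] := hq h.
pose r := map_poly (horner_eval z) q.
have rP : P (horner_alg h r).
  have hc : P ((map_poly (horner_alg x) q).[h] - horner_alg h r).
    rewrite /r; elim/poly_ind: q {qm qh r} => [|p c IH].
      by rewrite !rmorph0 horner0 subr0; exact: lideal0.
    rewrite !rmorphD !rmorphM /= !map_polyX !map_polyC /= !hornerE.
    rewrite horner_algX horner_algC opprD addrACA -mulrBl.
    apply: lidealD => //; first exact: lidealMr.
    exact: horner_alg_congr.
  by rewrite -(subKr (map_poly (horner_alg x) q).[h] (horner_alg h r)); exact: lidealB.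
have r0 : r != 0 by rewrite monic_neq0 // /r monic_map.
by have [y hy] := poly_root_in_prime pP r0 rP; exists y.
Qed.

(** Incomparability of primes in integral extensions: factors [h] cancel modulo [P2] until the
    constant coefficient [c] is nonzero, and then [c], evaluated at [x], lies in [P1] because [h]
    does. *)
Lemma lower_coefficient (P2 P1 : set H) (x h : H) (q : {poly {poly k}}) :
  prime_ideal P2 -> prime_ideal P1 -> P2 `<=` P1 -> P1 h -> ~ P2 h -> q != 0 ->
  P2 (map_poly (horner_alg x) q).[h] ->
  exists2 r : {poly k}, r != 0 & P1 (horner_alg x r).
Proof.
move=> [hP2 _ PM2] [hP1 _ _] P21 h1 h2; elim/poly_ind: q => [|p c IH]; first by rewrite eqxx.
rewrite rmorphD rmorphM /= map_polyX map_polyC /= !hornerE.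
have [->|c0] := eqVneq c 0; last first.
  move=> _ /P21 hp; exists c => //.
  rewrite -[horner_alg x c](addKr ((map_poly (horner_alg x) p).[h] * h)) addrC.
  by apply: lidealB => //; exact: lidealMl.
rewrite !rmorph0 !addr0 => pX /PM2[|//]; apply: IH.
by apply: contraNneq pX => ->; rewrite mul0r.
Qed.

End Integral.

(** * Chains of irreducible loci *)

Section Dimension.
Variables (k : closedFieldType) (H : comAlgType k) (pH : nat -> H -> H).
Hypothesis grH : graded pH (pH : nat -> H^o -> H^o).
Hypothesis pH_scalar : forall c : k, pH 0%N c%:A = c%:A.
Hypothesis noeth : noetherian H.
Hypothesis local0 : forall h, pH 0%N h = h -> exists (c : k) n, (h - c%:A) ^+ n = 0.
Variables (E : lmodType H) (pE : nat -> E -> E).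
Hypothesis grE : graded pH pE.
Hypothesis fgE : finitely_generated E.

Local Notation parameter := (parameter pE).
Local Notation relevant := (relevant pH).
Local Notation annE := (module_ann E).
Local Notation quotient_ann := (@quotient_ann k H E).
Local Notation m0 := (irrelevant_maximal pH).

Lemma m0P : maximal_left_ideal m0.
Proof. exact: (irrelevant_maximalP grH pH_scalar local0). Qed.

(** The chain is the irrelevant point inside the locus of [P]; the element of positive degree
    outside [P] makes it strict. *)
Lemma locus_chain (P : set H) : homog_ideal pH P -> jrad P `<=` P -> prime_ideal P ->
  relevant P -> annE `<=` P -> has_irreducible_chain (zariski_locus annE) 1.
Proof.
move=> hP rP pP [y [d [d0 yd ny]]] aP; have [lP P1 _] := pP.
have Pm := homog_sub_irrelevant grH local0 hP P1.
exists (fun i => if i is 0%N then zariski_locus m0 else zariski_locus P); split.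
  move=> [|[|//]] _; split.
  - by exists m0.
  - apply: locus_irreducible => //; first exact: maximal_prime m0P.
    by move=> h; apply=> //; exact: m0P.
  - by move=> m [mm m0m]; split=> // h /aP/Pm; exact: m0m.
  - by exists P.
  - exact: locus_irreducible.
  - by move=> m [mm Pm']; split=> // h /aP; exact: Pm'.
case=> // _; split; first by move=> m [mm m0m]; split=> // h /Pm; exact: m0m.
move=> sub; apply: ny; apply: rP => m mm Pm'.
by have [|_ ] := sub m; [|apply; exact: (pos_irrelevant grH d0 yd)].
Qed.

Lemma locus_chain2 (P1 P2 : set H) : homog_ideal pH P1 -> jrad P1 `<=` P1 -> prime_ideal P1 ->
  relevant P1 -> jrad P2 `<=` P2 -> prime_ideal P2 -> P2 `<=` P1 -> ~ P1 `<=` P2 ->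
  annE `<=` P2 -> has_irreducible_chain (zariski_locus annE) 2.
Proof.
move=> hP1 rP1 pP1 rel rP2 pP2 P21 nP21 aP2.
have [Z [Zi Zlt]] := locus_chain hP1 rP1 pP1 rel (subset_trans aP2 P21).
exists (fun i => if i is 2 then zariski_locus P2 else if i is 1%N then zariski_locus P1
  else zariski_locus m0).
have Pm := homog_sub_irrelevant grH local0 hP1 (let: And3 _ h _ := pP1 in h).
split.
  move=> [|[|[|//]]] _; split.
  - by exists m0.
  - apply: locus_irreducible => //; first exact: maximal_prime m0P.
    by move=> h; apply=> //; exact: m0P.
  - by move=> m [mm m0m]; split=> // h /aP2/P21/Pm; exact: m0m.
  - by exists P1.
  - exact: locus_irreducible.
  - by move=> m [mm Pm']; split=> // h /aP2/P21; exact: Pm'.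
  - by exists P2.
  - exact: locus_irreducible.
  - by move=> m [mm Pm']; split=> // h /aP2; exact: Pm'.
have [y [d [d0 yd ny]]] := rel.
case=> [|[|//]] _; split.
- by move=> m [mm m0m]; split=> // h /Pm; exact: m0m.
- move=> sub; apply: ny; apply: rP1 => m mm Pm'.
  by have [|_ ] := sub m; [|apply; exact: (pos_irrelevant grH d0 yd)].
- by move=> m [mm Pm']; split=> // h /P21; exact: Pm'.
- move=> sub; apply: nP21 => h Ph; apply: rP2 => m mm Pm'.
  by have [|_ ] := sub m; [|apply].
Qed.

Lemma nonparameter_relevant x d : pH d x = x -> ~ parameter x ->
  relevant (jrad (quotient_ann x)).
Proof.
move=> xd /(quotient_relevant grH noeth grE fgE xd) [y [e [m [e0 ye mm qm ny]]]].
by exists y, e; split=> // ry; apply: ny; exact: ry.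
Qed.

(* A homogeneous [x] of positive degree for which the locus [x = 0] in the
   variety is minimal is a parameter, unless there are two nested homogeneous
   primes: if a relevant prime [P1] above [x] is minimal over the annihilator,
   some [f] outside [P1] has [f P1] in its radical, and [x ^+ q + (f g) ^+ p]
   cuts out a smaller locus than [x]. *)
Lemma parameter_or_chain :
  (exists x d, [/\ (0 < d)%N, pH d x = x & parameter x]) \/
  (exists P1 P2, [/\ homog_ideal pH P1 /\ homog_ideal pH P2, jrad P1 `<=` P1 /\ jrad P2 `<=` P2,
    prime_ideal P1 /\ prime_ideal P2, relevant P1 & [/\ P2 `<=` P1, ~ P1 `<=` P2 & annE `<=` P2]]).
Proof.
apply/or_asboolP; apply/negPn/negP; rewrite negb_or => /andP[/asboolPn nopar /asboolPn nochain].
have aI := module_ann_ideal E; have [_ ah] := module_ann_homog grH grE.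
pose F : set (set H) := [set I | exists x d, [/\ (0 < d)%N, pH d x = x & I = jrad (adjoin annE x)]].
have [||I [[x [p [p0 xp ->]]] _ xmax]] := @lideal_max H noeth F (jrad (adjoin annE 0)).
- by exists 0, 1%N; split=> //; exact: (pH00 grH).
- by move=> I [y [d [_ _ ->]]]; exact: jrad_ideal.
have npar : ~ parameter x by move=> par; apply: nopar; exists x, p.
have hq := quotient_ann_homog grH grE xp.
have [P1 [hP1 rP1 pP1 relP1 qP1]] := maximal_relevant grH pH_scalar noeth
  (jrad_homog grH pH_scalar hq) (@jrad_idem _ _) (nonparameter_relevant xp npar).
have P1x : P1 x by apply: qP1; apply: sub_jrad; exact: quotient_ann_self.
have aP1 : annE `<=` P1.
  by move=> h ha; apply: qP1; apply: sub_jrad; exact: module_ann_sub.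
have [lP1 P11 PM1] := pP1; have [_ hh1] := hP1.
have [f [fd [fh nf fP]]] : exists f fd, [/\ pH fd f = f, ~ P1 f &
    forall h, P1 h -> jrad annE (f * h)].
  apply: contrapT => nof.
  (* Noetherian induction: an ideal [C] maximal among those for which no such [f] exists turns out
     to be prime. It is strictly below [P1], as otherwise [f = 1] would do, and this pair of primes
     has been excluded. *)
  pose G : set (set H) := [set C | [/\ homog_ideal pH C, jrad C `<=` C, annE `<=` C, C `<=` P1 &
    ~ exists f fd, [/\ pH fd f = f, ~ P1 f & forall h, P1 h -> C (f * h)]]].
  have GI C : G C -> left_ideal C by case=> [[]].
  have [||C [GC aC Cmax]] := @lideal_max H noeth G (jrad annE).
  - split=> //; [by apply: (jrad_homog grH pH_scalar); split | exact: jrad_idem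
      | exact: sub_jrad |].
    by move=> h hr; apply: rP1; exact: (jradS aP1).
  - exact: GI.
  have [[lC hC] rC annC CP1 nfC] := GC.
  have C1 : ~ C 1 by move=> /CP1.
  have adj a d : pH d a = a -> ~ C a ->
      exists f fd, [/\ pH fd f = f, ~ P1 f & forall h, P1 h -> jrad (adjoin C a) (f * h)].
    move=> ad na; have hA : homog_ideal pH (adjoin C a).
      split; first exact: adjoin_ideal.
      move=> n h [c hc]; have := hC n _ hc.
      have -> : pH n (h - c * a) = pH n h - pH n (c * a) := gradedB (E := H^o) grH n h (c * a).
      have -> := gradedZr grH (E := H^o) grH n c ad.
      case: leqP => _ h1; first by exists (pH (n - d)%N c).
      by exists 0; rewrite mul0r.
    have hr := jrad_homog grH pH_scalar hA; have [lr hhr] := hr.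
    (* If the closure stays inside [P1], maximality of [C] applies; if it leaves [P1], a component
       of one of its elements is a suitable [f]. *)
    case: (pselect (jrad (adjoin C a) `<=` P1)) => [sub|nsub].
      apply: contrapT => no; apply: na; apply: (Cmax (jrad (adjoin C a))).
      - split=> //; first exact: jrad_idem.
        by move=> h /annC hCh; apply: sub_jrad; exact: adjoin_sub.
      - by move=> h hCh; apply: sub_jrad; exact: adjoin_sub.
      - by apply: sub_jrad; exact: adjoin_self.
    have [u ru nu] : exists2 u, jrad (adjoin C a) u & ~ P1 u.
      by apply: contrapT => no; apply: nsub => u hu; apply: contrapT => nu; apply: no; exists u.
    have [n nn] : exists n, ~ P1 (pH n u).
      apply: contrapT => no; apply: nu; have [N [_ uN]] := graded_bound grH (u : H^o).
      rewrite (uN _ (leqnn N)); apply: lideal_sum => // i _.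
      by apply: contrapT => ni; apply: no; exists i.
    exists (pH n u), n; split=> //; first exact: (graded_idem (E := H^o) grH).
    by move=> h _; apply: (lidealMr _ lr); exact: hhr.
  have pC : prime_ideal C.
    apply: (homog_prime grH) => // a b d e ad be Cab; apply: contrapT => /not_orP[na nb].
    have [f [fd [fh nf fP]]] := adj a d ad na; have [g [gd [gh ng gP]]] := adj b e be nb.
    apply: nfC; exists (f * g), (fd + gd)%N; split; first exact: degM.
      by move=> /PM1[].
    move=> h Ph; apply: rC; apply: (jrad_adjoinI lC Cab).
      by rewrite (mulrC f) -mulrA; apply: (lidealMl _ (@jrad_ideal _ _)); exact: fP.
    by rewrite -mulrA; apply: (lidealMl _ (@jrad_ideal _ _)); exact: gP.
  apply: nochain; exists P1, C; split=> //; split=> // P1C.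
  by apply: nfC; exists 1, 0%N; split; [exact: (deg1 pH_scalar) | | move=> h /P1C; rewrite mul1r].
have [g [gd [gd0 gh ng]]] := relP1.
pose y := f * g; pose q := (fd + gd)%N.
have q0 : (0 < q)%N by rewrite addn_gt0 gd0 orbT.
have yq : pH q y = y by exact: degM.
have ny : ~ P1 y by move=> /PM1[].
(* The factor [g] made the degree [q] of [y] positive, and the exponents bring both terms to degree
   [q * p]. A maximal ideal containing the annihilator contains [x * y]; with [x'] it then contains
   both factors. *)
pose x' := x ^+ q + y ^+ p.
have x'd : pH (q * p)%N x' = x'.
  have -> : pH (q * p)%N x' = pH (q * p)%N (x ^+ q) + pH (q * p)%N (y ^+ p) :=
    gradedD (E := H^o) grH _ _ _.
  rewrite (degX grH pH_scalar q xp) mulnC.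
  by rewrite [pH _ (y ^+ p)](degX grH pH_scalar p yq).
have both m : maximal_left_ideal m -> adjoin annE x' `<=` m -> m x /\ m y.
  move=> mm am; have [lm m1 _] := mm; have pm := maximal_prime mm.
  have [_ _ mM] := pm.
  have mx' : m x' by apply: am; exact: adjoin_self.
  have : m (y * x).
    rewrite /y -mulrA mulrC -mulrA; apply: lidealMl => //.
    rewrite mulrC; apply: (fP x P1x) => // h ha; apply: am; exact: adjoin_sub.
  case/mM => [my|mx].
    split=> //; apply: (prime_exp pm (n := q)).
    by rewrite -(addrK (y ^+ p) (x ^+ q)); apply: lidealB => //; exact: lideal_exp.
  split=> //; apply: (prime_exp pm (n := p)).
  by rewrite -(addKr (x ^+ q) (y ^+ p)) addrC; apply: lidealB => //; exact: lideal_exp.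
apply: ny; apply: qP1; apply: (@jradS _ (adjoin annE x)).
  by apply: adjoin_min; [exact: quotient_ann_ideal | exact: module_ann_sub
    | exact: quotient_ann_self].
apply: (xmax (jrad (adjoin annE x'))).
- by exists x', (q * p)%N; split=> //; rewrite muln_gt0 q0.
- move=> h hx m mm am; apply: hx => //; apply: adjoin_min; first by case: mm.
    by move=> u ua; apply: am; exact: adjoin_sub.
  by case: (both m mm am).
- by move=> m mm am; case: (both m mm am).
Qed.

End Dimension.

(** * Parameters, bounded degrees and lines *)

Section BoundedDegrees.
Variables (k : closedFieldType) (H : comAlgType k) (pH : nat -> H -> H).
Hypothesis grH : graded pH (pH : nat -> H^o -> H^o).
Hypothesis pH_scalar : forall c : k, pH 0%N c%:A = c%:A.
Hypothesis noeth : noetherian H.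
Hypothesis local0 : forall h, pH 0%N h = h -> exists (c : k) n, (h - c%:A) ^+ n = 0.
Variables (E : lmodType H) (pE : nat -> E -> E).
Hypothesis grE : graded pH pE.
Hypothesis fgE : finitely_generated E.

Local Notation parameter := (parameter pE).
Local Notation annE := (module_ann E).
Local Notation kspan := (@fspan k H (in_alg H) E).

Definition eventually_zero : Prop := exists N, forall n e, (N <= n)%N -> pE n e = e -> e = 0.
Definition has_parameter : Prop := exists x d, [/\ (0 < d)%N, pH d x = x & parameter x].
Definition bounded_degrees : Prop := exists B, forall n, exists b : seq E,
  (size b <= B)%N /\ forall e, pE n e = e -> kspan b e.

(** A power of each homogeneous element of positive degree annihilates [E], so the variety has no
    point besides the irrelevant ideal. *)
Lemma eventually_zero_no_chain : eventually_zero ->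
  ~ has_irreducible_chain (zariski_locus annE) 1.
Proof.
move=> [N hN] [Z [Zi Zlt]].
have annpos y d : (0 < d)%N -> pH d y = y -> annE (y ^+ N).
  move=> d0 yd e; have [M [_ eM]] := graded_bound grE e.
  rewrite (eM _ (leqnn M)) scaler_sumr big1 // => i _.
  apply: (hN (i + N * d)%N).
    by apply: leq_trans (leq_addl _ _); rewrite -[X in (X <= _)%N]muln1 leq_mul.
  by apply: (gradedM grE); [exact: (degX grH pH_scalar) | exact: (graded_idem grE)].
have sub m : zariski_locus annE m -> m = irrelevant_maximal pH.
  move=> [mm am]; have [lm m1 mx] := mm; have pm := maximal_prime mm.
  have [lI I1 Ix] := irrelevant_maximalP grH pH_scalar local0.
  have mI : irrelevant_maximal pH `<=` m.
    move=> h [n hn]; have h0 : m (pH 0%N h).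
      by apply: (prime_exp pm (n := n)); rewrite hn; exact: lideal0.
    have [M [_ hM]] := graded_bound grH (h : H^o).
    rewrite (hM M.+1) // big_ord_recl; apply: lidealD => //; apply: lideal_sum => // i _.
    apply: (prime_exp pm (n := N)); apply: am; apply: (annpos _ i.+1) => //.
    exact: (graded_idem (E := H^o) grH).
  by apply/seteqP; split=> //; exact: Ix.
have [_ [[m Zm] _] Z0V] := Zi 0%N isT; have [_ _ Z1V] := Zi 1%N isT.
have [_ nZ] := Zlt 0%N isT; apply: nZ => m' Z1m'.
by rewrite (sub _ (Z1V _ Z1m')) -(sub _ (Z0V _ Zm)).
Qed.

(** The element 0 would be a parameter only for an eventually zero [E], so its [quotient_ann], the
    annihilator of [E], has a relevant closure. *)
Lemma not_eventually_zero_chain : ~ eventually_zero ->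
  has_irreducible_chain (zariski_locus annE) 1.
Proof.
move=> nz; have p0 : pH 1%N 0 = 0 by exact: (pH00 grH).
have np : ~ parameter 0.
  by move=> [N hN]; apply: nz; exists N => n e Nn /(hN n e Nn) [u ->]; rewrite scale0r.
have [P [hP rP pP relP aP]] := maximal_relevant grH pH_scalar noeth
  (jrad_homog grH pH_scalar (quotient_ann_homog grH grE p0)) (@jrad_idem _ _)
  (nonparameter_relevant grH noeth grE fgE p0 np).
apply: (locus_chain grH pH_scalar noeth local0 hP) => // h ha; apply: aP; apply: sub_jrad.
exact: module_ann_sub.
Qed.

Lemma iter_homog x d : (0 < d)%N -> pH d x = x ->
  forall N, (forall n e, (N <= n)%N -> pE n e = e -> multiple x e) ->
  forall n e, (N <= n)%N -> pE n e = e ->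
    exists2 e', e = x *: e' & ((d <= n)%N /\ pE (n - d)%N e' = e') \/ e = 0.
Proof.
move=> d0 xd N hN n e Nn en; have [u eu] := hN n e Nn en.
move: (gradedZ grE n u xd); rewrite -eu en; case: leqP => dn eq.
  exists (pE (n - d)%N u) => //; left; split=> //; exact: (graded_idem grE).
by exists u => //; right.
Qed.

Hypothesis finE : forall n, exists b : seq E, forall e, pE n e = e -> kspan b e.

Lemma kspan_below N : exists b : seq E, forall n e, (n < N)%N -> pE n e = e -> kspan b e.
Proof.
elim: N => [|N [b hb]]; first by exists [::].
have [b' hb'] := finE N; exists (b ++ b') => n e; rewrite ltnS leq_eqVlt.
case/orP=> [/eqP -> /hb'|nN /(hb _ _ nN)]; first exact: fspan_catr.
exact: fspan_catl.
Qed.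

(** In degrees at least [N], multiplication by [x] maps degree [n - d] onto degree [n], so one
    spanning family for the degrees below [N] bounds all of them. *)
Lemma parameter_bounded : has_parameter -> bounded_degrees.
Proof.
move=> [x [d [d0 xd [N hN]]]]; have [b hb] := kspan_below N.
exists (size b) => n; have [l] := ubnP n; elim: l n => // l IH n nl.
case: (ltnP n N) => [nN|Nn]; first by exists b; split=> // e; exact: hb.
have [dn|nd] := leqP d n; last first.
  exists [::]; split=> // e en /=.
  have [u _ [[dn _]|//]] := iter_homog d0 xd hN Nn en.
  by rewrite leqNgt nd in dn.
have [b' [sb hb']] : exists b' : seq E, (size b' <= size b)%N /\
    forall e, pE (n - d)%N e = e -> kspan b' e.
  apply: IH; apply: (leq_trans _ (nl : (n <= l)%N)).
  by rewrite ltn_subrL d0 (leq_trans d0 dn).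
exists [seq x *: e | e <- b']; rewrite size_map; split=> // e en.
have [u eu [[_ ud]|e0]] := iter_homog d0 xd hN Nn en; last first.
  by rewrite e0; exact: fspan0.
rewrite eu; have := hb' u ud; elim: b' u {sb hb' eu ud} => [|y b' IHb] u /=.
  by move=> ->; rewrite scaler0.
by move=> [r /IHb hr]; exists r; rewrite scalerA mulrC -scalerA -scalerBr.
Qed.

(** The [x]-power torsion [G] is finitely generated, hence killed by a single [x ^+ j]. In high
    degrees [e = x ^+ j *: u]; if [x *: e = 0], then [u] is torsion and [x ^+ j] already kills
    it. *)
Lemma parameter_injective x d : (0 < d)%N -> pH d x = x -> parameter x ->
  exists N, forall n e, (N <= n)%N -> pE n e = e -> x *: e = 0 -> e = 0.
Proof.
move=> d0 xd [N hN].
pose G : set E := [set e | exists j, x ^+ j *: e = 0].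
have Gmono j i (e : E) : x ^+ j *: e = 0 -> x ^+ (j + i)%N *: e = 0.
  by move=> h; rewrite addnC exprD -scalerA h scaler0.
have Gs : submodule G.
  split; first by exists 0%N; rewrite scaler0.
  move=> a u v [i ui] [j vj]; exists (i + j)%N.
  rewrite scalerDr scalerA mulrC -scalerA (Gmono _ _ _ ui) scaler0 add0r.
  by rewrite addnC; exact: Gmono.
have [s hs] := fg_idspan fgE.
have [g gG gspan] := noetherian_submodule noeth Gs (fun e _ => hs e).
have [j hj] : exists j, forall e, e \in g -> x ^+ j *: e = 0.
  elim: g gG {gspan} => [|e g IH] gG; first by exists 0%N.
  have [|j hj] := IH; first by move=> u ug; apply: gG; rewrite inE ug orbT.
  have [i ei] := gG e (mem_head _ _); exists (i + j)%N => u.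
  rewrite inE => /orP[/eqP->|ug]; first exact: Gmono.
  by rewrite addnC; apply: Gmono; exact: hj.
have {}hj e : G e -> x ^+ j *: e = 0.
  move/gspan; elim: g e hj {gG gspan} => [|u g IH] e hj /=; first by move=> ->; rewrite scaler0.
  move=> [r /IH hr]; rewrite -(subrK (r *: u) e) scalerDr hr ?add0r.
    by rewrite scalerA mulrC -scalerA hj ?mem_head // scaler0.
  by move=> v vg; apply: hj; rewrite inE vg orbT.
have iter i n e : (N + i * d <= n)%N -> pE n e = e -> exists u, e = x ^+ i *: u.
  elim: i n e => [|i IH] n e le en; first by exists e; rewrite expr0 scale1r.
  have [u eu [[dn ud]|->]] := iter_homog d0 xd hN
     (leq_trans (leq_addr _ _) le) en; last by exists 0; rewrite scaler0.
  have [|v uv] := IH (n - d)%N u _ ud.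
    by rewrite leq_subRL // addnCA -mulSn.
  by exists v; rewrite eu uv scalerA exprS.
exists (N + j * d)%N => n e le en xe.
have [u eu] := iter j n e le en; rewrite eu; apply: hj.
by exists j.+1; rewrite exprS -scalerA -eu.
Qed.

(** Repeated division by [x] ends below degree [N], where [E] is spanned over [k] by finitely many
    elements; so [E] is finitely generated over [k[x]]. *)
Lemma parameter_span x d : (0 < d)%N -> pH d x = x -> parameter x ->
  exists b : seq E, forall e, fspan (horner_alg x) b e.
Proof.
move=> d0 xd [N hN]; have [b hb] := kspan_below N.
exists b => e; have [M [_ eM]] := graded_bound grE e; rewrite (eM _ (leqnn M)).
apply: fspan_sum => i _.
suff key n u : pE n u = u -> fspan (horner_alg x) b u.
  by apply: (key i); exact: (graded_idem grE).
have [l] := ubnP n; elim: l n u => // l IH n1 e1 nl en.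
case: (ltnP n1 N) => [nN|Nn].
  have /fspanP [c ->] := hb n1 e1 nN en; apply/fspanP; exists (fun t => (c t)%:P).
  by apply: eq_bigr => t _; congr (_ *: _); apply: esym; exact: horner_algC.
have [u0 -> [[dn ud]|]] := iter_homog d0 xd hN Nn en.
  have -> : x *: u0 = horner_alg x 'X *: u0 by rewrite horner_algX. apply: (fspanZ (f := horner_alg x)); apply: (IH (n1 - d)%N) => //.
  apply: (leq_trans _ (nl : (n1 <= l)%N)).
  by rewrite ltn_subrL d0 (leq_trans d0 dn).
by move=> ->; exact: fspan0.
Qed.

(** The determinant trick: with [Q] the matrix of [h] on generators over [k[x]], the adjugate shows
    that the determinant of [h - Q] kills every generator. *)
Lemma parameter_integral x d : (0 < d)%N -> pH d x = x -> parameter x ->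
  forall h, exists2 q : {poly {poly k}}, q \is monic &
    annE (map_poly (horner_alg x) q).[h].
Proof.
move=> d0 xd par h; have [b hb] := parameter_span d0 xd par.
pose s := size b.
have hr (i : 'I_s) : exists c : nat -> {poly k},
    h *: b`_i = \sum_(j < s) horner_alg x (c j) *: b`_j.
  exact/fspanP.
have [c hc] := choice hr.
pose P : 'M[{poly k}]_s := \matrix_(i, j) c i j.
pose Q := map_mx (horner_alg x) P.
exists (char_poly P); first exact: char_poly_monic.
rewrite map_char_poly -/Q.
have -> : (char_poly Q).[h] = \det (h%:M - Q).
  rewrite -[LHS]/(horner_eval h (\det _)) -det_map_mx; congr (\det _).
  by apply/matrixP => i j; rewrite !mxE /= /horner_eval hornerD hornerN hornerC hornerMn hornerX.
set D := h%:M - Q.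
have Db (i : 'I_s) : \sum_j D i j *: b`_j = 0.
  under eq_bigr do rewrite !mxE scalerBl -scalerMnl.
  rewrite sumrB -hc (bigD1 i) //= eqxx mulr1n big1 ?addr0 ?subrr // => j ji.
  by rewrite eq_sym (negbTE ji) mulr0n.
have detb (i : 'I_s) : \det D *: b`_i = 0.
  have -> : \det D *: b`_i = \sum_j (\adj D *m D) i j *: b`_j.
    rewrite mul_adj_mx (bigD1 i) //= !mxE eqxx mulr1n big1 ?addr0 // => j ji.
    by rewrite !mxE eq_sym (negbTE ji) mulr0n scale0r.
  under eq_bigr do rewrite mxE scaler_suml.
  rewrite exchange_big big1 //= => l _.
  by under eq_bigr do rewrite -scalerA; rewrite -scaler_sumr Db scaler0.
move=> e; have /fspanP [u ->] := hb e; rewrite scaler_sumr big1 // => i _.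
by rewrite scalerA mulrC -scalerA detb scaler0.
Qed.

(** In a chain of length 2, an [h] in the ideal of the middle member but not in that of the top one
    is integral over [k[x]], so the ideal of the middle member contains a nonzero polynomial in [x].
    This ideal is then maximal, the middle member is a point, and nothing fits below it. *)
Lemma parameter_no_chain : has_parameter ->
  ~ has_irreducible_chain (zariski_locus annE) 2.
Proof.
move=> [x [d [d0 xd par]]] [Z [Zi Zlt]].
have [c0 i0 _] := Zi 0%N isT; have [c1 i1 s1] := Zi 1%N isT; have [c2 i2 s2] := Zi 2 isT.
have pP1 := vanish_prime c1 i1; have pP2 := vanish_prime c2 i2.
have aP (Y : set (set H)) : Y `<=` zariski_locus annE -> annE `<=` vanish Y.
  by move=> sY h ha m /sY [_]; apply.
have [sub12 nsub12] := Zlt 1%N isT; have [sub01 nsub01] := Zlt 0%N isT.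
have [h h1 h2] : exists2 h, vanish (Z 1%N) h & ~ vanish (Z 2) h.
  apply: contrapT => no; apply: nsub12.
  rewrite -(vanishK c1) -(vanishK c2) => m [mm vm]; split=> // h hv.
  by apply: vm; apply: contrapT => nv; apply: no; exists h.
have [q qm qh] := parameter_integral d0 xd par h.
have [r r0 r1] := lower_coefficient pP2 pP1 (vanishS sub12) h1 h2 (monic_neq0 qm) (aP _ s2 _ qh).
have [z hz] := poly_root_in_prime pP1 r0 r1.
have [|lm m1 mx] := integral_maximal pP1 hz.
  move=> g; have [q' q'm q'h] := parameter_integral d0 xd par g.
  by exists q' => //; exact: aP q'h.
have all m : Z 1%N m -> m = vanish (Z 1%N).
  move=> Zm; have [lM M1 Mx] := zariski_closed_max c1 Zm.
  by apply/seteqP; split; [apply: mx => // g; apply | move=> g; apply].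
have [[m Zm] _] := i0; apply: nsub01 => m' Zm'.
by rewrite (all _ Zm') -(all _ (sub01 _ Zm)).
Qed.

(** Modulo [P1] only the term without [f] survives, so its coefficient is zero; a factor [f] then
    cancels modulo [P2]. *)
Lemma monomials_independent (P2 P1 : set H) (f y : H) : prime_ideal P2 -> prime_ideal P1 ->
  P2 `<=` P1 -> P1 f -> ~ P2 f -> ~ P1 y -> forall n (c : nat -> k),
  P2 (\sum_(j < n.+1) c j *: (f ^+ j * y ^+ (n - j))) -> forall j, (j < n.+1)%N -> c j = 0.
Proof.
move=> pP2 pP1 P21 Pf nf ny; have [l2 _ M2] := pP2; have [l1 P11 M1] := pP1.
have unit1 (c : k) u : ~ P1 u -> P1 (c *: u) -> c = 0.
  move=> nu Pcu; apply/eqP; apply: contrapT => /negP c0; apply: nu.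
  have -> : u = (c^-1)%:A * (c *: u) by rewrite mulr_algl scalerA mulVf // scale1r.
  exact: lidealMl.
elim=> [|n IH] c; rewrite big_ord_recl expr0 mul1r subn0 => h; have h1 := P21 _ h.
  rewrite big_ord0 addr0 in h1; case=> // _; apply: unit1 h1.
  by rewrite expr0.
have e : \sum_(i < n.+1) c (lift ord0 i) *: (f ^+ lift ord0 i * y ^+ (n.+1 - lift ord0 i)) =
    f * \sum_(i < n.+1) c i.+1 *: (f ^+ i * y ^+ (n - i)).
  rewrite mulr_sumr; apply: eq_bigr => i _.
  by rewrite !lift0 subSS exprS -scalerAr mulrA.
rewrite e in h h1.
have c0 : c 0%N = 0.
  apply: (unit1 _ (y ^+ n.+1)); first by move/(prime_exp pP1).
  rewrite -(addrK (f * \sum_(i < n.+1) c i.+1 *: (f ^+ i * y ^+ (n - i))) (_ *: _)).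
  by apply: lidealB => //; exact: lidealMr.
case=> // j jn; apply: (IH (fun j => c j.+1)) => //.
by move: h; rewrite c0 scale0r add0r => /M2[].
Qed.

(** Otherwise there are nested primes and [n + 1] monomials of degree [n * d] independent modulo
    [P2]. Each sends the [s] generators into degrees spanned by at most [B] elements, so for
    [n = s * B] a nontrivial combination annihilates [E] and lies in [P2]. *)
Lemma bounded_has_parameter : bounded_degrees -> has_parameter.
Proof.
move=> [B hB].
case: (parameter_or_chain grH pH_scalar noeth grE fgE) => //.
move=> [P1 [P2 [[hP1 hP2] [rP1 rP2] [pP1 pP2] relP1 [P21 nP12 aP2]]]]; exfalso.
have [_ _ M1] := pP1; have [_ _ M2] := pP2; have [_ hom1] := hP1; have [l2 hom2] := hP2.
have [y [e [e0 ye ny]]] := relP1.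
have [u Pu nu] : exists2 u, P1 u & ~ P2 u.
  by apply: contrapT => no; apply: nP12 => u Pu; apply: contrapT => nu; apply: no; exists u.
have [i ni] : exists i, ~ P2 (pH i u).
  apply: contrapT => no; apply: nu; have [N [_ uN]] := graded_bound grH (u : H^o).
  rewrite (uN _ (leqnn N)); apply: lideal_sum => // i _.
  by apply: contrapT => ni; apply: no; exists i.
(* The exponents bring [f] and [z] to the common degree [(i + e) * e]. *)
pose f := (pH i u * y) ^+ e; pose z := y ^+ (i + e).
pose d := ((i + e) * e)%N.
have ie : pH i (pH i u) = pH i u := graded_idem (E := H^o) grH i u.
have fd : pH d f = f.
  by rewrite /d mulnC; apply: (degX grH pH_scalar); exact: degM.
have zd : pH d z = z by exact: (degX grH pH_scalar).
have l1 : left_ideal P1 by case: pP1.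
have f1 : P1 f by apply: lideal_exp => //; apply: lidealMr => //; exact: hom1.
have f2 : ~ P2 f by move/(prime_exp pP2)/M2 => [|/P21].
have nz : ~ P1 z by move/(prime_exp pP1).
have [g [gd gspan]] := homog_gens grE fgE.
pose s := size g; pose gl (l : 'I_s) := nth (0%N, 0) g l; pose n := #|{: 'I_s * 'I_B}|.
have [b hb] : exists b : 'I_s -> 'I_B -> E, forall (l : 'I_s) w,
    pE (n * d + (gl l).1)%N w = w -> exists c : 'I_B -> k, w = \sum_t (c t)%:A *: b l t.
  have h (l : 'I_s) : exists b : 'I_B -> E, forall w,
    pE (n * d + (gl l).1)%N w = w -> exists c : 'I_B -> k, w = \sum_t (c t)%:A *: b t.
    have [b [sb hb]] := hB (n * d + (gl l).1)%N.
    exists (fun t => b`_t) => w /hb /fspanP [c ->].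
    exists (fun t => if (t < size b)%N then c t else 0).
    rewrite (big_ord_widen B (fun t => in_alg H (c t) *: b`_t) sb) big_mkcond /=.
    by apply: eq_bigr => t _; case: ifP => // _; rewrite scale0r scale0r.
  by have [b hb] := choice h; exists b.
pose mon (j : 'I_n.+1) := f ^+ j * z ^+ (n - j).
have mond j : pH (n * d)%N (mon j) = mon j.
  rewrite /mon -{1}(subnKC (ltn_ord j : (j <= n)%N)) mulnDl.
  by apply: degM => //; exact: (degX grH pH_scalar).
have hc (jl : 'I_n.+1 * 'I_s) : exists c : 'I_B -> k,
    mon jl.1 *: (gl jl.2).2 = \sum_t (c t)%:A *: b jl.2 t.
  apply: hb; rewrite addnC; apply: (gradedM grE); first exact: mond.
  by apply: gd; rewrite mem_nth.
have [c cP] := choice hc.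
pose C : 'M[k]_(n.+1, n) :=
  \matrix_(j, t) c (j, (enum_val t).1) (enum_val t).2.
have [v v0 vC] : exists2 v : 'rV[k]_n.+1, v != 0 & v *m C = 0.
  have : kermx C != 0.
    by rewrite kermx_eq0 /row_free neq_ltn ltnS rank_leq_col.
  case/rowV0Pn => v /sub_kermxP vC v0; by exists v.
case/eqP: v0; apply/rowP => j0; rewrite mxE.
(* The vector is extended by 0 to a sequence, the form of coefficients that [monomials_independent]
   takes. *)
pose vn j := if insub j is Some j' then v 0 j' else 0 : k.
have vnE (j : 'I_n.+1) : vn j = v 0 j by rewrite /vn valK.
rewrite -vnE; apply: (monomials_independent pP2 pP1 P21 f1 f2 nz (n := n)) (ltn_ord j0).
apply: aP2 => w.
have kill (l : 'I_s) : (\sum_(j < n.+1) vn j *: (f ^+ j * z ^+ (n - j))) *: (gl l).2 = 0.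
  rewrite scaler_suml.
  under eq_bigr => j _.
    rewrite -mulr_algl -scalerA (cP (j, l)) /= scaler_sumr vnE; over.
  rewrite exchange_big big1 //= => t _.
  have := congr1 (fun A : 'rV_n => A 0 (enum_rank (l, t))) vC; rewrite !mxE => h.
  under eq_bigr do rewrite scalerA -!in_algE -rmorphM.
  rewrite -scaler_suml -rmorph_sum /= -[X in X%:A]/(\sum_j v 0 j * c (j, l) t).
  suff -> : \sum_j v 0 j * c (j, l) t = 0 by rewrite scale0r scale0r.
  by rewrite -[RHS]h; apply: eq_bigr => j _; rewrite mxE enum_rankK.
have /fspanP [a ->] := gspan w; rewrite scaler_sumr big1 // => l _.
rewrite scalerA mulrC -scalerA.
have ls : (l < s)%N by apply: (leq_trans (ltn_ord l)); rewrite size_map.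
rewrite (nth_map (0%N, 0)) //.
by have := kill (Ordinal ls); rewrite /gl /= => ->; rewrite scaler0.
Qed.

Lemma line_parameter : variety_dim (zariski_locus annE) 1 <->
  has_parameter /\ ~ eventually_zero.
Proof.
split=> [[ch nch]|[par nz]]; last first.
  by split; [exact: not_eventually_zero_chain | exact: parameter_no_chain].
split; last by move/eventually_zero_no_chain.
case: (parameter_or_chain grH pH_scalar noeth grE fgE) => //.
move=> [P1 [P2 [[hP1 hP2] [rP1 rP2] [pP1 pP2] relP1 [P21 nP12 aP2]]]].
by case: nch; exact: (locus_chain2 grH pH_scalar noeth local0 hP1 rP1 pP1 relP1 rP2 pP2).
Qed.

End BoundedDegrees.

(** * Finite dimensional modules *)

Section LinearMaps.
Variable R : nzRingType.
Implicit Types M N X Y P W : lmodType R.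

Definition mklin M N (f : M -> N) (hf : linear f) : {linear M -> N} :=
  HB.pack f (GRing.isLinear.Build R M N _ f hf).

(** A total linear relation that is single-valued at 0 is the graph of a linear map. Maps defined
    through preimages are obtained in this way. *)
Lemma lin_choice M N (G : M -> N -> Prop) :
  (forall x, exists y, G x y) ->
  (forall a x y x' y', G x y -> G x' y' -> G (a *: x + x') (a *: y + y')) ->
  (forall y, G 0 y -> y = 0) ->
  exists f : {linear M -> N}, forall x, G x (f x).
Proof.
move=> tot lin uniq; have [f hf] := choice tot.
have fun_uniq x y y' : G x y -> G x y' -> y = y'.
  move=> h h'; apply/eqP; rewrite -subr_eq0; apply/eqP; apply: uniq.
  have := lin (-1) _ _ _ _ h' h; rewrite !scaleN1r addNr.
  by rewrite addrC.
have fl : linear f by move=> a x y; apply: fun_uniq (hf _) (lin _ _ _ _ _ _ _).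
by exists (mklin fl).
Qed.

Lemma injective_ker M N (f : {linear M -> N}) : (forall x, f x = 0 -> x = 0) -> injective f.
Proof. by move=> h x y e; apply/eqP; rewrite -subr_eq0; apply/eqP/h; rewrite linearB e subrr. Qed.

Lemma submodule0 M (U : set M) : submodule U -> U 0. Proof. by case. Qed.
Lemma submoduleD M (U : set M) x y : submodule U -> U x -> U y -> U (x + y).
Proof. by move=> [_ h] Ux Uy; have := h 1 _ _ Ux Uy; rewrite scale1r. Qed.
Lemma submoduleZ M (U : set M) a x : submodule U -> U x -> U (a *: x).
Proof. by move=> [h0 h] Ux; have := h a _ _ Ux h0; rewrite addr0. Qed.
Lemma submoduleB M (U : set M) x y : submodule U -> U x -> U y -> U (x - y).
Proof. by move=> hU Ux Uy; apply: submoduleD => //; rewrite -scaleN1r; exact: submoduleZ. Qed.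

Lemma kernel_submodule M N (f : {linear M -> N}) : submodule [set x | f x = 0].
Proof. by split=> [|a x y /= fx fy]; rewrite /= ?linear0 // linearP fx fy scaler0 addr0. Qed.

Lemma range_submodule M N (f : {linear M -> N}) : submodule [set y | exists x, f x = y].
Proof.
split=> [|a x y /= [u <-] [v <-]]; first by exists 0; rewrite linear0.
by exists (a *: u + v); rewrite linearP.
Qed.

Lemma bijectiveP (S T : Type) (f : S -> T) : injective f -> surjective f -> bijective f.
Proof.
move=> fi fs; have [g hg] := choice fs.
by exists g => [x|//]; apply: fi.
Qed.

Lemma bijective_surjective (S T : Type) (f : S -> T) : bijective f -> surjective f.
Proof. by move=> [g _ gK] y; exists (g y). Qed.

Lemma linear_inverse M N (f : {linear M -> N}) : bijective f ->
  exists g : {linear N -> M}, cancel f g /\ cancel g f.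
Proof.
move=> bf; have fi := bij_inj bf.
have [||y|g hg] := @lin_choice N M (fun y x => f x = y).
- exact: bijective_surjective.
- by move=> a x y x' y' <- <-; rewrite linearP.
- by move=> e; apply: fi; rewrite e linear0.
by exists g; split=> [x|y]; [apply: fi | ]; rewrite hg.
Qed.

Definition retract X P := exists (i : {linear X -> P}) (r : {linear P -> X}), forall x, r (i x) = x.

Lemma retract_projective X P : projective P -> retract X P -> projective X.
Proof.
move=> pP [i [r ri]] Y Z g f sg.
have [h hh] := pP _ _ g (f \o r) sg.
by exists (h \o i) => x /=; rewrite hh /= ri.
Qed.

Lemma retract_injective X P : injective_module P -> retract X P -> injective_module X.
Proof.
move=> iP [i [r ri]] Y Z j f ij.
have [g hg] := iP _ _ j (i \o f) ij.
by exists (r \o g) => x /=; rewrite hg /= ri.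
Qed.

Lemma injective_sub_retract W P (j : {linear W -> P}) : injective_module W -> injective j ->
  exists r : {linear P -> W}, forall w, r (j w) = w.
Proof. by move=> iW ij; have [r hr] := iW _ _ j idfun ij; exists r. Qed.

Lemma prod_projective P W : projective P -> projective W -> projective (P * W)%type.
Proof.
move=> pP pW X Y g f sg.
have f1l : linear (fun p : P => f (p, 0)).
  by move=> a x y; rewrite -linearP; congr (f _); apply/pair_equal_spec; rewrite /= scaler0 addr0.
have f2l : linear (fun w : W => f (0, w)).
  by move=> a x y; rewrite -linearP; congr (f _); apply/pair_equal_spec; rewrite /= scaler0 addr0.
have [h1 e1] := pP _ _ g (mklin f1l) sg; have [h2 e2] := pW _ _ g (mklin f2l) sg.
have hl : linear (fun pw : P * W => h1 pw.1 + h2 pw.2).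
  by move=> a [x1 x2] [y1 y2] /=; rewrite !linearP scalerDr addrACA.
exists (mklin hl) => -[p w] /=; rewrite linearD e1 e2 /= -linearD.
by congr (f _); apply/pair_equal_spec; rewrite /= addr0 add0r.
Qed.

Lemma quotient_module M (U : set M) : submodule U ->
  exists (Y : lmodType R) (p : {linear M -> Y}), surjective p /\ forall x, p x = 0 <-> U x.
Proof.
move=> [U0 UD].
have hS : submod_closed [pred x | `[< U x >]].
  split=> [|a x y /asboolP Ux /asboolP Uy]; apply/asboolP => //; exact: UD.
have pl : linear (lquot_pi hS : M -> lquot hS).
  by move=> a x y; rewrite lquot_piD; congr (_ + _); apply: esym; exact: lquot_scaleE.
exists (lquot hS), (mklin pl); split=> [y|x]; first by eexists; exact: lquot_pi_surj.
split=> [|Ux].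
  have -> : (0 : lquot hS) = lquot_pi hS 0 by rewrite -[RHS]/(mklin pl 0) linear0.
  by move/lquot_piE; rewrite subr0 => /asboolP.
have -> : (0 : lquot hS) = lquot_pi hS 0 by rewrite -[RHS]/(mklin pl 0) linear0.
by apply/lquot_piE; rewrite subr0; apply/asboolP.
Qed.

End LinearMaps.

Section SubmoduleType.
Variables (R : nzRingType) (M : lmodType R) (U : set M).
Hypothesis hU : submodule U.

(** The argument of type [submodule U] makes the proof available to the structure instances. *)
Definition sub_pred of submodule U : {pred M} := [pred x | `[< U x >]].
Lemma sub_pred_closed : submod_closed (sub_pred hU).
Proof.
split=> [|a x y /asboolP Ux /asboolP Uy]; apply/asboolP; first by case: hU.
by have [_ h] := hU; exact: h.
Qed.
HB.instance Definition _ := GRing.isSubmodClosed.Build R M (sub_pred hU) sub_pred_closed.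

Record subtype_of := SubtypeOf { subtype_val : M; _ : subtype_val \in sub_pred hU }.
HB.instance Definition _ := [isSub for subtype_val].
HB.instance Definition _ := [Choice of subtype_of by <:].
HB.instance Definition _ := [SubChoice_isSubLmodule of subtype_of by <:].
End SubmoduleType.

Lemma sub_module (R : nzRingType) (M : lmodType R) (U : set M) : submodule U ->
  exists (X : lmodType R) (i : {linear X -> M}), injective i /\ forall v, U v <-> exists x, i x = v.
Proof.
move=> hU.
have vl : linear (val : subtype_of hU -> M) by move=> a x y; rewrite !linearP.
exists (subtype_of hU : lmodType R), (mklin vl); split; first exact: val_inj.
move=> v; split=> [Uv|[x <-]]; last exact/asboolP/(valP x).
have hv : v \in sub_pred hU by apply/asboolP.
by exists (SubtypeOf hv).
Qed.

(** * Free, projective and injective modules *)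

Section FreeModules.
Variable R : nzRingType.
Implicit Types M P : lmodType R.

Lemma free_map M n (x : 'I_n -> M) :
  exists f : {linear 'rV[R]_n -> M}, forall v, f v = \sum_i v 0 i *: x i.
Proof.
have fl : linear (fun v : 'rV[R]_n => \sum_i v 0 i *: x i).
  move=> a u v; rewrite scaler_sumr -big_split; apply: eq_bigr => i _.
  by rewrite !mxE scalerDl scalerA.
by exists (mklin fl).
Qed.

Lemma free_projective n : projective 'rV[R]_n.
Proof.
move=> X Y g f sg.
have [x hx] := choice (fun i : 'I_n => sg (f (delta_mx 0 i))).
have [h hh] := free_map x; exists h => v.
rewrite hh linear_sum [in RHS](row_sum_delta v) linear_sum.
by apply: eq_bigr => i _; rewrite !linearZ /= hx.
Qed.

Lemma free_fg n : finitely_generated 'rV[R]_n.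
Proof.
pose e : seq 'rV[R]_n := [seq delta_mx 0 i | i <- enum 'I_n].
have se : size e = n by rewrite size_map size_enum_ord.
exists e => v; exists (fun j => if insub j is Some i then v 0 i else 0).
rewrite {1}(row_sum_delta v) se; apply: eq_bigr => i _.
by rewrite valK (nth_map i) ?nth_ord_enum // size_enum_ord.
Qed.

Lemma fg_free_cover M : finitely_generated M ->
  exists n (p : {linear 'rV[R]_n -> M}), surjective p.
Proof.
move=> [s hs]; exists (size s); have [p hp] := free_map (fun i : 'I_(size s) => s`_i).
exists p => y; have [c ->] := hs y; exists (\row_i c i).
by rewrite hp; apply: eq_bigr => i _; rewrite mxE.
Qed.

Lemma fg_surjective M P (p : {linear P -> M}) : surjective p ->
  finitely_generated P -> finitely_generated M.
Proof.
move=> sp [s hs]; exists [seq p x | x <- s] => y; have [x <-] := sp y.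
have [c xE] := hs x; exists c; rewrite {1}xE linear_sum size_map.
by apply: eq_bigr => i _; rewrite (nth_map 0) // linearZ.
Qed.

Lemma fg_projective_retract P : projective P -> finitely_generated P ->
  exists n, retract P 'rV[R]_n.
Proof.
move=> pP /fg_free_cover [n [p sp]]; exists n.
by have [h hh] := pP _ _ p idfun sp; exists h, p.
Qed.

Lemma free_injective n : injective_module R^o -> injective_module 'rV[R]_n.
Proof.
move=> iR X Y i f ii.
have fl (j : 'I_n) : linear (fun x => f x 0 j : R^o).
  by move=> a x y; rewrite linearP !mxE.
have [g hg] := choice (fun j => iR _ _ i (mklin (fl j)) ii).
have gl : linear (fun y => \row_j (g j y : R)).
  by move=> a x y; apply/rowP => j; rewrite !mxE linearP.
by exists (mklin gl) => x; apply/rowP => j; rewrite mxE hg.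
Qed.

(** [P] is a retract of a free module of finite rank, which is injective along with the ring. *)
Lemma projective_injective P : injective_module R^o -> projective P ->
  finitely_generated P -> injective_module P.
Proof.
move=> iR pP fP; have [n rP] := fg_projective_retract pP fP.
by apply: retract_injective rP; exact: free_injective.
Qed.

End FreeModules.

(** * Dimension over the base field *)

Section FiniteDimension.
Variables (k : fieldType) (A : falgType k).
Implicit Types M N X Y P W K : lmodType A.

Local Notation kspan := (@fspan k A (in_alg A)).

Definition klinear (M N : lmodType A) (f : M -> N) : Prop :=
  forall (c : k) x y, f (c%:A *: x + y) = c%:A *: f x + f y.

Lemma linear_klinear M N (f : {linear M -> N}) : klinear f.
Proof. by move=> c x y; rewrite linearP. Qed.

Lemma kspan_fg M : finitely_generated M <-> exists b : seq M, forall x, kspan b x.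
Proof.
split=> [[s hs]|[b hb]]; last first.
  by exists b => x; have /fspanP [c ->] := hb x; exists (fun i => (c i)%:A).
pose e := vbasis {:A}.
exists [seq a *: x | x <- s, a <- e] => x; have [c ->] := hs x.
apply: fspan_sum => i _; rewrite (coord_vbasis (memvf (c i))) scaler_suml.
apply: fspan_sum => t _; rewrite -mulr_algl -scalerA; apply: (fspanZ (f := in_alg A)).
apply: fspan_mem; apply/allpairsP; exists (s`_i, e`_t); split=> //; rewrite mem_nth //.
by rewrite size_tuple.
Qed.

(** A spanning family of least size is independent: a nontrivial relation would express one member
    by the others. *)
Lemma kspan_minimal M : finitely_generated M -> exists b : seq M, (forall x, kspan b x) /\
  forall c : nat -> k, \sum_(i < size b) (c i)%:A *: b`_i = 0 ->
    forall i, (i < size b)%N -> c i = 0.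
Proof.
move=> /kspan_fg [b0 hb0].
have ex : exists n, `[< exists2 b : seq M, size b = n & forall x, kspan b x >].
  by exists (size b0); apply/asboolP; exists b0.
case: (ex_minnP ex) => n /asboolP [b sb hb] minb; exists b; split=> // c ce i ib.
apply/eqP; apply: contrapT => /negP ci.
pose b' := take i b ++ drop i.+1 b.
have bE : b = take i b ++ b`_i :: drop i.+1 b by rewrite -drop_nth // cat_take_drop.
have sb' : (size b' < n)%N.
  by rewrite -sb [X in (_ < size X)%N]bE !size_cat /= addnS.
suff hb' x : kspan b' x.
  by have := leq_trans sb' (minb _ (asboolT (ex_intro2 _ _ b' erefl hb'))); rewrite ltnn.
have mem (j : nat) : (j < size b)%N -> j != i -> kspan b' b`_j.
  move=> jb ji; apply: fspan_mem; rewrite mem_cat.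
  case: (ltngtP j i) ji => // [ji|ij] _.
    by rewrite -(nth_take 0 ji) mem_nth // size_take ib.
  apply/orP; right; rewrite -(subnKC ij) -nth_drop mem_nth // size_drop.
  by rewrite ltn_sub2r // (leq_ltn_trans ij).
apply: fspan_trans (hb x) => y yb.
rewrite -(nth_index 0 yb); have [ji|ji] := eqVneq (index y b) i; last by apply: mem; rewrite ?index_mem.
rewrite ji.
have -> : b`_i = (- (c i)^-1)%:A *: \sum_(j < size b | j != i :> nat) (c j)%:A *: b`_j.
  move: ce; rewrite (bigD1 (Ordinal ib)) //= => /eqP; rewrite addr_eq0 => /eqP ce.
  have -> : \sum_(j < size b | j != i :> nat) (c j)%:A *: b`_j = - ((c i)%:A *: b`_i).
    by rewrite ce opprK; apply: eq_bigl => j.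
  rewrite scalerN scaleNr scaleNr opprK scalerA mulr_algl scalerA mulVf // scale1r.
  by rewrite scale1r.
apply: (fspanZ (f := in_alg A)); apply: fspan_sum => j ji'.
by apply: (fspanZ (f := in_alg A)); exact: mem.
Qed.

(** Coordinates in [k^n]. The module is declared over [A] only and [k] acts through [c%:A], so
    linearity over [k] is spelled out. *)
Definition kcoord M n : Prop := exists (f : M -> 'rV[k]_n) (g : 'rV[k]_n -> M),
  [/\ cancel f g, cancel g f & forall c x y, f (c%:A *: x + y) = c *: f x + f y].

Lemma kcoord_exists M : finitely_generated M -> exists n, kcoord M n.
Proof.
move=> /kspan_minimal [b [hb ind]]; exists (size b).
pose g (v : 'rV[k]_(size b)) : M := \sum_i (v 0 i)%:A *: b`_i.
have gl c u v : g (c *: u + v) = c%:A *: g u + g v.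
  rewrite /g scaler_sumr -big_split; apply: eq_bigr => i _.
  by rewrite !mxE [in LHS]scalerDl [in LHS]scalerDl scalerA mulr_algl scalerA.
have gs x : exists v, g v = x.
  have /fspanP [c ->] := hb x; exists (\row_i c i); apply: eq_bigr => i _.
  by rewrite mxE.
have [f hf] := choice gs.
have gi u v : g u = g v -> u = v.
  move=> e; have e0 : g (-1 *: v + u) = 0.
    by rewrite gl e scaleN1r scaleN1r addNr.
  apply/rowP => i.
  pose c j := if insub j is Some j' then (-1 *: v + u) 0 j' else 0 : k.
  have := ind c _ i (ltn_ord i); rewrite /c valK !mxE mulN1r addrC.
  move=> h; apply/eqP; rewrite -subr_eq0; apply/eqP; apply: h.
  by rewrite -[RHS]e0; apply: eq_bigr => j _; rewrite valK.
exists f, g; split=> // [v|c x y]; first by apply: gi; rewrite hf.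
by apply: gi; rewrite gl !hf.
Qed.

Lemma kcoord_klinear M n (f : M -> 'rV[k]_n) g : cancel f g -> cancel g f ->
  (forall c x y, f (c%:A *: x + y) = c *: f x + f y) ->
  forall c u v, g (c *: u + v) = c%:A *: g u + g v.
Proof. by move=> fK gK fl c u v; apply: (can_inj fK); rewrite gK fl !gK. Qed.

Lemma kcoord_zero M n (g : 'rV[k]_n -> M) :
  (forall c u v, g (c *: u + v) = c%:A *: g u + g v) -> g 0 = 0.
Proof.
move=> gl; have := gl (-1) 0 0; rewrite scaleN1r oppr0 addr0 => ->.
by rewrite !scaleN1r addNr.
Qed.

Lemma kcoord_matrix M N n m (f : M -> 'rV[k]_n) g (f' : N -> 'rV[k]_m) g' (h : M -> N) :
  cancel f g -> cancel g f -> (forall c x y, f (c%:A *: x + y) = c *: f x + f y) ->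
  cancel f' g' -> cancel g' f' -> (forall c x y, f' (c%:A *: x + y) = c *: f' x + f' y) ->
  klinear h -> exists F : 'M[k]_(n, m), forall x, f' (h x) = f x *m F.
Proof.
move=> fK gK fl fK' gK' fl' hl.
have Fl : linear (fun v => f' (h (g v))).
  by move=> c u v; rewrite (kcoord_klinear fK gK fl) hl fl'.
exists (lin1_mx (mklin Fl)) => x.
by rewrite -[f x *m _]/(f x *m lin1_mx (mklin Fl)) mul_rV_lin1 /= fK.
Qed.

Lemma kcoord_injective M N n m (h : M -> N) : kcoord M n -> kcoord N m -> klinear h ->
  injective h -> (n <= m)%N /\ (n = m -> surjective h).
Proof.
move=> [f [g [fK gK fl]]] [f' [g' [fK' gK' fl']]] hl hi.
have [F hF] := kcoord_matrix fK gK fl fK' gK' fl' hl.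
have rF : row_free F.
  rewrite -kermx_eq0; apply/rowV0P => v /sub_kermxP vF.
  have : f' (h (g v)) = f' (h (g 0)) by rewrite !hF !gK vF mul0mx.
  by move/(can_inj fK')/hi/(can_inj gK).
split=> [|e y]; first by rewrite -(eqP rF) rank_leq_col.
have fF : row_full F by rewrite /row_full (eqP rF) e.
have /submxP [D hD] := submx_full (f' y) fF.
by exists (g D); apply: (can_inj fK'); rewrite hF gK.
Qed.

Lemma kcoord_surjective M N n m (h : M -> N) : kcoord M n -> kcoord N m -> klinear h ->
  surjective h -> (m <= n)%N /\ (n = m -> injective h).
Proof.
move=> [f [g [fK gK fl]]] [f' [g' [fK' gK' fl']]] hl hs.
have [F hF] := kcoord_matrix fK gK fl fK' gK' fl' hl.
have fF : row_full F.
  rewrite -sub1mx; apply/row_subP => i; have [x hx] := hs (g' (row i 1%:M)).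
  by rewrite -[row i _]gK' -hx hF submxMl.
split=> [|e]; first by rewrite -(eqP fF) rank_leq_row.
have rF : row_free F by rewrite /row_free (eqP fF) e.
move=> x y exy; apply: (can_inj fK); apply: (row_free_inj rF).
by rewrite -!hF exy.
Qed.

(** The value 0 in the absence of finite coordinates makes the dimension a total function. *)
Definition kdim M : nat := if pselect (exists n, kcoord M n) is left p then projT1 (cid p) else 0%N.

Lemma kdimP M : finitely_generated M -> kcoord M (kdim M).
Proof.
move=> /kcoord_exists ex; rewrite /kdim; case: pselect => // p.
by case: (cid p).
Qed.

Lemma kdim_unique M n : finitely_generated M -> kcoord M n -> kdim M = n.
Proof.
move=> fM cn; have idl : klinear (@idfun M) by [].
have [h1 _] := kcoord_injective (kdimP fM) cn idl (fun _ _ e => e).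
have [h2 _] := kcoord_injective cn (kdimP fM) idl (fun _ _ e => e).
by apply/eqP; rewrite eqn_leq h1.
Qed.

Lemma kdim_injective M N (h : {linear M -> N}) : finitely_generated M -> finitely_generated N ->
  injective h -> (kdim M <= kdim N)%N /\ (kdim M = kdim N -> surjective h).
Proof. by move=> fM fN; apply: kcoord_injective (kdimP fM) (kdimP fN) (linear_klinear h). Qed.

Lemma kdim_surjective M N (h : {linear M -> N}) : finitely_generated M -> finitely_generated N ->
  surjective h -> (kdim N <= kdim M)%N /\ (kdim M = kdim N -> injective h).
Proof. by move=> fM fN; apply: kcoord_surjective (kdimP fM) (kdimP fN) (linear_klinear h). Qed.

Lemma kcoord_has_kdim M n : kcoord M n -> has_kdim M n.
Proof.
move=> [f [g [fK gK fl]]]; have gl := kcoord_klinear fK gK fl.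
have g0 := kcoord_zero gl.
have gsum (c : 'I_n -> k) : g (\sum_i c i *: delta_mx 0 i) = \sum_i (c i)%:A *: g (delta_mx 0 i).
  elim/big_rec2: _ => // i u v _ <-; exact: gl.
exists (fun i => g (delta_mx 0 i)) => x; exists [ffun i => f x 0 i]; split.
  rewrite -{1}(fK x) {1}(row_sum_delta (f x)) gsum.
  by apply: eq_bigr => i _; rewrite ffunE.
move=> c xE; apply/ffunP => i; rewrite ffunE xE -gsum gK summxE (bigD1 i) //=.
rewrite !mxE !eqxx mulr1 big1 ?addr0 // => j ji.
by rewrite !mxE eq_sym (negbTE ji) andbF mulr0.
Qed.

Lemma has_kdim_kcoord M n : has_kdim M n -> kcoord M n.
Proof.
move=> [b hb].
have [c hc] := choice hb.
pose g (v : 'rV[k]_n) : M := \sum_i (v 0 i)%:A *: b i.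
exists (fun x => \row_i c x i), g; split.
- move=> x; have [xE _] := hc x; rewrite {2}xE /g; apply: eq_bigr => i _.
  by rewrite mxE.
- move=> v; have [_ uq] := hc (g v); apply/rowP => i; rewrite mxE (uq [ffun i => v 0 i]) ?ffunE //.
  by apply: eq_bigr => j _; rewrite ffunE.
- move=> a x y; have [_ uq] := hc (a%:A *: x + y); apply/rowP => i; rewrite !mxE.
  rewrite (uq [ffun i => a * c x i + c y i]) ?ffunE //.
  have [xE _] := hc x; have [yE _] := hc y.
  rewrite {1}xE {1}yE scaler_sumr -big_split; apply: eq_bigr => j _.
  by rewrite ffunE [in RHS]scalerDl [in RHS]scalerDl [in LHS]scalerA mulr_algl [in LHS]scalerA.
Qed.

Lemma has_kdimP M n : finitely_generated M -> has_kdim M n <-> n = kdim M.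
Proof.
move=> fM; split=> [/has_kdim_kcoord/(kdim_unique fM)|->] //.
exact/kcoord_has_kdim/kdimP.
Qed.

(** A matrix of maximal rank with row space inside [W] works, as one more vector of [W] would raise
    the rank. *)
Lemma subspace_rows n (W : set 'rV[k]_n) : W 0 ->
  (forall c u v, W u -> W v -> W (c *: u + v)) ->
  exists B : 'M[k]_n, forall v, (v <= B)%MS <-> W v.
Proof.
move=> W0 WD.
have ex : exists r, `[< exists2 B : 'M[k]_n, \rank B = r & forall v : 'rV_n, (v <= B)%MS -> W v >].
  exists (\rank (0 : 'M[k]_n)); apply/asboolP; exists 0 => // v.
  by rewrite submx0 => /eqP ->.
have bd r : `[< exists2 B : 'M[k]_n, \rank B = r & forall v : 'rV_n, (v <= B)%MS -> W v >] -> (r <= n)%N.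
  by move/asboolP => [B <- _]; exact: rank_leq_row.
case: (ex_maxnP ex bd) => r /asboolP [B rB hB] maxr; exists B => v; split; first exact: hB.
move=> Wv; apply: contrapT => /negP nv.
have : (\rank (B + v)%MS <= r)%N.
  apply: maxr; apply/asboolP; exists (B + v)%MS => // u /sub_addsmxP [[u1 u2] /= ->].
  have /sub_rVP [a ->] := submxMl u2 v.
  by rewrite addrC; apply: WD => //; apply: hB; exact: submxMl.
rewrite -rB leqNgt => /negP; apply; rewrite ltn_neqAle mxrankS ?addsmxSl // andbT.
apply: contra nv => /eqP e.
have /mxrank_leqif_eq [_ h] := addsmxSl B v.
move: h; rewrite e eqxx => /esym/andP [_ sub].
by apply: submx_trans sub; rewrite addsmxSr.
Qed.

Lemma fg_sub X M (i : {linear X -> M}) : finitely_generated M -> injective i ->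
  finitely_generated X.
Proof.
move=> /kcoord_exists [n [f [g [fK gK fl]]]] ii.
have f0 : f 0 = 0.
  by apply: (can_inj gK); rewrite fK (kcoord_zero (kcoord_klinear fK gK fl)).
have [||B hB] := @subspace_rows n [set v | exists x, f (i x) = v].
- by exists 0; rewrite linear0.
- by move=> c u v [x <-] [y <-]; exists (c%:A *: x + y); rewrite linearP fl.
have hr (j : 'I_n) : exists x, f (i x) = row j B by apply/hB; exact: row_sub.
have [x hx] := choice hr.
apply/kspan_fg; exists [seq x j | j <- enum 'I_n] => y.
have /submxP [D hD] : (f (i y) <= B)%MS by apply/hB; exists y.
have -> : y = \sum_j (D 0 j)%:A *: x j.
  apply: ii; apply: (can_inj fK); rewrite hD mulmx_sum_row linear_sum.
  elim/big_rec2: _ => // j u v _ e.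
  by rewrite linearZ /= fl hx e.
apply: fspan_sum => j _; apply: (fspanZ (f := in_alg A)).
by apply/fspan_mem/map_f; rewrite mem_enum.
Qed.

(** A strictly monotone bounded rank, the source of minimal and maximal members of families of
    submodules. *)
Lemma submodule_rank M : finitely_generated M -> exists rk : set M -> nat,
  (forall U, submodule U -> (rk U <= kdim M)%N) /\
  forall U U', submodule U -> submodule U' -> U `<=` U' ->
    (rk U <= rk U')%N /\ (rk U = rk U' -> U' `<=` U).
Proof.
move=> fM; have [f [g [fK gK fl]]] := kdimP fM; have gl := kcoord_klinear fK gK fl.
have g0 := kcoord_zero gl.
have hB (U : set M) : exists B : 'M[k]_(kdim M), submodule U -> forall v, (v <= B)%MS <-> U (g v).
  case: (pselect (submodule U)) => [hU|]; last by exists 0.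
  have [||B hB] := @subspace_rows (kdim M) [set v | U (g v)]; last by exists B.
    by rewrite /= g0; exact: submodule0.
  by move=> c u v hu hv; rewrite /= gl; apply: submoduleD => //; exact: submoduleZ.
have [B BP] := choice hB; exists (fun U => \rank (B U)); split.
  by move=> U _; exact: rank_leq_row.
move=> U U' hU hU' UU'.
have s : (B U <= B U')%MS.
  by apply/row_subP => i; apply/BP => //; apply/UU'/BP => //; exact: row_sub.
split; first exact: mxrankS.
move=> e x U'x; have := mxrank_leqif_eq s; rewrite /leqif e eqxx => -[_ /esym/andP[_ s']].
by rewrite -(fK x); apply/BP => //; apply: submx_trans s'; apply/BP => //; rewrite fK.
Qed.

Lemma submodule_min M (F : set (set M)) U0 : finitely_generated M -> F U0 ->
  (forall U, F U -> submodule U) ->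
  exists2 U, F U & forall W : set M, F W -> W `<=` U -> U `<=` W.
Proof.
move=> /submodule_rank [rk [_ hrk]] F0 FS.
have ex : exists n, `[< exists2 U, F U & rk U = n >].
  by exists (rk U0); apply/asboolP; exists U0.
case: (ex_minnP ex) => n /asboolP [U FU rU] mn; exists U => // W FW WU.
have [le eq] := hrk _ _ (FS _ FW) (FS _ FU) WU; apply: eq; apply/eqP.
by rewrite eqn_leq le rU mn //; apply/asboolP; exists W.
Qed.

Lemma submodule_max M (F : set (set M)) U0 : finitely_generated M -> F U0 ->
  (forall U, F U -> submodule U) ->
  exists2 U, F U & forall W : set M, F W -> U `<=` W -> W `<=` U.
Proof.
move=> /submodule_rank [rk [brk hrk]] F0 FS.
have ex : exists n, `[< exists2 U, F U & rk U = n >].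
  by exists (rk U0); apply/asboolP; exists U0.
have bd n : `[< exists2 U, F U & rk U = n >] -> (n <= kdim M)%N.
  by move/asboolP => [U /FS hU <-]; exact: brk.
case: (ex_maxnP ex bd) => n /asboolP [U FU rU] mx; exists U => // W FW UW.
have [le eq] := hrk _ _ (FS _ FU) (FS _ FW) UW; apply: eq; apply/eqP.
by rewrite eqn_leq le rU mx //; apply/asboolP; exists W.
Qed.

End FiniteDimension.

(** * Projective covers and syzygies *)

Section Fitting.
Variables (k : fieldType) (A : falgType k).
Implicit Types M N X Y P W K : lmodType A.

Lemma iter_linear M (h : {linear M -> M}) m : exists g : {linear M -> M}, forall x, g x = iter m h x.
Proof.
elim: m => [|m [g hg]]; first by exists idfun.
by exists (h \o g) => x; rewrite /= hg.
Qed.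

Lemma fitting_stable M (h : {linear M -> M}) : finitely_generated M ->
  exists m, [/\ (0 < m)%N, forall x, exists y, iter m h x = iter (m + m) h y
    & forall x, iter (m + m) h x = 0 -> iter m h x = 0].
Proof.
move=> fM.
have h0 n : iter n h 0 = 0 by have [g hg] := iter_linear h n; rewrite -hg linear0.
pose im n : set M := [set y | exists x, iter n h x = y].
pose ke n : set M := [set x | iter n h x = 0].
have [||U [a ->] amin] := @submodule_min _ _ M [set U | exists n, U = im n] (im 0%N) fM.
- by exists 0%N.
- move=> U [n ->]; have [g hg] := iter_linear h n.
  have -> : im n = [set y | exists x, g x = y].
    by apply/seteqP; split=> y [x <-]; exists x; rewrite hg.
  exact: range_submodule.
have [||V [b ->] bmax] := @submodule_max _ _ M [set U | exists n, U = ke n] (ke 0%N) fM.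
- by exists 0%N.
- move=> V [n ->]; have [g hg] := iter_linear h n.
  have -> : ke n = [set x | g x = 0] by apply/seteqP; split=> x; rewrite /ke /= hg.
  exact: kernel_submodule.
(* Images are stable from [a] on and kernels from [b] on; the successor keeps [m] positive. *)
exists (a + b).+1; split=> // x.
  have [|||y hy] := amin (im (a + ((a + b).+1 + (a + b).+1))%N) _ _ (iter a h x).
  - by exists (a + ((a + b).+1 + (a + b).+1))%N.
  - by move=> _ [y <-]; exists (iter ((a + b).+1 + (a + b).+1) h y); rewrite -iterD.
  - by exists x.
  exists (iter (b.+1 + a) h y).
  set m := ((a + b).+1 + (a + b).+1)%N in hy *.
  have -> : (a + b).+1 = (b.+1 + a)%N by rewrite addnC addSn.
  by rewrite iterD -hy -!iterD addnA addnC.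
move=> hx.
have bx : ke b x.
  apply: (bmax (ke ((a + b).+1 + (a + b).+1)%N)) hx; first by eexists.
  have bc : (b <= (a + b).+1 + (a + b).+1)%N.
    by rewrite addSn ltnW // ltnS -addnA addnCA leq_addr.
  move=> y hy; have : iter ((a + b).+1 + (a + b).+1 - b + b) h y = 0 by rewrite iterD hy h0.
  by rewrite subnK.
by rewrite -addSn iterD bx h0.
Qed.

(** Fitting's decomposition: the image of the [m]-th iterate is a complement of its kernel, and the
    retraction is the projection along that kernel. *)
Lemma fitting_image M (h : {linear M -> M}) m :
  (forall x, exists y, iter m h x = iter (m + m) h y) ->
  (forall x, iter (m + m) h x = 0 -> iter m h x = 0) ->
  exists (Y : lmodType A) (j : {linear Y -> M}) (r : {linear M -> Y}),
    (forall y, r (j y) = y) /\ forall x, (exists z, iter m h z = x) <-> exists y, j y = x.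
Proof.
move=> him hker; have [g hg] := iter_linear h m.
have [Y [j [ij jP]]] := sub_module (range_submodule g).
have gj y : exists z, g z = j y by apply/jP; exists y.
have [||y|r hr] := @lin_choice A M Y (fun x y => g (x - j y) = 0).
- move=> x; have [z hz] := him x.
  have [y hy] : exists y, j y = g z by apply/jP; exists z.
  by exists y; rewrite linearB hy !hg -iterD -hz subrr.
- move=> a x y x' y' e e'.
  have -> : a *: x + x' - j (a *: y + y') = a *: (x - j y) + (x' - j y').
    by rewrite linearP scalerBr opprD addrACA.
  by rewrite linearP e e' scaler0 addr0.
- rewrite sub0r linearN => /eqP; rewrite oppr_eq0 => /eqP e.
  have [z hz] := gj y; apply: ij; rewrite linear0 -hz hg; apply: hker.
  by rewrite iterD -!hg hz.
exists Y, j, r; split=> [y|x].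
  apply: ij; apply/eqP; rewrite -subr_eq0 -opprB oppr_eq0; apply/eqP.
  have e := hr (j y); rewrite -linearB in e *.
  have [z hz] := gj (y - r (j y)); rewrite -hz hg; apply: hker.
  by rewrite iterD -!hg hz.
split=> [[z hz]|/jP [z hz]]; first by apply/jP; exists z; rewrite hg.
by exists z; rewrite -hg.
Qed.

(** The other summand of the decomposition, with the projection along the image. *)
Lemma fitting_kernel M (h : {linear M -> M}) m :
  (forall x, exists y, iter m h x = iter (m + m) h y) ->
  (forall x, iter (m + m) h x = 0 -> iter m h x = 0) ->
  exists (Y : lmodType A) (j : {linear Y -> M}) (r : {linear M -> Y}),
    (forall y, r (j y) = y) /\ forall x, iter m h x = 0 <-> exists y, j y = x.
Proof.
move=> him hker; have [g hg] := iter_linear h m.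
have [Y [j [ij jP]]] := sub_module (kernel_submodule g).
have gj y : g (j y) = 0 by apply/jP; exists y.
have [||y|r hr] := @lin_choice A M Y (fun x y => exists z, x - j y = g z).
- move=> x; have [z hz] := him x.
  have [y hy] : exists y, j y = x - g z.
    by apply/jP; rewrite /= linearB !hg -iterD -hz subrr.
  by exists y, z; rewrite hy subKr.
- move=> a x y x' y' [z e] [z' e']; exists (a *: z + z').
  by rewrite [RHS]linearP -e -e' linearP scalerBr opprD addrACA.
- move=> [z]; rewrite sub0r => e; apply: ij; rewrite linear0; apply/eqP.
  rewrite -oppr_eq0 e hg; apply/eqP; apply: hker.
  by rewrite iterD -!hg -e linearN gj oppr0.
exists Y, j, r; split=> [y|x].
  apply: ij; apply/eqP; rewrite -subr_eq0 -opprB oppr_eq0; apply/eqP.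
  have [z e] := hr (j y); rewrite e hg; apply: hker.
  by rewrite iterD -!hg -e -linearB gj.
by rewrite -hg; split=> [/jP|/jP].
Qed.

Lemma iter_injective M (h : {linear M -> M}) m : (0 < m)%N ->
  (forall x, iter m h x = 0 -> x = 0) -> injective h.
Proof.
case: m => // m _ hi; apply: injective_ker => x hx; apply: hi.
rewrite iterSr hx; have [g hg] := iter_linear h m.
by rewrite -hg linear0.
Qed.

(** Take a finitely generated projective of least dimension over [M]. If [U] and the kernel of [p]
    span [P], lifting gives an endomorphism [h] of [P] over [M] with values in [U]. Its Fitting
    image is projective and still maps onto [M], so by minimality it is all of [P], and hence so is
    [U]. *)
Lemma projective_cover_exists M : finitely_generated M ->
  exists (P : lmodType A) (p : {linear P -> M}), projective_cover p /\ finitely_generated P.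
Proof.
move=> fM.
pose good n := `[< exists (P : lmodType A) (p : {linear P -> M}),
  [/\ projective P, finitely_generated P, surjective p & kdim P = n] >].
have ex : exists n, good n.
  have [n [p sp]] := fg_free_cover fM; exists (kdim 'rV[A]_n); apply/asboolP.
  by exists 'rV[A]_n, p; split=> //; [exact: free_projective | exact: free_fg].
case: (ex_minnP ex) => n /asboolP [P [p [pP fP sp dP]]] mn.
exists P, p; split=> //; split=> // U hU Uk.
have [X [i [ii iU]]] := sub_module hU.
have spi : surjective (p \o i).
  move=> y; have [q <-] := sp y; have [u /iU [x hx] /eqP] := Uk q.
  by rewrite linearB subr_eq0 => /eqP e; exists x; rewrite /= hx e.
have [h0 hh0] := pP _ _ (p \o i) p spi.
pose h : {linear P -> P} := i \o h0.
have ph q : p (h q) = p q by rewrite -[RHS]hh0.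
have piter l q : p (iter l h q) = p q by elim: l => //= l IH; rewrite ph.
have [m [m0 him hker]] := fitting_stable h fP.
have [Y [j [r [rj jP]]]] := fitting_image him hker.
have ij : injective j by move=> x y e; rewrite -(rj x) -(rj y) e.
have fY := fg_sub fP ij.
have pY : projective Y by apply: retract_projective pP _; exists j, r.
have sY : surjective (p \o j).
  move=> y; have [q <-] := sp y.
  have [x hx] : exists x, j x = iter m h q by apply/jP; exists q.
  by exists x; rewrite /= hx piter.
have le : (n <= kdim Y)%N by apply: mn; apply/asboolP; exists Y, (p \o j).
have [le' sj] := kdim_injective fY fP ij.
have /sj surj_j : kdim Y = kdim P by apply/eqP; rewrite eqn_leq le' dP.
move=> q; have [y yq] := surj_j q.
have [z hz] : exists z, iter m h z = q by apply/jP; exists y.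
rewrite -hz; case: m m0 {him hker jP hz} => // m _; rewrite iterS.
by apply/iU; exists (h0 (iter m h z)).
Qed.

Lemma exact_kernel M N (f : {linear M -> N}) :
  exists (K : lmodType A) (i : {linear K -> M}), injective i /\ exact_at i f.
Proof.
have [K [i [ii iP]]] := sub_module (kernel_submodule f).
by exists K, i; split.
Qed.

(** Over a selfinjective algebra a finitely generated projective submodule is injective, hence a
    summand; so this says that [M] has no nonzero finitely generated projective summand. *)
Definition no_projective_sub M := forall (W : lmodType A) (j : {linear W -> M}),
  projective W -> finitely_generated W -> injective j -> forall w : W, w = 0.

(** A projective [W] inside [K] is injective, so some [r] retracts [P] onto it. As [W] lies in the
    kernel of [p], the kernels of [r] and [p] span [P], and superfluity forces [r = 0]. *)
Lemma syzygy_no_projective P M K (p : {linear P -> M}) (i : {linear K -> P}) :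
  selfinjective A -> projective_cover p -> injective i -> exact_at i p ->
  no_projective_sub K.
Proof.
move=> sA [pP sp small] ii ex W j pW fW ij w.
have iW := projective_injective sA pW fW.
have [r hr] := injective_sub_retract (j := i \o j) iW (inj_comp ii ij).
have r0 : forall q, r q = 0.
  apply: (small [set q | r q = 0]); first exact: kernel_submodule.
  move=> q; exists (q - i (j (r q))); first by rewrite /= linearB hr subrr.
  by rewrite opprB addrC subrK; apply/ex; exists (j (r q)).
by rewrite -(hr w) r0.
Qed.

(** Injectivity of [P] and [P'] extends the isomorphism of kernels and its inverse to [be] and
    [be']. Their composite is the identity on [K], so its Fitting kernel is a projective module that
    embeds in [M], hence zero. Thus [be] is bijective and induces the isomorphism of the
    quotients. *)
Lemma iso_of_syzygies P M K P' M' K' (p : {linear P -> M}) (i : {linear K -> P})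
    (p' : {linear P' -> M'}) (i' : {linear K' -> P'}) :
  selfinjective A ->
  projective P -> finitely_generated P -> surjective p -> injective i -> exact_at i p ->
  projective P' -> finitely_generated P' -> surjective p' -> injective i' -> exact_at i' p' ->
  no_projective_sub M -> no_projective_sub M' -> lmod_iso K K' -> lmod_iso M M'.
Proof.
move=> sA pP fP sp ii ex pP' fP' sp' ii' ex' nM nM' [al bal].
have [al' [alK alK']] := linear_inverse bal.
have iP := projective_injective sA pP fP; have iP' := projective_injective sA pP' fP'.
have [be hbe] := iP' _ _ i (i' \o al) ii.
have [be' hbe'] := iP _ _ i' (i \o al') ii'.
have key (Q N L : lmodType A) (q : {linear Q -> N}) (l : {linear L -> Q}) (h : {linear Q -> Q}) :
    projective Q -> finitely_generated Q -> exact_at l q -> injective l ->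
    no_projective_sub N -> (forall x, h (l x) = l x) -> injective h.
  move=> pQ fQ exq il nN hl.
  have [m [m0 him hker]] := fitting_stable h fQ.
  have [Y [j [r [rj jP]]]] := fitting_kernel him hker.
  have ij : injective j by move=> x y e; rewrite -(rj x) -(rj y) e.
  have fY := fg_sub fQ ij.
  have pY : projective Y by apply: retract_projective pQ _; exists j, r.
  have iqj : injective (q \o j).
    apply: injective_ker => y /= /exq [x hx].
    have : iter m h (j y) = 0 by apply/jP; exists y.
    rewrite -hx; have -> : iter m h (l x) = l x by elim: (m) => //= n ->.
    by rewrite hx => e; apply: ij; rewrite e linear0.
  have y0 := nN Y (q \o j) pY fY iqj.
  by apply: (iter_injective m0) => x /jP [y <-]; rewrite (y0 y) linear0.
have inj1 : injective (be' \o be).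
  by apply: (key _ _ _ p i) => // x /=; rewrite hbe /= hbe' /= alK.
have inj2 : injective (be \o be').
  by apply: (key _ _ _ p' i') => // x /=; rewrite hbe' /= hbe /= alK'.
have ibe : injective be by exact: inj_compr inj1.
have ibe' : injective be' by exact: inj_compr inj2.
have sbe : surjective be.
  have [le s] := kdim_injective fP fP' ibe; apply: s; apply/eqP; rewrite eqn_leq le.
  by have [] := kdim_injective fP' fP ibe'.
have [||y|ga hga] := @lin_choice A M M' (fun x y => exists2 q, p q = x & p' (be q) = y).
- by move=> x; have [q <-] := sp x; exists (p' (be q)), q.
- move=> a x y x' y' [q <- <-] [q' <- <-]; exists (a *: q + q'); by rewrite !linearP.
- by move=> [q /ex [x <-] <-]; rewrite hbe /=; apply/ex'; exists (al x).
exists ga; apply: bijectiveP.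
  apply: injective_ker => x gx; have [q pq] := hga x; rewrite gx => /ex' [y hy].
  rewrite -pq; apply/ex; exists (al' y); apply: ibe.
  by rewrite hbe /= alK'.
move=> y; have [q' hq'] := sp' y; have [q hq] := sbe q'; exists (p q).
have [q1 pq1 <-] := hga (p q).
have : p (q1 - q) = 0 by rewrite linearB pq1 subrr.
move=> /ex [x hx]; rewrite -hq' -hq; apply/eqP; rewrite -subr_eq0 -linearB -linearB -hx.
by apply/eqP; rewrite hbe; apply/ex'; exists (al x).
Qed.

(** A maximal projective submodule is injective, so it has a complement; a projective submodule of
    the complement would enlarge it. *)
Lemma split_projective M : selfinjective A -> finitely_generated M ->
  exists (X P : lmodType A) (u : {linear X -> M}) (v : {linear P -> M}),
    [/\ projective P, no_projective_sub X, finitely_generated X /\ finitely_generated P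
      & bijective (fun xp : X * P => u xp.1 + v xp.2)].
Proof.
move=> sA fM.
pose F : set (set M) := [set U | exists (W : lmodType A) (v : {linear W -> M}),
  [/\ projective W, injective v & U = [set y | exists x, v x = y]]].
have [||U [P [v [pP iv ->]]] mx] := @submodule_max _ _ M F [set 0] fM.
- have zl : linear ((fun=> 0) : 'rV[A]_0 -> M) by move=> a x y; rewrite scaler0 addr0.
  exists 'rV[A]_0, (mklin zl).
  split; first exact: free_projective.
    by move=> x y _; apply/rowP; case.
  by apply/seteqP; split=> [y ->|y [x <-]] //; exists 0.
- by move=> U [W [v [_ _ ->]]]; exact: range_submodule.
have fP := fg_sub fM iv.
have [r hr] := injective_sub_retract (projective_injective sA pP fP) iv.
have [X [u [iu uP]]] := sub_module (kernel_submodule r).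
have ru x : r (u x) = 0 by apply/uP; exists x.
have ker0 (W : lmodType A) (j : {linear W -> X}) : injective j ->
    injective (fun wp : W * P => u (j wp.1) + v wp.2).
  move=> ij [w p] [w' p'] /= e.
  have ep : p = p' by have := congr1 r e; rewrite !linearD !ru !hr !add0r.
  congr (_, _) => //; apply: ij; apply: iu.
  by move: e; rewrite ep => /addIr.
exists X, P, u, v; split=> //.
- move=> W j pW fW ij w.
  have fl : linear (fun wp : W * P => u (j wp.1) + v wp.2).
    by move=> a [w1 p1] [w2 p2] /=; rewrite !linearP scalerDr addrACA.
  have [|||x hx] := mx [set y | exists wp : W * P, u (j wp.1) + v wp.2 = y] _ _ (u (j w)).
  + exists (W * P)%type, (mklin fl); split=> //; last exact: ker0.
    exact: prod_projective.
  + by move=> _ [x <-]; exists (0, x); rewrite /= !linear0 add0r.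
  + by exists (w, 0); rewrite /= linear0 addr0.
  have x0 : x = 0 by rewrite -(hr x) hx ru.
  by apply: ij; rewrite linear0; apply: iu; rewrite linear0 -hx x0 linear0.
- by split=> //; exact: fg_sub fM iu.
apply: bijectiveP.
  by move=> [w p] [w' p'] e; apply: (ker0 X idfun) => //.
move=> y; have [x hx] : exists x, u x = y - v (r y).
  by apply/uP; rewrite /= linearB hr subrr.
by exists (x, r y); rewrite /= hx subrK.
Qed.

End Fitting.

(** * The top of a module *)

Section Radical.
Variables (k : fieldType) (A : falgType k).
Implicit Types M N X Y P W S : lmodType A.

Local Notation top := (mod_radical A).
Local Notation tpi := (lquot_pi (jacobson_radical_submod A)).

Lemma top_eq (a b : A) : tpi a = tpi b <-> forall m, maximal_left_ideal m -> m (a - b).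
Proof. by split=> [/lquot_piE /asboolP//|h]; apply/lquot_piE/asboolP. Qed.

Lemma topZ (a b : A) : a *: tpi b = tpi (a * b).
Proof. exact: (lquot_scaleE (jacobson_radical_submod A)). Qed.

Lemma topD (a b : A) : tpi (a + b) = tpi a + tpi b.
Proof. exact: (lquot_piD (jacobson_radical_submod A)). Qed.

Lemma top0 : (0 : top) = tpi 0.
Proof. by apply: (@addIr _ (tpi 0)); rewrite -topD !add0r. Qed.

Lemma topB (a b : A) : tpi (a - b) = tpi a - tpi b.
Proof. by apply/eqP; rewrite -subr_eq opprK -topD subrK. Qed.

Lemma top_surj (x : top) : exists a, tpi a = x.
Proof. by eexists; exact: (@lquot_pi_surj _ _ _ (jacobson_radical_submod A)). Qed.

Lemma top_fg : finitely_generated top.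
Proof.
exists [:: tpi 1] => x; have [a <-] := top_surj x; exists (fun=> a).
by rewrite big_ord1 topZ mulr1.
Qed.

Lemma hom_top_kernel P M (p : {linear P -> M}) (u : {linear P -> top}) q :
  superfluous_kernel p -> p q = 0 -> u q = 0.
Proof.
move=> small pq; have [a ua] := top_surj (u q); rewrite -ua top0.
apply/top_eq => m mm; rewrite subr0; apply: contrapT => nma.
have [hm m1 mx] := mm.
have mD x y : m x -> m y -> m (x + y) by move=> hx hy; exact: (@submoduleD A A^o).
have mZ b x : m x -> m (b * x) by move=> hx; exact: (@submoduleZ A A^o).
have [c mc] : exists c, m (1 - c * a).
  apply: contrapT => no.
  have sJ : left_ideal [set x | exists c, m (x - c * a)].
    split; first by exists 0; rewrite mul0r subr0; exact: (@submodule0 A A^o).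
    move=> b x y [c hc] [d hd]; exists (b * c + d).
    have -> : b *: x + y - (b * c + d) * a = b * (x - c * a) + (y - d * a).
      by rewrite mulrDl mulrBr mulrA opprD addrACA.
    by apply: mD => //; exact: mZ.
  apply: nma; apply: (mx _ sJ) => [x hx|[c hc]|].
  - by exists 0; rewrite mul0r subr0.
  - by apply: no; exists c.
  - by exists 1; rewrite mul1r subrr; exact: (@submodule0 A A^o).
have full : forall p', exists2 b, u p' = tpi b & m b.
  apply: (small [set p' | exists2 b, u p' = tpi b & m b]).
    split; first by exists 0; rewrite ?linear0 ?top0 //; exact: (@submodule0 A A^o).
    move=> d x y [b xb mb] [b' yb mb']; exists (d * b + b').
      by rewrite linearP xb yb topZ topD.
    by apply: mD => //; exact: mZ.
  move=> p'; have [b hb] := top_surj (u p').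
  exists (p' - (b * c) *: q); last by rewrite opprB addrC subrK linearZ /= pq scaler0.
  exists (b - b * c * a); last by rewrite -mulrA -[X in X - _]mulr1 -mulrBr; exact: mZ.
  by rewrite linearB linearZ /= -hb -ua topZ topB.
have [b hb mb] := full q; apply: nma.
rewrite -ua in hb; have /top_eq := hb => /(_ m mm) h.
by rewrite -(subrK b a); exact: mD.
Qed.

Definition simple S : Prop := (exists s : S, s <> 0) /\
  forall U : set S, submodule U -> (exists2 s, U s & s <> 0) -> forall s, U s.

(* A left ideal [K] minimal among those not contained in the maximal left ideal
   [m] satisfies [K :&: m <= r], so writing [1 = x + y] with [x] in [K] and [y] in
   [m], right multiplication by [x] embeds [A / m] into [A / r]. *)
Lemma simple_retract S : simple S -> retract S top.
Proof.
move=> [[s0 s0n] simp].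
pose m : set A := [set a | a *: s0 = 0].
have gen s : exists a, s = a *: s0.
  have [||a ha] := simp [set s | exists a, s = a *: s0] _ _ s; last by exists a.
    split; first by exists 0; rewrite scale0r.
    by move=> a x y [b ->] [c ->]; exists (a * b + c); rewrite scalerDl scalerA.
  by exists s0 => //; exists 1; rewrite scale1r.
have hm : left_ideal m.
  split; first by rewrite /m /= scale0r.
  by move=> a x y hx hy; rewrite /m /= scalerDl -scalerA hx hy scaler0 addr0.
have m1 : ~ m 1 by rewrite /m /= scale1r.
have mm : maximal_left_ideal m.
  split=> // J hJ mJ J1 b Jb; apply: contrapT => nb; apply: J1.
  have [||c hc] := simp [set s | exists c, s = (c * b) *: s0] _ _ s0.
  - split; first by exists 0; rewrite mul0r scale0r.
    by move=> a x y [c ->] [d ->]; exists (a * c + d); rewrite mulrDl scalerDl -mulrA scalerA.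
  - by exists (b *: s0); [exists 1; rewrite mul1r | exact: nb].
  rewrite -(subrK (c * b) 1); apply: (@submoduleD A A^o) => //.
    by apply: mJ; rewrite /m /= scalerBl scale1r -hc subrr.
  exact: (@submoduleZ A A^o).
have fA : finitely_generated A^o.
  by exists [:: 1 : A^o] => x; exists (fun=> x); rewrite big_ord1; exact/esym/mulr1.
have [||K [hK nK] Kmin] := @submodule_min k A A^o
    [set K | left_ideal K /\ ~ K `<=` m] setT fA.
- by split=> // /(_ 1 I).
- by move=> U [].
have Km c : K c -> m c -> forall n, maximal_left_ideal n -> n c.
  move=> Kc mc n mn; apply: contrapT => nc; have [hn n1 nx] := mn.
  have KnI : submodule ([set x | K x /\ n x] : set A^o).
    split; first by split; exact: submodule0.
    by move=> a x y [Kx nx'] [Ky ny]; split; [apply hK | apply hn].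
  have Knm x : K x -> n x -> m x.
    move=> Kx nx'; apply: contrapT => nmx; apply: nc.
    have KK : K `<=` [set x | K x /\ n x].
      apply: Kmin; [split=> // sub | by move=> ? []].
      by apply: nmx; exact: sub.
    by have [] := KK c Kc.
  apply: nK => b Kb.
  have [a ha] : exists a, n (b - a * c).
    have [a ha] : exists a, n (1 - a * c).
      apply: contrapT => no; apply: nc; apply: (nx [set x | exists a, n (x - a * c)]).
      - split; first by exists 0; rewrite mul0r subr0; exact: (@submodule0 A A^o).
        move=> a x y [e he] [d hd]; exists (a * e + d).
        have -> : a *: x + y - (a * e + d) * c = a *: (x - e * c : A^o) + (y - d * c).
          by rewrite mulrDl scalerBr -[a *: (e * c : A^o)]/(a * (e * c)) mulrA opprD addrACA.
        by apply hn.
      - by move=> x hx; exists 0; rewrite mul0r subr0.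
      - by move=> [a ha]; apply: no; exists a.
      - by exists 1; rewrite mul1r subrr; exact: (@submodule0 A A^o).
    exists (b * a); rewrite -mulrA -[X in X - _]mulr1 -mulrBr.
    exact: (@submoduleZ A A^o).
  rewrite -(subrK (a * c) b); apply: (@submoduleD A A^o) => //.
    apply: Knm => //; apply: (@submoduleB A A^o) => //.
    exact: (@submoduleZ A A^o).
  exact: (@submoduleZ A A^o).
have [x Kx mx1] : exists2 x, K x & m (1 - x).
  have [y Ky ny] : exists2 y, K y & ~ m y.
    by apply: contrapT => no; apply: nK => y Ky; apply: contrapT => ny; apply: no; exists y.
  have [||c hc] := simp [set s | exists c, s = (c * y) *: s0] _ _ s0.
  - split; first by exists 0; rewrite mul0r scale0r.
    by move=> a u v [c ->] [d ->]; exists (a * c + d); rewrite mulrDl scalerDl -mulrA scalerA.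
  - by exists (y *: s0); [exists 1; rewrite mul1r | exact: ny].
  exists (c * y); first exact: (@submoduleZ A A^o).
  by rewrite /m /= scalerBl scale1r -hc subrr.
have xs0 : x *: s0 = s0.
  by apply/eqP; rewrite -subr_eq0 -opprB oppr_eq0 -{1}(scale1r s0) -scalerBl; apply/eqP.
have [||y|i hi] := @lin_choice A S top (fun s t => exists2 a, s = a *: s0 & t = tpi (a * x)).
- by move=> s; have [a ->] := gen s; exists (tpi (a * x)), a.
- move=> a u v u' v' [b -> ->] [c -> ->]; exists (a * b + c).
    by rewrite scalerDl scalerA.
  by rewrite topZ -topD mulrDl mulrA.
- move=> [a /esym a0 ->]; rewrite top0; apply/top_eq => n mn; rewrite subr0.
  apply: Km => //; first exact: (@submoduleZ A A^o).
  by rewrite /m /= -scalerA xs0.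
have [||y|r hr] := @lin_choice A top S (fun t s => exists2 a, t = tpi a & s = a *: s0).
- by move=> t; have [a <-] := top_surj t; exists (a *: s0), a.
- move=> a u v u' v' [b -> ->] [c -> ->]; exists (a * b + c).
    by rewrite topZ -topD.
  by rewrite scalerDl scalerA.
- by move=> [a]; rewrite top0 => /esym/top_eq /(_ m mm) + ->; rewrite subr0.
exists i, r => s; have [a sE iE] := hi s; have [b ib ->] := hr (i s).
have /top_eq /(_ m mm) : tpi (a * x) = tpi b by rewrite -iE.
by rewrite /m /= scalerBl -scalerA xs0 -sE => /eqP; rewrite subr_eq0 => /eqP.
Qed.

Lemma simple_quotient Y (U : set Y) : finitely_generated Y -> submodule U -> (exists y, ~ U y) ->
  exists S (pi : {linear Y -> S}), [/\ simple S, surjective pi & forall y, U y -> pi y = 0].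
Proof.
move=> fY hU [y0 ny0].
have [||V [hV UV [y1 ny1]] Vmax] := @submodule_max k A Y
   [set V | [/\ submodule V, U `<=` V & exists y, ~ V y]] U fY.
- by split=> //; exists y0.
- by move=> V [].
have [S [pi [spi piV]]] := quotient_module hV.
exists S, pi; split=> //; last by move=> y /UV /piV.
split; first by exists (pi y1) => /piV.
move=> W hW [s Ws s0] s'; apply: contrapT => ns'.
have [y ys] := spi s; have [y' ys'] := spi s'.
suff Vy : V y by move/piV: Vy; rewrite ys.
apply: (Vmax [set z | W (pi z)]).
- split.
  + split; first by rewrite /= linear0; exact: submodule0.
    by move=> a u v hu hv; rewrite /= linearP; apply hW.
  + by move=> z /UV /piV /= ->; exact: submodule0.
  + by exists y'; rewrite /= ys'.
- by move=> z /piV /= ->; exact: submodule0.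
- by rewrite /= ys.
Qed.

(** The cokernel of a map that is not onto has a simple quotient, and simple modules embed in
    [A / r]. *)
Lemma hom_top_separates X Y (phi : {linear X -> Y}) : finitely_generated Y ->
  ~ surjective phi ->
  exists u : {linear Y -> top}, (exists y, u y <> 0) /\ forall x, u (phi x) = 0.
Proof.
move=> fY ns; have [|S [pi [sS spi pi0]]] := simple_quotient fY (range_submodule phi).
  apply: contrapT => no; apply: ns => y; apply: contrapT => ny; apply: no.
  by exists y.
have [[s s0] _] := sS; have [i [r ri]] := simple_retract sS.
exists (i \o pi); split; last by move=> x /=; rewrite pi0 ?linear0 //; exists x.
have [y ys] := spi s; exists y => /= e; apply: s0.
by rewrite -(ri s) -ys e linear0.
Qed.

(** Otherwise one can choose in turn elements [x i] and maps [u i] such that [u i] vanishes on the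
    earlier [x j] but not on [x i]; such a triangular system of [B + 1] maps is independent. *)
Lemma generators_bound M B : finitely_generated M ->
  (forall u : 'I_B.+1 -> {linear M -> top}, exists c : 'I_B.+1 -> k,
     (exists i, c i != 0) /\ forall x, \sum_i (c i)%:A *: u i x = 0) ->
  exists f : {linear 'rV[A]_B -> M}, surjective f.
Proof.
move=> fM dep; apply: contrapT => nogen.
have build n : (n <= B.+1)%N -> exists (x : nat -> M) (u : nat -> {linear M -> top}),
    forall i, (i < n)%N -> u i (x i) <> 0 /\ forall j, (j < i)%N -> u i (x j) = 0.
  elim: n => [_|n IH nB]; first by exists (fun=> 0), (fun=> mklin (f := fun=> 0) (fun a _ _ => esym (etrans (addr0 _) (scaler0 top a)))).
  have [x [u xu]] := IH (ltnW nB).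
  have [f hf] := free_map (fun i : 'I_B => if (i < n)%N then x i else 0).
  have [|v [[y vy] vf]] := @hom_top_separates _ _ f fM.
    by move=> sf; apply: nogen; exists f.
  exists (fun i => if i == n then y else x i), (fun i => if i == n then v else u i) => i.
  rewrite ltnS leq_eqVlt => /orP[/eqP->|iltn].
    rewrite eqxx; split=> // j jn; rewrite (ltn_eqF jn).
    have jB : (j < B)%N by exact: leq_trans jn _.
    have -> : x j = f (delta_mx 0 (Ordinal jB)).
      rewrite hf (bigD1 (Ordinal jB)) //= jn !mxE !eqxx scale1r big1 ?addr0 // => l lj.
      by rewrite mxE (negbTE lj) andbF scale0r.
    exact: vf.
  rewrite (ltn_eqF iltn); have [h1 h2] := xu i iltn; split=> // j ji.
  by rewrite (ltn_eqF (ltn_trans ji iltn)); exact: h2.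
have [x [u xu]] := build _ (leqnn _).
have [c [[i0 ci0] cu]] := dep (fun i => u i).
(* At [x i], with [i] the least index of a nonzero coefficient, only the [i]-th term of the relation
   survives. *)
have ex : exists i, [exists i' : 'I_B.+1, (i' == i :> nat) && (c i' != 0)].
  by exists i0; apply/existsP; exists i0; rewrite eqxx.
case: (ex_minnP ex) => i /existsP [i' /andP[/eqP ii ci]] imin.
have := cu (x i); rewrite (bigD1 i') //= ii big1 => [|j ji].
  rewrite addr0 => h; have ib : (i < B.+1)%N by rewrite -ii.
  have [h1 _] := xu i ib; apply: h1.
  have := congr1 (fun z => ((c i')^-1)%:A *: z) h.
  by rewrite scaler0 scalerA mulr_algl scalerA mulVf // scale1r scale1r.
have [lt|gt|e] := ltngtP j i.
- have -> : c j = 0.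
    apply/eqP; apply: contraLR lt => cj; rewrite -leqNgt; apply: imin.
    by apply/existsP; exists j; rewrite eqxx.
  by rewrite scale0r scale0r.
- by have [_ h] := xu j (ltn_ord j); rewrite h // scaler0.
- by case/eqP: ji; apply: val_inj; rewrite /= ii.
Qed.

Lemma cover_generators P M (p : {linear P -> M}) n (f : {linear 'rV[A]_n -> M}) :
  projective_cover p -> surjective f -> exists g : {linear 'rV[A]_n -> P}, surjective g.
Proof.
move=> [pP sp small] sf; have [g hg] := free_projective f sp.
exists g; apply: (small [set q | exists v, g v = q]); first exact: range_submodule.
move=> q; have [v hv] := sf (p q); exists (g v); first by exists v.
by rewrite linearB hg hv subrr.
Qed.

End Radical.

(** * Yoneda products on Ext *)

Section Cochains.
Variables (k : fieldType) (A : falgType k).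
Implicit Types L M N K P Q : lmodType A.

Local Notation cochain M N := (seq A -> M -> N).

Lemma cochain_ext M N (g g' : cochain M N) : (forall s m, g s m = g' s m) -> g = g'.
Proof. by move=> h; apply/funext => s; apply/funext => m. Qed.

Lemma ext_cochainD M N (g g' : cochain M N) :
  ext_cochain g -> ext_cochain g' -> ext_cochain (g + g').
Proof.
move=> Cg Cg'; have -> : g + g' = g - (0 - g') by rewrite sub0r opprK.
by do !apply: ext_cochainB => //; exact: ext_cochain0.
Qed.

Lemma ext_cochainN M N (g : cochain M N) : ext_cochain g -> ext_cochain (- g).
Proof. by move=> Cg; rewrite -sub0r; apply: ext_cochainB => //; exact: ext_cochain0. Qed.

Lemma ext_diff_add M N (g g' : cochain M N) : ext_diff (g + g') = ext_diff g + ext_diff g'.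
Proof. by apply: cochain_ext => s m; exact: (ext_diffD g g' s m). Qed.

Lemma ext_diff_opp M N (g : cochain M N) : ext_diff (- g) = - ext_diff g.
Proof. by apply: cochain_ext => s m; exact: (ext_diffN g s m). Qed.

Lemma ext_diff_sgnE M N (g : cochain M N) :
  ext_diff (sgn_cochain g) = - sgn_cochain (ext_diff g).
Proof. by apply: cochain_ext => s m; exact: (ext_diff_sgn g s m). Qed.

Lemma yonedaA_cochain L M N K (f : cochain N K) (g : cochain M N) (h : cochain L M) :
  additive_cochain f ->
  yoneda_cochain (yoneda_cochain f g) h = yoneda_cochain f (yoneda_cochain g h).
Proof.
move=> fB; apply: cochain_ext => s m; elim: s f fB => [|a s IH] f fB.
  by rewrite !yoneda_nil.
rewrite yoneda_cons yoneda_nil (yoneda_cons f) yoneda_cons.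
have f0 : f [::] 0 = 0 by rewrite -(subrr 0) fB subrr.
have fD x y : f [::] (x + y) = f [::] x + f [::] y.
  by rewrite -[y in LHS]opprK fB -[- y]sub0r fB f0 sub0r opprK.
have -> : sft a (yoneda_cochain f g) =
    fun s m => f [::] (sft a g s m) + yoneda_cochain (sft a f) g s m.
  by apply: cochain_ext => s' m'; rewrite /sft yoneda_cons.
rewrite yonedaDl IH; last by move=> *; exact: fB.
rewrite fD -addrA; congr (_ + (_ + _)).
by rewrite /yoneda_cochain (big_morph _ fD f0).
Qed.

(** A map placed in degree 0; for linear [u] it is a cocycle, which puts [Hom] inside [Ext]. *)
Definition homc M N (u : M -> N) : cochain M N := fun s m => if s is [::] then u m else 0.

Lemma yoneda_homl L M N (u : M -> N) (h : cochain L M) :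
  yoneda_cochain (homc u) h = fun s m => u (h s m).
Proof.
apply: cochain_ext => -[|a s] m; first by rewrite yoneda_nil.
by rewrite yoneda_cons /yoneda_cochain big1 ?addr0.
Qed.

Lemma yoneda_homr L M N (u : L -> M) (g : cochain M N) : (forall s, g s 0 = 0) ->
  yoneda_cochain g (homc u) = fun s m => g s (u m).
Proof.
move=> g0; apply: cochain_ext => s m; elim: s g g0 => [|a s IH] g g0.
  by rewrite yoneda_nil.
by rewrite yoneda_cons /= g0 add0r IH // => s'; rewrite /sft.
Qed.

Lemma homc_cochain M N (u : {linear M -> N}) : ext_cochain (homc u).
Proof.
split.
- by move=> [|? ?] *; rewrite /homc /= scaler0 addr0.
- by move=> [|? ?] *; rewrite /homc ?linearP // scaler0 addr0.
- by exists 1%N => -[].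
Qed.

Lemma homc_diff M N (u : {linear M -> N}) : ext_diff (homc u) = 0.
Proof.
apply: cochain_ext => -[//|a [|b t]] m; first by rewrite ext_diff1 /= linearZ subrr.
rewrite /ext_diff /= !scaler0 add0r addr0 big1 ?scaler0 // => i _.
by rewrite /homc /contract; case: i => -[|i] //= _; rewrite scaler0.
Qed.

Lemma comp_cochain L M N (g : cochain M N) (h : L -> M) :
  ext_cochain g -> klinear h -> ext_cochain (fun s m => g s (h m)).
Proof.
move=> [gm gl [n gs]] hl; split=> [s1 s2 c x y m|s c x y|].
- exact: gm.
- by rewrite hl gl.
- by exists n => s m; exact: gs.
Qed.

Lemma postcomp_cochain L M N (h : M -> N) (g : cochain L M) :
  klinear h -> ext_cochain g -> ext_cochain (fun s m => h (g s m)).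
Proof.
move=> hl [gm gl [n gs]]; have h0 : h 0 = 0.
  have := hl (-1) 0 0; rewrite scaler0 addr0 => {1}->.
  by rewrite scaleN1r scaleN1r addNr.
split=> [s1 s2 c x y m|s c x y|].
- by rewrite gm hl.
- by rewrite gl hl.
- by exists n => s m sn; rewrite gs.
Qed.

Definition trunc_cochain M N n (g : cochain M N) : cochain M N :=
  fun s m => if size s == n then g s m else 0.

Lemma trunc_is_cochain M N n (g : cochain M N) : ext_cochain g -> ext_cochain (trunc_cochain n g).
Proof.
move=> [gm gl [n' gs]]; split.
- by move=> *; rewrite /trunc_cochain gm !size_cat /=; case: ifP => // _; rewrite scaler0 addr0.
- by move=> *; rewrite /trunc_cochain; case: ifP => _; rewrite ?gl // scaler0 addr0.
- by exists n' => s m sn; rewrite /trunc_cochain gs // if_same.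
Qed.

Lemma trunc_diff M N n (g : cochain M N) :
  ext_diff (trunc_cochain n g) = trunc_cochain n.+1 (ext_diff g).
Proof.
apply: cochain_ext => -[|a t] m; first by [].
rewrite /ext_diff /trunc_cochain [size (a :: t)]/= eqSS size_belast.
case: eqP => tn; last first.
  rewrite !scaler0 addr0 add0r big1 // => i _.
  by rewrite size_contract //= (introF eqP tn) scaler0.
congr (_ + _ + _); apply: eq_bigr => i _.
have -> : size (contract i (a :: t)) = size t by rewrite size_contract.
by rewrite (introT eqP tn).
Qed.

Lemma trunc_trunc M N m n (g : cochain M N) :
  trunc_cochain m (trunc_cochain n g) = if m == n then trunc_cochain n g else 0.
Proof.
apply: cochain_ext => s x; rewrite /trunc_cochain.
case: (eqVneq m n) => [->|mn]; first by rewrite /=; case: ifP => [->|].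
by case: eqP => // ->; rewrite (negbTE mn).
Qed.

Lemma trunc_yoneda L M N p q (g : cochain M N) (h : cochain L M) :
  (forall s, g s 0 = 0) ->
  trunc_cochain p (yoneda_cochain g (trunc_cochain q h)) =
  if (q <= p)%N then yoneda_cochain (trunc_cochain (p - q)%N g) (trunc_cochain q h) else 0.
Proof.
move=> g0; apply: cochain_ext => s m.
have -> : (if (q <= p)%N then yoneda_cochain (trunc_cochain (p - q)%N g) (trunc_cochain q h) else 0) s m =
   if (q <= p)%N then yoneda_cochain (trunc_cochain (p - q)%N g) (trunc_cochain q h) s m else 0.
  by case: ifP.
rewrite {1}/trunc_cochain; case: eqP => [<-|np].
  case: leqP => qp; rewrite /yoneda_cochain /trunc_cochain.
    apply: eq_bigr => i _; have ip : (i <= size s)%N by rewrite -ltnS.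
    rewrite size_drop size_takel //.
    case: (eqVneq (size s - i)%N q) => [e|ne]; last by rewrite /= g0 if_same.
    by rewrite -e subKn // eqxx.
  rewrite big1 // => i _; rewrite size_drop.
  by case: eqP => [e|_]; [move: qp; rewrite -e ltnNge leq_subr | rewrite g0].
case: leqP => // qp; rewrite /yoneda_cochain big1 // => i _.
rewrite /trunc_cochain size_drop size_takel; last by rewrite -ltnS.
case: eqP => // ip; case: eqP => [e|_]; last by rewrite g0.
case: np; rewrite -(subnK qp) -ip -e subnKC //.
by rewrite -ltnS.
Qed.

Lemma trunc_sum M N (g : cochain M N) n : (forall s m, (n <= size s)%N -> g s m = 0) ->
  g = \sum_(i < n) trunc_cochain i g.
Proof.
move=> gs; apply: cochain_ext => s m.
rewrite fct_sumE fct_sumE /trunc_cochain.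
case: (ltnP (size s) n) => [lt|ge].
  rewrite (bigD1 (Ordinal lt)) //= eqxx big1 ?addr0 // => i.
  by rewrite -val_eqE eq_sym /= => /negbTE ->.
by rewrite gs // big1 // => i _; case: eqP => // e; move: (ltn_ord i); rewrite -e ltnNge ge.
Qed.

(** Needed for products with the class of a short exact sequence, which has degree 1. *)
Lemma yoneda_deg1r L M N (g : cochain M N) (h : cochain L M) a t m : (forall s, g s 0 = 0) ->
  (forall s m, size s != 1%N -> h s m = 0) ->
  yoneda_cochain g h (a :: t) m = g (belast a t) (h [:: last a t] m).
Proof.
move=> g0 h1; elim: t a g g0 => [|b t IH] a g g0.
  by rewrite yoneda_cons yoneda_nil /sft /= (h1 [::]) // g0 addr0.
by rewrite yoneda_cons h1 // g0 add0r IH // => s; rewrite /sft.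
Qed.

Lemma yoneda_deg1l L M N (g : cochain M N) (h : cochain L M) a t m :
  (forall s m, size s != 1%N -> g s m = 0) ->
  yoneda_cochain g h (a :: t) m = g [:: a] (h t m).
Proof.
move=> g1; rewrite yoneda_cons g1 // add0r; case: t => [|b t]; first by rewrite yoneda_nil.
rewrite yoneda_cons /yoneda_cochain big1 ?addr0 // => i _.
by rewrite /sft g1.
Qed.

End Cochains.

Section ExtClasses.
Variables (k : fieldType) (A : falgType k).
Implicit Types L M N K P Q : lmodType A.

Lemma cocycleP M N (g : seq A -> M -> N) :
  ext_cochain g -> ext_diff g = 0 -> g \in @ext_cocycle_pred k A M N.
Proof. by move=> Cg dg; apply/asboolP. Qed.

Definition cocycle M N (g : seq A -> M -> N) (Cg : ext_cochain g) (dg : ext_diff g = 0) :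
  ext_cocycle M N := ExtCocycle (cocycleP Cg dg).

Lemma cocycle_cochain M N (z : ext_cocycle M N) : ext_cochain z.
Proof. by have /asboolP [] := valP z. Qed.

Lemma cocycle_diff M N (z : ext_cocycle M N) : ext_diff z = 0.
Proof. by have /asboolP [] := valP z. Qed.

Lemma cocycle_zero M N (z : ext_cocycle M N) s : z s 0 = 0.
Proof. exact/ext_cochain_g0/cocycle_cochain. Qed.

Lemma cocycle_additive M N (z : ext_cocycle M N) : additive_cochain z.
Proof. exact/ext_cochain_add/cocycle_cochain. Qed.

Lemma cocycle_add M N (z : ext_cocycle M N) s x y : z s (x + y) = z s x + z s y.
Proof.
have zB := cocycle_additive z s.
by rewrite -[y in LHS]opprK zB -[- y]sub0r zB cocycle_zero sub0r opprK.
Qed.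

Lemma ext_class_surj M N (x : Ext M N) : exists z, x = ext_class z.
Proof. by exists (ext_repr x); rewrite ext_reprK. Qed.

Lemma ext_class_val M N (z z' : ext_cocycle M N) : val z = val z' -> ext_class z = ext_class z'.
Proof. by move=> e; congr ext_class; exact: val_inj. Qed.

Lemma ext_class_diff M N (z z' : ext_cocycle M N) g :
  ext_cochain g -> (val z : seq A -> M -> N) - val z' = ext_diff g -> ext_class z = ext_class z'.
Proof. by move=> Cg e; apply/ext_classP; exists g. Qed.

Lemma ext_classD M N (z z' : ext_cocycle M N) : ext_class (z + z') = ext_class z + ext_class z'.
Proof. by rewrite /ext_class raddfD. Qed.

Lemma ext_class0 M N : ext_class (0 : ext_cocycle M N) = 0.
Proof. by rewrite /ext_class raddf0. Qed.

Lemma ext_classN M N (z : ext_cocycle M N) : ext_class (- z) = - ext_class z.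
Proof. by rewrite /ext_class raddfN. Qed.

Lemma ext_class_eq0 M N (z : ext_cocycle M N) : ext_class z = 0 ->
  exists2 g, ext_cochain g & val z = ext_diff g.
Proof.
by rewrite -(ext_class0 M N) => /ext_classP [g Cg]; rewrite [val 0]/= subr0; exists g.
Qed.

Lemma ext_class_bound M N (z : ext_cocycle M N) g : ext_cochain g -> val z = ext_diff g ->
  ext_class z = 0.
Proof.
move=> Cg e; rewrite -(ext_class0 M N); apply: (ext_class_diff Cg).
by rewrite [val 0]/= subr0.
Qed.

Lemma yonedaDlE L M N (x x' : Ext M N) (y : Ext L M) : yoneda (x + x') y = yoneda x y + yoneda x' y.
Proof.
have [[z ->] [z' ->]] := (ext_class_surj x, ext_class_surj x').
have [w ->] := ext_class_surj y; rewrite -ext_classD !yonedaE -ext_classD.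
by apply: ext_class_val; apply: cochain_ext => s m; exact: yonedaDl.
Qed.

Lemma yonedaDrE L M N (x : Ext M N) (y y' : Ext L M) : yoneda x (y + y') = yoneda x y + yoneda x y'.
Proof.
have [[w ->] [w' ->]] := (ext_class_surj y, ext_class_surj y').
have [z ->] := ext_class_surj x; rewrite -ext_classD !yonedaE -ext_classD.
apply: ext_class_val; apply: cochain_ext => s m.
rewrite /= /yoneda_cochain !fctE -big_split; apply: eq_bigr => i _.
exact: cocycle_add.
Qed.

Lemma yonedaAE L M N K (x : Ext N K) (y : Ext M N) (w : Ext L M) :
  yoneda (yoneda x y) w = yoneda x (yoneda y w).
Proof.
have [z ->] := ext_class_surj x; have [z' ->] := ext_class_surj y.
have [z'' ->] := ext_class_surj w; rewrite !yonedaE.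
by apply: ext_class_val; apply: yonedaA_cochain; exact: cocycle_additive.
Qed.

Lemma yoneda0l L M N (y : Ext L M) : yoneda (0 : Ext M N) y = 0.
Proof. by apply: (@addrI _ (yoneda 0 y)); rewrite -yonedaDlE !addr0. Qed.

Lemma yoneda0r L M N (x : Ext M N) : yoneda x (0 : Ext L M) = 0.
Proof. by apply: (@addrI _ (yoneda x 0)); rewrite -yonedaDrE !addr0. Qed.

Lemma yonedaNlE L M N (x : Ext M N) (y : Ext L M) : yoneda (- x) y = - yoneda x y.
Proof. by apply: (@addrI _ (yoneda x y)); rewrite -yonedaDlE !subrr yoneda0l. Qed.

Lemma yonedaNrE L M N (x : Ext M N) (y : Ext L M) : yoneda x (- y) = - yoneda x y.
Proof. by apply: (@addrI _ (yoneda x y)); rewrite -yonedaDrE !subrr yoneda0r. Qed.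

Definition hom_cocycle M N (u : {linear M -> N}) := cocycle (homc_cochain u) (homc_diff u).
Definition hom_class M N (u : {linear M -> N}) : Ext M N := ext_class (hom_cocycle u).

Lemma yoneda_id M N (x : Ext M N) : yoneda x (hom_class (@idfun M)) = x.
Proof.
have [z ->] := ext_class_surj x; rewrite yonedaE; apply: ext_class_val.
by rewrite /= yoneda_homr // => s; exact: cocycle_zero.
Qed.

Lemma hom_class_comp L M N (u : {linear M -> N}) (v : {linear L -> M}) :
  yoneda (hom_class u) (hom_class v) = hom_class (u \o v).
Proof.
rewrite yonedaE; apply: ext_class_val; rewrite /= yoneda_homl.
by apply: cochain_ext => -[|a s] m //=; rewrite linear0.
Qed.

Lemma hom_class_inj M N (u v : {linear M -> N}) : hom_class u = hom_class v -> u =1 v.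
Proof.
move=> /ext_classP [g _ /(congr1 (fun f => f [::]))] e x.
have := congr1 (@^~ x) e; rewrite !fctE /= => /eqP.
by rewrite subr_eq0 => /eqP.
Qed.

Lemma hom_class_ext M N (u v : {linear M -> N}) : u =1 v -> hom_class u = hom_class v.
Proof.
move=> uv; apply: ext_class_val; apply: cochain_ext => -[|a s] m //=.
Qed.

Definition trunc_cocycle M N (n : nat) (z : ext_cocycle M N) : ext_cocycle M N.
Proof.
refine (cocycle (trunc_is_cochain n (cocycle_cochain z)) _).
have h : trunc_cochain n.+1 (ext_diff z) = 0.
  by rewrite cocycle_diff; apply: cochain_ext => s m; rewrite /trunc_cochain if_same.
by rewrite trunc_diff.
Defined.

Definition ext_comp M N (n : nat) (x : Ext M N) : Ext M N := ext_class (trunc_cocycle n (ext_repr x)).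

(** Truncation passes to classes because the differential raises the degree by one; in degree 0
    there are no coboundaries. *)
Lemma ext_compE M N n (z : ext_cocycle M N) : ext_comp n (ext_class z) = ext_class (trunc_cocycle n z).
Proof.
have /ext_classP [g Cg e] : ext_class (ext_repr (ext_class z)) = ext_class z by exact: ext_reprK.
case: n => [|n].
  apply: (ext_class_diff (ext_cochain0 M N)); rewrite ext_diff_zero.
  apply: cochain_ext => -[|a s] m; rewrite !fctE /= /trunc_cochain /= ?subrr //.
  have := congr1 (fun f => f [::] m) e; rewrite !fctE ext_diff0 => /eqP.
  by rewrite subr_eq0 => /eqP ->; rewrite subrr.
apply: (ext_class_diff (trunc_is_cochain n Cg)); rewrite trunc_diff -e.
apply: cochain_ext => s m; rewrite !fctE /= /trunc_cochain.
by case: ifP => // _; rewrite subrr.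
Qed.

Lemma ext_comp_degree M N n (z : ext_cocycle M N) :
  (forall s m, size s != n -> z s m = 0) -> ext_comp n (ext_class z) = ext_class z.
Proof.
move=> zn; rewrite ext_compE; apply: ext_class_val; apply: cochain_ext => s m.
by rewrite /= /trunc_cochain; case: eqP => // /eqP/zn ->.
Qed.

Lemma ext_compD M N n (x y : Ext M N) : ext_comp n (x + y) = ext_comp n x + ext_comp n y.
Proof.
have [z ->] := ext_class_surj x; have [w ->] := ext_class_surj y.
rewrite -ext_classD !ext_compE -ext_classD; apply: ext_class_val; apply: cochain_ext => s m.
by rewrite /= !fctE /trunc_cochain /=; case: ifP => // _; rewrite addr0.
Qed.

Lemma ext_comp_comp M N m n (x : Ext M N) :
  ext_comp m (ext_comp n x) = if m == n then ext_comp n x else 0.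
Proof.
have [z ->] := ext_class_surj x; rewrite !ext_compE.
have -> : (if m == n then ext_class (trunc_cocycle n z) else 0) =
    ext_class (if m == n then trunc_cocycle n z else 0).
  by case: ifP => // _; rewrite ext_class0.
apply: ext_class_val; rewrite /= trunc_trunc.
by case: ifP.
Qed.

Lemma ext_comp_sum M N (x : Ext M N) : exists n, x = \sum_(i < n) ext_comp i x.
Proof.
have [z ->] := ext_class_surj x; have [_ _ [n zn]] := cocycle_cochain z.
exists n; under eq_bigr do rewrite ext_compE.
have -> : \sum_(i < n) ext_class (trunc_cocycle i z) = ext_class (\sum_(i < n) trunc_cocycle i z).
  by rewrite /ext_class raddf_sum.
apply: ext_class_val; rewrite raddf_sum /=.
exact: trunc_sum.
Qed.

Lemma ext_comp_yoneda L M N p q (x : Ext M N) (y : Ext L M) :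
  ext_comp p (yoneda x (ext_comp q y)) =
  if (q <= p)%N then yoneda (ext_comp (p - q)%N x) (ext_comp q y) else 0.
Proof.
have [z ->] := ext_class_surj x; have [w ->] := ext_class_surj y.
rewrite (ext_compE q) (ext_compE (p - q)%N) !yonedaE (ext_compE p).
have -> : (if (q <= p)%N then ext_class (yoneda_cocycle (trunc_cocycle (p - q)%N z) (trunc_cocycle q w)) else 0)
   = ext_class (if (q <= p)%N then yoneda_cocycle (trunc_cocycle (p - q)%N z) (trunc_cocycle q w) else 0).
  by case: ifP => // _; rewrite ext_class0.
apply: ext_class_val; rewrite /= trunc_yoneda; last exact: cocycle_zero.
by case: ifP.
Qed.

Lemma ext_comp_hom M N (u : {linear M -> N}) : ext_comp 0%N (hom_class u) = hom_class u.
Proof. by apply: ext_comp_degree => -[]. Qed.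

(** In degree 0 the cocycle condition is linearity over [A]. *)
Lemma ext_comp0_hom M N (x : Ext M N) : ext_comp 0%N x = x -> exists u, x = hom_class u.
Proof.
have [z ->] := ext_class_surj x; rewrite ext_compE => e.
have zl : linear (fun m => z [::] m).
  move=> a x1 y1.
  have za b m : z [::] (b *: m) = b *: z [::] m.
    have := congr1 (fun f => f [:: b] m) (cocycle_diff z); rewrite ext_diff1 => /eqP.
    by rewrite subr_eq0 => /eqP.
  by rewrite cocycle_add za.
exists (mklin zl); rewrite -e; apply: ext_class_val; apply: cochain_ext => -[|a s] m //.
Qed.

End ExtClasses.

Section HHAction.
Variables (k : fieldType) (A : falgType k).
Implicit Types L M N K P Q : lmodType A.
Implicit Types x y : HH A.

Lemma hh_class_surj x : exists z, x = hh_class z.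
Proof. by exists (hh_repr x); rewrite hh_reprK. Qed.

Lemma HH_to_ExtD M x y : HH_to_Ext M (x + y) = HH_to_Ext M x + HH_to_Ext M y.
Proof.
have [z ->] := hh_class_surj x; have [w ->] := hh_class_surj y.
rewrite -hh_classD !HH_to_ExtE -ext_classD; apply: ext_class_val.
by apply: cochain_ext => s m; rewrite /= !fctE /tensor_cochain scalerDl.
Qed.

Lemma HH_to_ExtM M x y : HH_to_Ext M (x * y) = yoneda (HH_to_Ext M x) (HH_to_Ext M y).
Proof.
have [z ->] := hh_class_surj x; have [w ->] := hh_class_surj y.
rewrite hh_classM !HH_to_ExtE yonedaE; apply: ext_class_val.
exact: tensor_cup.
Qed.

Lemma HH_to_Ext_scalar M (c : k) (u : {linear M -> M}) : (forall m, u m = c%:A *: m) ->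
  HH_to_Ext M (c *: 1) = hom_class u.
Proof.
move=> uE; have -> : c *: 1 = hh_class (c *: hh_one A) by rewrite hh_classZ.
rewrite HH_to_ExtE; apply: ext_class_val; apply: cochain_ext => -[|a s] m.
  by rewrite /= /tensor_cochain !fctE /= uE.
by rewrite /= /tensor_cochain !fctE /= scaler0 scale0r.
Qed.

Lemma HH_to_Ext1 M : HH_to_Ext M 1 = hom_class (@idfun M).
Proof.
by rewrite -[1](scale1r (1 : HH A)); apply: HH_to_Ext_scalar => m; rewrite !scale1r.
Qed.

Lemma HH_to_Ext_natural L M (j : {linear L -> M}) x :
  yoneda (hom_class j) (HH_to_Ext L x) = yoneda (HH_to_Ext M x) (hom_class j).
Proof.
have [z ->] := hh_class_surj x; rewrite !HH_to_ExtE !yonedaE; apply: ext_class_val.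
rewrite /= yoneda_homl yoneda_homr; last by move=> s; rewrite /tensor_cochain scaler0.
by apply: cochain_ext => s m; rewrite /tensor_cochain linearZ.
Qed.

Lemma HH_act_hom L M N (j : {linear L -> M}) (e : Ext M N) x :
  HH_act (yoneda e (hom_class j)) x = yoneda (HH_act e x) (hom_class j).
Proof. by rewrite /HH_act !yonedaAE HH_to_Ext_natural. Qed.

Lemma scalar_central (c : k) (a : A) : a * c%:A = c%:A * a.
Proof. by rewrite mulr_algr mulr_algl. Qed.

Lemma scalar_linear M N (c : k) (u : {linear M -> N}) : linear (fun m => c%:A *: u m).
Proof.
move=> a x y; rewrite linearP scalerDr; congr (_ + _).
by rewrite !scalerA scalar_central.
Qed.

Definition scale_hom M N (c : k) (u : {linear M -> N}) : {linear M -> N} := mklin (scalar_linear c u).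

End HHAction.

(** * Dimension shifting *)

Section Shift.
Variables (k : fieldType) (A : falgType k).
Implicit Types L M N K P Q : lmodType A.

Lemma klinear_sum M N (h : M -> N) (I : Type) (r : seq I) (F : I -> M) :
  klinear h -> h (\sum_(i <- r) F i) = \sum_(i <- r) h (F i).
Proof.
move=> hl; have h0 : h 0 = 0.
  have := hl (-1) 0 0; rewrite scaler0 addr0 => {1}->.
  by rewrite scaleN1r scaleN1r addNr.
have hD x y : h (x + y) = h x + h y.
  by have := hl 1 x y; rewrite !scale1r.
exact: (big_morph h hD h0).
Qed.

Lemma klinear0 M N (h : M -> N) : klinear h -> h 0 = 0.
Proof.
move=> hl; have := hl (-1) 0 0; rewrite scaler0 addr0 => {1}->.
by rewrite scaleN1r scaleN1r addNr.
Qed.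

Lemma klinearD M N (h : M -> N) x y : klinear h -> h (x + y) = h x + h y.
Proof. by move=> hl; have := hl 1 x y; rewrite !scale1r. Qed.

Lemma klinearN M N (h : M -> N) x : klinear h -> h (- x) = - h x.
Proof.
move=> hl; have := hl (-1) x 0; rewrite addr0 (klinear0 hl) addr0.
by rewrite !scaleN1r.
Qed.

Lemma klinear_sign M N (h : M -> N) n x : klinear h -> h ((-1) ^+ n *: x) = (-1) ^+ n *: h x.
Proof.
move=> hl; apply: additive_sgn => u v.
by rewrite klinearD // klinearN.
Qed.

(** The sequence splits over [k]. The splitting need not respect [A], and its failure to do so is
    the class of the extension. *)
Lemma klinear_section P M K (p : {linear P -> M}) (i : {linear K -> P}) :
  finitely_generated M -> surjective p -> injective i -> exact_at i p ->
  exists (sg : M -> P) (ka : P -> K), [/\ klinear sg, klinear ka,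
    forall m, p (sg m) = m, forall q, i (ka q) = q - sg (p q) & forall x, ka (i x) = x].
Proof.
move=> fM sp ii ex; have [f [g [fK gK fl]]] := kdimP fM.
have gl := kcoord_klinear fK gK fl.
have [x hx] := choice (fun j : 'I_(kdim M) => sp (g (delta_mx 0 j))).
pose sg m := \sum_j (f m 0 j)%:A *: x j.
have sgl : klinear sg.
  move=> c u v; rewrite /sg fl scaler_sumr -big_split; apply: eq_bigr => j _.
  by rewrite !mxE [in LHS]scalerDl [in LHS]scalerDl scalerA mulr_algl scalerA.
have psg m : p (sg m) = m.
  rewrite /sg linear_sum -{2}(fK m) [X in _ = g X](row_sum_delta (f m)).
  elim/big_rec2: _ => [|j u v _ e]; first by rewrite (kcoord_zero gl).
  by rewrite linearZ /= hx gl e.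
have hk q : exists y, i y = q - sg (p q) by apply/ex; rewrite linearB psg subrr.
have [ka hka] := choice hk.
exists sg, ka; split=> // [c u v|y].
  apply: ii; rewrite linearP !hka linearP sgl scalerBr opprD.
  by rewrite addrACA.
by apply: ii; rewrite hka (proj2 (ex _)) ?(klinear0 sgl) ?subr0 //; exists y.
Qed.

Lemma contract_rcons l (s : seq A) x : (l.+1 < size s)%N ->
  contract l (rcons s x) = rcons (contract l s) x.
Proof.
move=> ls; rewrite /contract rcons_cat /= -!cats1.
rewrite takel_cat ?(ltnW (ltnW ls)) // !nth_cat ls (ltnW ls) drop_cat.
case: ltnP => // h; have -> : l.+2 = size s by apply/eqP; rewrite eqn_leq ls.
by rewrite subnn drop0 drop_size.
Qed.

(* A dual basis [(x_j, f_j)] of [P] gives the contraction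
   [w s q = \sum_j z (s ++ [f_j q]) x_j]. *)
Lemma projective_coboundary P N (z : ext_cocycle P N) : projective P ->
  finitely_generated P -> (forall m, z [::] m = 0) ->
  exists2 w, ext_cochain w & val z = ext_diff w.
Proof.
move=> pP fP z0; have [n [i [r ri]]] := fg_projective_retract pP fP.
pose w s (q : P) : N := \sum_(j < n) z (rcons s (i q 0 j)) (r (delta_mx 0 j)).
have [zm zl [b zb]] := cocycle_cochain z.
have Cw : ext_cochain w.
  split=> [s1 s2 c x y m|s c x y|].
  - rewrite /w scaler_sumr -big_split; apply: eq_bigr => j _.
    by rewrite !rcons_cat /= zm.
  - rewrite /w scaler_sumr -big_split; apply: eq_bigr => j _ /=.
    by rewrite linearP !mxE mulr_algl -!cats1 zm.
  - by exists b => s m bs; rewrite /w big1 // => j _; rewrite zb // size_rcons leqW.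
exists (- sgn_cochain w); first exact/ext_cochainN/sgn_is_cochain.
rewrite ext_diff_opp ext_diff_sgnE opprK; apply: cochain_ext => -[|a t] m.
  by rewrite /sgn_cochain ext_diff0 scaler0; exact: z0.
rewrite /sgn_cochain.
suff -> : ext_diff w (a :: t) m = (-1) ^+ size (a :: t) *: z (a :: t) m.
  by rewrite scalerA -expr2 sqrr_sign scale1r.
have mE : m = \sum_(j < n) i m 0 j *: r (delta_mx 0 j).
  rewrite -{1}(ri m) {1}(row_sum_delta (i m)) linear_sum.
  by apply: eq_bigr => j _; rewrite linearZ.
(* Summed over [j], the terms of this identity assemble to [ext_diff w], except for the last, in
   which the dual basis recovers [m] and [z] itself appears. *)
have cyc j : ext_diff z (rcons (a :: t) (i m 0 j)) (r (delta_mx 0 j)) = 0.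
  by rewrite cocycle_diff.
have : \sum_(j < n) ext_diff z (rcons (a :: t) (i m 0 j)) (r (delta_mx 0 j)) = 0.
  by rewrite big1.
rewrite /ext_diff /=.
under eq_bigr => j _.
  rewrite size_rcons big_ord_recr /= last_rcons belast_rcons.
  have -> : contract (size t) (a :: rcons t (i m 0 j)) = rcons (belast a t) (last a t * i m 0 j).
    have -> : a :: rcons t (i m 0 j) = rcons (belast a t) (last a t) ++ [:: i m 0 j].
      by rewrite -lastI -rcons_cons cats1.
    rewrite /contract -cats1 -[in take _ _](size_belast a t).
    rewrite -!cats1 -!catA /= take_size_cat //.
    have -> : (belast a t ++ [:: last a t; i m 0 j])`_(size t) = last a t.
      by rewrite nth_cat size_belast ltnn subnn.
    have -> : (belast a t ++ [:: last a t; i m 0 j])`_(size t).+1 = i m 0 j.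
      by rewrite nth_cat size_belast ltnNge leqnSn /= subSn // subnn.
    by rewrite drop_oversize // size_cat size_belast /= addn2.
  over.
rewrite !big_split /= => h.
have e1 : \sum_(j < n) a *: z (rcons t (i m 0 j)) (r (delta_mx 0 j)) = a *: w t m.
  by rewrite scaler_sumr.
have e2 : \sum_(j < n) \sum_(l < size t) (-1) ^+ l.+1 *:
      z (contract l (a :: rcons t (i m 0 j))) (r (delta_mx 0 j)) =
    \sum_(l < size t) (-1) ^+ l.+1 *: w (contract l (a :: t)) m.
  rewrite exchange_big; apply: eq_bigr => l _; rewrite scaler_sumr; apply: eq_bigr => j _.
  by rewrite -rcons_cons contract_rcons //= ltnS.
have e3 : \sum_(j < n) (-1) ^+ (size t).+1 *: z (rcons (belast a t) (last a t * i m 0 j)) (r (delta_mx 0 j))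
   = (-1) ^+ (size t).+1 *: w (belast a t) (last a t *: m).
  rewrite scaler_sumr; apply: eq_bigr => j _.
  by rewrite linearZ mxE.
have e4 : \sum_(j < n) (-1) ^+ (size t).+2 *: z (a :: t) (i m 0 j *: r (delta_mx 0 j))
   = - ((-1) ^+ (size t).+1 *: z (a :: t) m).
  rewrite -scaler_sumr [in RHS]mE exprS mulN1r scaleNr; congr (- (_ *: _)).
  by rewrite (big_morph _ (cocycle_add z (a :: t)) (cocycle_zero z (a :: t))).
by move: h; rewrite e1 e2 e3 e4 => /eqP; rewrite !addrA subr_eq0 => /eqP <-.
Qed.

(** * The degree 1 class of a short exact sequence *)

Section ShortExact.
Variables (P M K : lmodType A) (p : {linear P -> M}) (i : {linear K -> P}).
Variables (sg : M -> P) (ka : P -> K).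
Hypotheses (sgl : klinear sg) (kal : klinear ka) (psg : forall m, p (sg m) = m)
  (ika : forall q, i (ka q) = q - sg (p q)) (kai : forall x, ka (i x) = x).

Let ii : injective i. Proof. by move=> x y e; rewrite -(kai x) -(kai y) e. Qed.

Lemma section_pi x : p (i x) = 0.
Proof. by have := ika (i x); rewrite kai => /eqP; rewrite eq_sym subr_eq addrC -subr_eq subrr => /eqP e; rewrite -(psg (p (i x))) -e linear0. Qed.

(** The cocycle of the extension: its image under [i] is [a *: sg m - sg (a *: m)]. Products with it
    are the connecting maps of [Ext], up to sign. *)
Definition shift_cochain : seq A -> M -> K := fun s m => if s is [:: a] then ka (a *: sg m) else 0.

Lemma shift_val a m : i (shift_cochain [:: a] m) = a *: sg m - sg (a *: m).
Proof. by rewrite /= ika linearZ /= psg. Qed.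

Lemma shift_is_cochain : ext_cochain shift_cochain.
Proof.
split=> [s1 s2 c x y m|s c x y|].
- case: s1 => [|u [|? ?]]; case: s2 => [|? ?]; rewrite /= ?scaler0 ?addr0 //.
  by rewrite scalerDl -kal scalerA mulr_algl.
- case: s => [|a [|? ?]]; rewrite /= ?scaler0 ?addr0 // -kal sgl scalerDr.
  by rewrite !scalerA scalar_central.
- by exists 2 => -[|? [|? ?]].
Qed.

Lemma shift_diff : ext_diff shift_cochain = 0.
Proof.
apply: cochain_ext => -[|a [|b [|c t]]] m //.
- by rewrite ext_diff1 /= scaler0 subr0.
- have -> : ext_diff shift_cochain [:: a; b] m = a *: shift_cochain [:: b] m
      - shift_cochain [:: a * b] m + shift_cochain [:: a] (b *: m).
    by rewrite /ext_diff /= big_ord1 /contract /= expr1 scaleN1r expr2 mulN1r opprK scale1r.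
  move: (shift_cochain [:: b] m) (shift_cochain [:: a * b] m) (shift_cochain [:: a] (b *: m))
    (shift_val b m) (shift_val (a * b) m) (shift_val a (b *: m)) => u v w eu ev ew.
  apply: ii; rewrite linearD linearB linearZ /= eu ev ew linear0.
  rewrite scalerBr !scalerA opprB !addrA.
  by rewrite [LHS](ACl ((1*4)*(2*5)*(3*6)))%AC /= subrr addNr subrr !addr0.
- rewrite /ext_diff /= !scaler0 add0r addr0 big1 // => l _.
  have := size_contract (i := l) (s := [:: a, b, c & t]) (ltn_ord l).
  by case: contract => [|? [|? ?]] //=; rewrite scaler0.
Qed.

Definition shift_cocycle := cocycle shift_is_cochain shift_diff.
Definition shift_class : Ext M K := ext_class shift_cocycle.

Lemma shift_degree s m : size s != 1%N -> shift_cochain s m = 0.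
Proof. by case: s => [|? [|? ?]]. Qed.

Lemma shift_comp : ext_comp 1%N shift_class = shift_class.
Proof. by apply: ext_comp_degree => s m; exact: shift_degree. Qed.

Lemma precomp_diff L M1 N (g : seq A -> M1 -> N) (h : {linear L -> M1}) :
  ext_diff (fun s m => g s (h m)) = fun s m => ext_diff g s (h m).
Proof.
apply: cochain_ext => -[//|a t] m; rewrite /ext_diff.
by rewrite linearZ.
Qed.

(** Pulled back to [P], the cocycle bounds some [w]. The restriction of [w] to [K], with signs, is
    the required cocycle, and [w] composed with the section bounds the difference. *)
Lemma shift_surjective N (z : ext_cocycle M N) : projective P -> finitely_generated P ->
  (forall m, z [::] m = 0) -> exists y : Ext K N, ext_class z = yoneda y shift_class.
Proof.
move=> pP fP z0.
have Czp : ext_cochain (fun s q => z s (p q)).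
  exact: comp_cochain (cocycle_cochain z) (linear_klinear p).
have dzp : ext_diff (fun s q => z s (p q)) = 0.
  by rewrite precomp_diff cocycle_diff.
have [|w Cw zw] := @projective_coboundary P N (cocycle Czp dzp) pP fP.
  by move=> m /=; exact: z0.
have Cwi : ext_cochain (fun s x => w s (i x)) by exact: comp_cochain Cw (linear_klinear i).
have dwi : ext_diff (fun s x => w s (i x)) = 0.
  rewrite precomp_diff; apply: cochain_ext => s x.
  by rewrite -zw /= section_pi cocycle_zero.
have Cy : ext_cochain (- sgn_cochain (fun s x => w s (i x))).
  exact/ext_cochainN/sgn_is_cochain.
have dy : ext_diff (- sgn_cochain (fun s x => w s (i x))) = 0.
  rewrite ext_diff_opp ext_diff_sgnE dwi opprK; apply: cochain_ext => s x.
  by rewrite /sgn_cochain scaler0.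
exists (ext_class (cocycle Cy dy)); rewrite yonedaE.
have Cws : ext_cochain (fun s m => w s (sg m)) by exact: comp_cochain Cw sgl.
have subE (u v : seq A -> M -> N) s x : (u - v) s x = u s x - v s x by [].
apply: (ext_class_diff Cws); apply: cochain_ext => -[|a t] m; rewrite subE [val (yoneda_cocycle _ _)]/=.
  by rewrite ext_diff0 yoneda_nil -[val z _ _]/(z [::] m) z0 (ext_cochain_g0 _ Cy) subrr.
have wB := ext_cochain_add Cw.
rewrite yoneda_deg1r; last 2 first.
- by move=> s; exact: ext_cochain_g0 Cy.
- by move=> s x; exact: shift_degree.
rewrite !fctE /sgn_cochain shift_val wB size_belast.
have zE : z (a :: t) m = ext_diff w (a :: t) (sg m) by rewrite -zw /= psg.
rewrite -[val z _ _]/(z (a :: t) m) zE /ext_diff [size (a :: t)]/= exprS mulN1r !scaleNr opprK scalerBr.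
by rewrite addrA subrK.
Qed.

(** If the product bounds [v], the cocycle extends to [P]: transport it along [ka] and correct the
    result by the signed pullback of [v] along [p]. *)
Lemma shift_injective N (y : Ext K N) : yoneda y shift_class = 0 ->
  exists z : Ext P N, y = yoneda z (hom_class i).
Proof.
have [c ->] := ext_class_surj y; rewrite yonedaE => /ext_class_eq0 [v Cv /= ev].
have Cw : ext_cochain (fun s q => c s (ka q)) by exact: comp_cochain (cocycle_cochain c) kal.
have Cvp : ext_cochain (fun s q => sgn_cochain v s (p q)).
  exact: comp_cochain (sgn_is_cochain Cv) (linear_klinear p).
have Cz := ext_cochainD Cw Cvp.
have dz : ext_diff ((fun s q => c s (ka q)) + (fun s q => sgn_cochain v s (p q))) = 0.
  rewrite ext_diff_add precomp_diff ext_diff_sgnE -ev.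
  apply: cochain_ext => -[|a t] q; rewrite !fctE.
    by rewrite ext_diff0 /sgn_cochain /= yoneda_nil /= cocycle_zero scaler0 oppr0 addr0.
  rewrite /sgn_cochain yoneda_deg1r; last 2 first.
  - by move=> s; exact: cocycle_zero.
  - by move=> s m; exact: shift_degree.
  have -> : shift_cochain [:: last a t] (p q) = ka (last a t *: q) - last a t *: ka q.
    apply: ii; rewrite shift_val linearB linearZ /= !ika linearZ /= scalerBr opprB.
    by rewrite !addrA [RHS](ACl (3*2*(1*4)))%AC /= subrr addr0.
  have := congr1 (fun f => f (a :: t) (ka q)) (cocycle_diff c).
  rewrite /ext_diff (cocycle_additive c) scalerBr opprB => /eqP.
  rewrite addr_eq0 => /eqP e; rewrite e.
  by rewrite (addrC (- _)) addrA subrK subrr.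
exists (ext_class (cocycle Cz dz)); rewrite yonedaE; apply: ext_class_val.
rewrite /= yoneda_homr; last by move=> s; exact: ext_cochain_g0 Cz.
apply: cochain_ext => s x; rewrite !fctE kai section_pi.
by rewrite (ext_cochain_g0 _ (sgn_is_cochain Cv)) addr0.
Qed.

(* The coboundary of [fun s m => ka (f s *: sg m)] is
   [- theta f - (-1)^(d+1) f theta], where [theta] is the cocycle of the extension. *)
Lemma shift_HH_comm d (x : HH A) : HH_deg d x ->
  yoneda shift_class (HH_to_Ext M x) = yoneda (HH_to_Ext K x) shift_class \/
  yoneda shift_class (HH_to_Ext M x) = - yoneda (HH_to_Ext K x) shift_class.
Proof.
move=> [f -> fd]; rewrite !HH_to_ExtE !yonedaE.
have /asboolP [Cf df] := valP f.
pose w s m := ka (f s *: sg m).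
have Cw : ext_cochain w.
  have Ct := @tensor_is_cochain k A P f Cf.
  exact: (postcomp_cochain kal (comp_cochain Ct sgl)).
pose th := yoneda_cochain shift_cochain (@tensor_cochain k A M f).
pose ht := yoneda_cochain (@tensor_cochain k A K f) shift_cochain.
have key : ext_diff w = - th - sgn_cochain ht.
  apply: cochain_ext => s m.
  have -> : (- th - sgn_cochain ht) s m = - th s m - (-1) ^+ size s *: ht s m by [].
  case: s => [|a t].
    by rewrite ext_diff0 /th /ht !yoneda_nil /= /tensor_cochain scaler0 oppr0 scaler0 subr0.
  rewrite /th yoneda_deg1l; last by move=> s u; exact: shift_degree.
  rewrite /ht yoneda_deg1r; last 2 first.
  - by move=> s; rewrite /tensor_cochain scaler0.
  - by move=> s u; exact: shift_degree.
  rewrite /tensor_cochain; apply: ii.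
  have iw s u : i (w s u) = f s *: sg u - sg (f s *: u).
    by rewrite /w ika linearZ /= psg.
  have isgn n (y : K) : i ((-1) ^+ n *: y) = (-1) ^+ n *: i y by rewrite linearZ.
  rewrite linearB linearN isgn [i (f _ *: _)]linearZ !shift_val.
  have dP : ext_diff (@tensor_cochain k A P f) (a :: t) (sg m) = 0.
    by rewrite tensor_diff df; exact: scale0r.
  have dM : ext_diff (@tensor_cochain k A M f) (a :: t) m = 0.
    by rewrite tensor_diff df; exact: scale0r.
  rewrite /ext_diff linearD linearD linearZ isgn linear_sum /= !iw.
  under eq_bigr do rewrite isgn iw scalerBr.
  rewrite sumrB.
  have {}dM : sg (a *: (f t *: m)) + \sum_(l < size t) (-1) ^+ l.+1 *: sg (f (contract l (a :: t)) *: m)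
     + (-1) ^+ (size t).+1 *: sg (f (belast a t) *: (last a t *: m)) = 0.
    transitivity (sg (ext_diff (@tensor_cochain k A M f) (a :: t) m)); last first.
      by rewrite dM klinear0.
    rewrite /ext_diff (klinearD _ _ sgl) (klinearD _ _ sgl) (klinear_sum _ _ sgl).
    rewrite (klinear_sign _ _ sgl); congr (_ + _ + _).
    by apply: eq_bigr => l _; rewrite (klinear_sign _ _ sgl).
  move: dP dM; rewrite /ext_diff /=.
  move: (\sum_(l < size t) _) (\sum_(l < size t) _) => S1 S2.
  rewrite !scalerBr.
  set x1 := a *: (f t *: sg m); set y1 := sg (a *: (f t *: m)).
  set x3 := _ *: (f (belast a t) *: (last a t *: sg m)).
  set y3 := _ *: sg (f (belast a t) *: (last a t *: m)).
  set z1 := a *: sg (f t *: m).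
  set z3 := _ *: (f (belast a t) *: sg (last a t *: m)).
  move=> /eqP; rewrite addr_eq0 => /eqP dP /eqP; rewrite addr_eq0 => /eqP dM.
  have -> : x1 - z1 + (S2 - S1) + (z3 - y3) = (x1 + S2) - S1 - z1 + z3 - y3.
    by rewrite !addrA [LHS](ACl (1*3*4*2*5*6))%AC.
  have -> : S1 = - y3 - y1 by rewrite -dM addrC addKr.
  rewrite dP !opprB !opprK !addrA.
  by rewrite [LHS](ACl ((3*6)*2*4*5*1))%AC /= subrr add0r.
have htd : sgn_cochain ht = if odd d then ht else - ht.
  apply: cochain_ext => s m.
  have -> : (if odd d then ht else - ht) s m = if odd d then ht s m else - ht s m by case: odd.
  rewrite /sgn_cochain; case: s => [|a t].
    by rewrite /ht yoneda_nil /tensor_cochain scaler0 oppr0 scaler0 if_same.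
  rewrite /ht yoneda_deg1r; last 2 first.
  - by move=> s; rewrite /tensor_cochain scaler0.
  - by move=> s u; exact: shift_degree.
  rewrite /tensor_cochain; have [td|td] := eqVneq (size (belast a t)) d; last first.
    by rewrite fd // scale0r scaler0 oppr0 if_same.
  rewrite -td size_belast /= exprS -signr_odd.
  by case: odd; rewrite ?expr0 ?expr1 ?mulr1 ?mulrN1 ?opprK ?scale1r ?scaleN1r.
case: (boolP (odd d)) htd => _ htd; [right | left].
  rewrite -ext_classN; apply: (ext_class_diff (ext_cochainN Cw)).
  by rewrite ext_diff_opp key htd opprB !opprK [RHS]addrC.
apply: (ext_class_diff (ext_cochainN Cw)).
by rewrite ext_diff_opp key htd opprB !opprK [RHS]addrC.
Qed.

End ShortExact.

End Shift.

(** * Hochschild cohomology *)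

Section HHGrading.
Variables (k : fieldType) (A : falgType k).

Definition hh_trunc (n : nat) (f : seq A -> A) : seq A -> A := fun s => if size s == n then f s else 0.

(** Hochschild cochains embed by [tensor_cochain] into cochains on [A^o], so their properties can be
    read off from those for modules. *)
Lemma tensor_trunc n f : @tensor_cochain k A A^o (hh_trunc n f) = trunc_cochain n (tensor_cochain f).
Proof.
apply: cochain_ext => s m; rewrite /tensor_cochain /hh_trunc /trunc_cochain.
by case: ifP => // _; rewrite scale0r.
Qed.

Lemma hh_trunc_diff n f : hh_diff (hh_trunc n f) = hh_trunc n.+1 (hh_diff f).
Proof. by apply: tensor_inj; rewrite -tensor_diff !tensor_trunc trunc_diff tensor_diff. Qed.

Lemma hh_trunc_cochain n f : hh_cochain f -> hh_cochain (hh_trunc n f).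
Proof.
move=> Cf; apply: hh_cochain_tensor; rewrite tensor_trunc.
by apply: trunc_is_cochain; exact: tensor_is_cochain.
Qed.

Lemma hh_trunc_is_cocycle (n : nat) (z : hh_cocycle A) : hh_trunc n z \in @hh_cocycle_pred k A.
Proof.
have /asboolP [Cz dz] := valP z; apply/asboolP; split; first exact: hh_trunc_cochain.
by rewrite hh_trunc_diff dz; apply/funext => s; rewrite /hh_trunc if_same.
Qed.

Definition hh_trunc_cocycle (n : nat) (z : hh_cocycle A) : hh_cocycle A := HHCocycle (hh_trunc_is_cocycle n z).
Definition hh_comp (n : nat) (x : HH A) : HH A := hh_class (hh_trunc_cocycle n (hh_repr x)).

Lemma hh_class_val (z w : hh_cocycle A) : val z = val w -> hh_class z = hh_class w.
Proof. by move=> e; congr hh_class; exact: val_inj. Qed.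

Lemma hh_compE n (z : hh_cocycle A) : hh_comp n (hh_class z) = hh_class (hh_trunc_cocycle n z).
Proof.
have /hh_classP/asboolP [g Cg e] : hh_class (hh_repr (hh_class z)) = hh_class z by exact: hh_reprK.
have valB (u w : hh_cocycle A) s : val (u - w) s = val u s - val w s by [].
have eE s : val (hh_repr (hh_class z)) s - val z s = hh_diff g s by rewrite -valB e.
apply/hh_classP/asboolP; case: n => [|n].
  exists 0; first exact: hh_cochain0.
  rewrite hh_diff_zero; apply/funext => -[|a s]; rewrite valB /= /hh_trunc /= ?subrr //.
  exact: (eE [::]).
exists (hh_trunc n g); first exact: hh_trunc_cochain.
rewrite hh_trunc_diff; apply/funext => s; rewrite valB /= /hh_trunc.
by case: ifP => _; [exact: eE | rewrite subrr].
Qed.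

Lemma hh_compD n x y : hh_comp n (x + y) = hh_comp n x + hh_comp n y.
Proof.
have [z ->] := hh_class_surj x; have [w ->] := hh_class_surj y.
rewrite -hh_classD !hh_compE -hh_classD; apply: hh_class_val; apply/funext => s.
by rewrite /= !fctE /hh_trunc /=; case: ifP => // _; rewrite addr0.
Qed.

Lemma hh_comp0 n : hh_comp n 0 = 0.
Proof. by apply: (@addrI _ (hh_comp n 0)); rewrite -hh_compD !addr0. Qed.

Lemma hh_comp_deg n x : HH_deg n (hh_comp n x).
Proof.
exists (hh_trunc_cocycle n (hh_repr x)) => // s /negbTE sn.
by rewrite /= /hh_trunc sn.
Qed.

Lemma hh_deg_comp n m x : HH_deg n x -> hh_comp m x = if m == n then x else 0.
Proof.
move=> [z -> zn]; rewrite hh_compE; case: eqP => [->|mn].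
  apply: hh_class_val; apply/funext => s; rewrite /= /hh_trunc.
  by case: eqP => // /eqP/zn ->.
have -> : (0 : HH A) = hh_class 0 by apply: (@addrI _ (hh_class 0)); rewrite -hh_classD !addr0.
apply: hh_class_val; apply/funext => s; rewrite /= /hh_trunc.
by case: eqP => // sm; rewrite zn // sm; apply/eqP.
Qed.

Lemma hh_comp_mul p q x y : hh_comp p (x * hh_comp q y) =
  if (q <= p)%N then hh_comp (p - q)%N x * hh_comp q y else 0.
Proof.
have [z ->] := hh_class_surj x; have [w ->] := hh_class_surj y.
rewrite (hh_compE q) (hh_compE (p - q)%N) !hh_classM (hh_compE p).
have z0 : (0 : HH A) = hh_class 0 by apply: (@addrI _ (hh_class 0)); rewrite -hh_classD !addr0.
rewrite z0 -[if _ then hh_class _ else _](fun_if (@hh_class k A)).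
apply: hh_class_val; apply: tensor_inj.
rewrite /= tensor_trunc tensor_cup tensor_trunc trunc_yoneda; last first.
  by move=> s; rewrite /tensor_cochain scaler0.
case: ifP => _ /=; first by rewrite tensor_cup !tensor_trunc.
by apply: cochain_ext => s m; rewrite /tensor_cochain scale0r.
Qed.

Lemma ext_comp_HH (M : lmodType A) n x : HH_to_Ext M (hh_comp n x) = ext_comp n (HH_to_Ext M x).
Proof.
have [z ->] := hh_class_surj x; rewrite hh_compE !HH_to_ExtE ext_compE.
apply: ext_class_val; apply: cochain_ext => s m; rewrite /= /tensor_cochain /hh_trunc /trunc_cochain.
by case: ifP => // _; rewrite scale0r.
Qed.

End HHGrading.

(** * The centre of an indecomposable algebra *)

Section LocalCenter.
Variables (k : closedFieldType) (A : falgType k).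

(** The powers of [c] up to the dimension of [A] are one too many to be independent. *)
Lemma killing_polynomial (c : A) : exists2 q : {poly k}, q != 0 & horner_alg c q = 0.
Proof.
pose n := \dim {:A}.
pose C : 'M[k]_(n.+1, n) := \matrix_(i, j) coord (vbasis {:A}) j (c ^+ i).
have : kermx C != 0 by rewrite kermx_eq0 /row_free neq_ltn ltnS rank_leq_col.
case/rowV0Pn => v /sub_kermxP vC v0.
exists (\poly_(i < n.+1) v 0 (inord i)).
  apply: contraNneq v0 => e; apply/eqP/rowP => i; rewrite mxE.
  by have := congr1 (fun p : {poly k} => p`_i) e; rewrite coef_poly ltn_ord coef0 inord_val.
rewrite poly_def rmorph_sum /=.
have -> : \sum_(i < n.+1) horner_alg c (v 0 (inord i) *: 'X^i) = \sum_(i < n.+1) v 0 i *: c ^+ i.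
  by apply: eq_bigr => i _; rewrite linearZ /= rmorphXn /= horner_algX inord_val mulr_algl.
apply: (can_inj (@GRing.addrK _ 0)); rewrite addr0 add0r.
rewrite (coord_vbasis (memvf (\sum_(i < n.+1) v 0 i *: c ^+ i))) big1 // => j _.
rewrite linear_sum /=.
have := congr1 (fun M : 'rV_n => M 0 j) vC; rewrite !mxE => h.
rewrite (_ : \sum_(i < n.+1) _ = 0) ?scale0r // -[RHS]h.
by apply: eq_bigr => i _; rewrite linearZ /= mxE.
Qed.

(** In a vanishing product of linear factors in [c], remove factors from the left until the rest is
    nonzero; that rest is the eigenvector. *)
Lemma eigenvalue_exists (c : A) : (forall a, c * a = a * c) ->
  exists (l : k) (x : A), x != 0 /\ (c - l%:A) * x = 0.
Proof.
move=> cc; have [q q0 qc] := killing_polynomial c.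
have [s qE] := closed_field_poly_normal q.
have : horner_alg c (\prod_(z <- s) ('X - z%:P)) = 0.
  move: qc; rewrite {1}qE linearZ /= mulr_algl => /eqP.
  by rewrite scaler_eq0 lead_coef_eq0 (negbTE q0) => /eqP.
elim: s {qE} => [|z s IH]; first by rewrite big_nil rmorph1 => /eqP; rewrite oner_eq0.
rewrite big_cons rmorphM rmorphB /= horner_algX horner_algC => e.
have [/IH //|n0] := eqVneq (horner_alg c (\prod_(z <- s) ('X - z%:P))) 0.
by exists z, (horner_alg c (\prod_(z <- s) ('X - z%:P))).
Qed.

(* Fitting's lemma for multiplication by [c - l]: its generalised kernel and image
   are complementary two-sided ideals. *)
Lemma center_local (c : A) : indecomposable_algebra A -> (forall a, c * a = a * c) ->
  exists (l : k) n, (c - l%:A) ^+ n = 0.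
Proof.
move=> ind cc; have [l [x [x0 lx]]] := eigenvalue_exists cc; exists l.
pose b := c - l%:A.
have bc a : b * a = a * b by rewrite /b mulrBl mulrBr cc mulr_algl mulr_algr.
have bcn n a : b ^+ n * a = a * b ^+ n by apply: esym; apply: commrX; rewrite /GRing.comm bc.
have fA : finitely_generated (A^o : lmodType A).
  by exists [:: 1 : A^o] => y; exists (fun=> y); rewrite big_ord1; exact/esym/mulr1.
have hl : linear (fun a : A^o => a * b : A^o) by move=> a u v; rewrite mulrDl -mulrA.
have [m [m0 him hker]] := fitting_stable (mklin hl) fA.
have itE j a : iter j (mklin hl) a = b ^+ j * a.
  by elim: j => [|j IH]; rewrite ?expr0 ?mul1r //= IH -bc exprS mulrA.
pose I := ({:A} * <[b ^+ m]>)%VS.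
pose J := lker (amulr (b ^+ m)).
have memJ a : (a \in J) = (a * b ^+ m == 0) by rewrite memv_ker lfunE.
have memI a : reflect (exists y, a = b ^+ m * y) (a \in I).
  apply: (iffP memv_cosetP) => [[y _ ->]|[y ->]]; exists y; rewrite ?bcn ?memvf //.
have tI : two_sided_ideal I.
  apply/andP; split; apply/prodvP => u v hu hv.
    by have /memI [y ->] := hv; apply/memI; exists (u * y); rewrite mulrA -bcn mulrA.
  by have /memI [y ->] := hu; apply/memI; exists (y * v); rewrite mulrA.
have tJ : two_sided_ideal J.
  apply/andP; split; apply/prodvP => u v hu hv; rewrite memJ.
    by move: hv; rewrite memJ -mulrA => /eqP ->; rewrite mulr0.
  by move: hu; rewrite memJ => /eqP hu; rewrite -mulrA -bcn mulrA hu mul0r.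
have IJ : (I + J = {:A})%VS.
  apply/eqP; rewrite eqEsubv subvf /=; apply/subvP => a _; have [y] := him a.
  rewrite !itE exprD -mulrA => e; rewrite -(subrK (b ^+ m * y) a) addrC.
  apply: memv_add; first by apply/memI; exists y.
  by rewrite memJ -bcn mulrBr e subrr.
have IJ0 : (I :&: J = 0)%VS.
  apply/eqP; rewrite -subv0; apply/subvP => a; rewrite memv_cap memJ => /andP[/memI [y ->]].
  rewrite -bcn mulrA -exprD => /eqP e; rewrite memv0; apply/eqP.
  by have := hker y; rewrite !itE; apply.
case: (ind I J tI tJ IJ IJ0) => [I0|J0].
  by exists m; apply/eqP; rewrite -memv0 -I0; apply/memI; exists 1; rewrite mulr1.
case/eqP: x0; apply/eqP; rewrite -memv0 -J0 memJ -bcn.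
case: m m0 {him hker itE I J memJ memI tI tJ IJ IJ0 J0} => // m _.
by rewrite exprSr -mulrA lx mulr0.
Qed.

Lemma hh0_is_cocycle (c : A) : (forall a, c * a = a * c) ->
  (fun s : seq A => if s is [::] then c else 0) \in @hh_cocycle_pred k A.
Proof.
move=> cc; apply/asboolP; split.
  by split=> [[|? ?] *|]; rewrite ?scaler0 ?addr0 //; exists 1%N => -[].
apply/funext => -[//|a [|b t]].
  by rewrite /hh_diff /= big_ord0 addr0 expr1 mulN1r cc subrr.
rewrite /hh_diff /= mul0r !mulr0 addr0 big1 ?add0r // => i _.
by rewrite /contract; case: i => -[|i] //= _; rewrite mulr0.
Qed.

Definition hh0 (c : A) (cc : forall a, c * a = a * c) : hh_cocycle A := HHCocycle (hh0_is_cocycle cc).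

(** A cocycle of degree 0 is a central element, to which [center_local] applies. *)
Lemma HH0_local (x : HH A) : indecomposable_algebra A -> HH_deg 0%N x ->
  exists (l : k) n, (x - l *: 1) ^+ n = 0.
Proof.
move=> ind [z -> zs]; have /asboolP [_ dz] := valP z.
have cc a : z [::] * a = a * z [::].
  have := congr1 (fun f => f [:: a]) dz; rewrite /hh_diff /= big_ord0 addr0 expr1 mulN1r => /eqP.
  by rewrite subr_eq0 => /eqP ->.
have [l [n hn]] := center_local ind cc; exists l, n.
pose b := z [::] - l%:A.
have bc a : b * a = a * b by rewrite /b mulrBl mulrBr cc mulr_algl mulr_algr.
have -> : hh_class z - l *: 1 = hh_class (hh0 bc).
  rewrite -[1]/(hh_class (hh_one A)) -hh_classZ -scaleN1r -hh_classZ -hh_classD.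
  apply: hh_class_val; apply/funext => -[|a s]; rewrite /= !fctE /=.
    by rewrite scaleN1r.
  by rewrite zs // scaler0 scaler0 addr0.
have bcn j a : b ^+ j * a = a * b ^+ j by apply: esym; apply: commrX; rewrite /GRing.comm bc.
have pw j : hh_class (hh0 bc) ^+ j = hh_class (hh0 (bcn j)).
  elim: j => [|j IH].
    rewrite expr0; apply: hh_class_val; apply/funext => -[|a s]; by rewrite /= ?expr0.
  rewrite exprS IH hh_classM; apply: hh_class_val; apply/funext => -[|a s].
    by rewrite /= cup_nil exprS.
  rewrite /= cup_cons mulr0 add0r /cup_cochain big1 // => i _.
  by rewrite /sft mul0r.
rewrite pw; have -> : (0 : HH A) = hh_class 0 by apply: (@addrI _ (hh_class 0)); rewrite -hh_classD !addr0.
by apply: hh_class_val; apply/funext => -[|a s]; rewrite /= -/b ?hn.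
Qed.

End LocalCenter.

(** * Finite generation of Ext *)

Section ExtModule.
Variables (k : fieldType) (A : falgType k) (H : comAlgType k) (iota : {lrmorphism H -> HH A}).
Variables (M N : lmodType A).

(** The phantom argument records [iota], on which the [H]-module structure depends. *)
Definition ext_module of {lrmorphism H -> HH A} : Type := Ext M N.
Local Notation E := (ext_module iota).

HB.instance Definition _ := GRing.Zmodule.copy E (Ext M N).

Definition ext_scale (h : H) (x : E) : E := HH_act (x : Ext M N) (iota h).

(** The product is taken on the right; commutativity of [H] turns it into a left action. *)
Lemma ext_scaleA a b x : ext_scale a (ext_scale b x) = ext_scale (a * b) x.
Proof. by rewrite /ext_scale /HH_act mulrC rmorphM HH_to_ExtM yonedaAE. Qed.

Lemma ext_scale1 : left_id 1 ext_scale.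
Proof. by move=> x; rewrite /ext_scale /HH_act rmorph1 HH_to_Ext1 yoneda_id. Qed.

Lemma ext_scaleDr : right_distributive ext_scale +%R.
Proof. by move=> a x y; exact: yonedaDlE. Qed.

Lemma ext_scaleDl x : {morph ext_scale^~ x : a b / a + b}.
Proof. by move=> a b; rewrite /ext_scale /HH_act rmorphD HH_to_ExtD yonedaDrE. Qed.

HB.instance Definition _ := GRing.Zmodule_isLmodule.Build H E
  ext_scaleA ext_scale1 ext_scaleDr ext_scaleDl.
End ExtModule.

Section ExtFinite.
Variables (k : fieldType) (A : falgType k) (H : comAlgType k) (iota : {lrmorphism H -> HH A}).
Hypothesis noeth : noetherian H.
Implicit Types L M N X Y P S : lmodType A.

Local Notation EM M N := (ext_module M N iota : lmodType H).

Lemma ext_pullback_linear L M N (j : {linear L -> M}) :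
  linear (fun e : EM M N => yoneda (e : Ext M N) (hom_class j) : EM L N).
Proof.
move=> h x y; rewrite -[RHS]/(ext_scale h (_ : EM L N) + _) /ext_scale HH_act_hom.
exact: yonedaDlE.
Qed.

Definition ext_pullback L M N (j : {linear L -> M}) : {linear EM M N -> EM L N} :=
  mklin (@ext_pullback_linear L M N j).

Lemma ext_retract_fg S T N : retract S T -> finitely_generated (EM T N) ->
  finitely_generated (EM S N).
Proof.
move=> [i [r ri]]; apply: (fg_surjective (p := ext_pullback N i)) => x.
exists (ext_pullback N r x); rewrite /= yonedaAE hom_class_comp.
by rewrite (hom_class_ext (v := idfun)) ?yoneda_id.
Qed.

(** Let [v] bound the restriction of [x] to [L]. Subtracting the coboundary of [v] transported along
    [ka] leaves a cocycle pulled back from [S]: it is [z] on the section, corrected by the signed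
    product of [v] with the extension cocycle. *)
Lemma ext_exact_middle L M S N (i : {linear L -> M}) (p : {linear M -> S}) (x : EM M N) :
  finitely_generated S -> injective i -> surjective p -> exact_at i p ->
  ext_pullback N i x = 0 -> exists y, x = ext_pullback N p y.
Proof.
move=> fS ii sp ex.
have [sg [ka [sgl kal psg ika kai]]] := klinear_section fS sp ii ex.
have [z ->] := ext_class_surj x; rewrite /= yonedaE => /ext_class_eq0 [v Cv ev].
have Cvk : ext_cochain (fun s m => v s (ka m)) by exact: comp_cochain Cv kal.
have zi s y : z s (i y) = ext_diff v s y.
  rewrite -ev /= yoneda_homr // => s'; exact: cocycle_zero.
pose th := shift_cochain sg ka.
have Cth : ext_cochain th := shift_is_cochain sgl kal.
have th1 s m : size s != 1%N -> th s m = 0 := @shift_degree _ _ _ _ _ sg ka s m.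
have thE a m : i (th [:: a] m) = a *: sg m - sg (a *: m) := shift_val psg ika a m.
pose vt := yoneda_cochain v th.
have v0 s : v s 0 = 0 := ext_cochain_g0 s Cv.
have z0 s : z s 0 = 0 := cocycle_zero z s.
have zB := cocycle_additive z.
pose g : seq A -> S -> N := (fun s m => z s (sg m)) - sgn_cochain vt.
have gE s m : g s m = z s (sg m) - (-1) ^+ size s *: vt s m by [].
have Czs : ext_cochain (fun s m => z s (sg m)).
  exact: comp_cochain (cocycle_cochain z) sgl.
have Cg : ext_cochain g.
  by apply: ext_cochainB => //; apply: sgn_is_cochain; exact: yoneda_is_cochain.
have dg : ext_diff g = 0.
  rewrite /g ext_diffB ext_diff_sgnE opprK; apply: cochain_ext => s m.
  have -> : (ext_diff (fun s m => z s (sg m)) + sgn_cochain (ext_diff vt)) s m =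
    ext_diff (fun s m => z s (sg m)) s m + (-1) ^+ size s *: ext_diff vt s m by [].
  rewrite /vt leibniz; last exact: ext_cochain_add.
  have -> : yoneda_cochain (sgn_cochain v) (ext_diff th) s m = 0.
    rewrite /th (shift_diff psg ika kai) /yoneda_cochain big1 // => l _.
    by rewrite /sgn_cochain v0 scaler0.
  rewrite addr0.
  case: s => [|a t]; first by rewrite ext_diff0 yoneda_nil ext_diff0 scaler0 addr0.
  rewrite yoneda_deg1r; last 2 first.
  - by move=> s; rewrite -zi linear0 z0.
  - by move=> s u; exact: th1.
  rewrite -zi thE zB scalerBr.
  have := congr1 (fun f => f (a :: t) (sg m)) (cocycle_diff z).
  rewrite /ext_diff => /eqP; rewrite addr_eq0 => /eqP ->.
  by rewrite (addrC (- _)) addrA subrK subrr.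
exists (ext_class (cocycle Cg dg)); rewrite /= yonedaE.
apply: (ext_class_diff Cvk); apply: cochain_ext => s m.
have subE (u w : seq A -> M -> N) : (u - w) s m = u s m - w s m by [].
rewrite subE /= yoneda_homr; last by move=> s'; exact: ext_cochain_g0 Cg.
have zk : z s m - z s (sg (p m)) = ext_diff v s (ka m) by rewrite -zB -ika zi.
rewrite gE opprB addrCA -[val z s m]/(z s m) zk /vt.
case: s zk {subE} => [|a t] zk; first by rewrite !ext_diff0 yoneda_nil th1 // v0 scaler0 addr0.
rewrite yoneda_deg1r //.
have -> : th [:: last a t] (p m) = ka (last a t *: m) - last a t *: ka m.
  apply: ii; rewrite thE linearB linearZ /= !ika linearZ /= scalerBr opprB.
  by rewrite !addrA [RHS](ACl (3*2*(1*4)))%AC /= subrr addr0.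
rewrite /ext_diff (ext_cochain_add Cv) scalerBr !addrA.
by rewrite [LHS](ACl (3*4*1*(5*2)))%AC /= subrr addr0.
Qed.

(** The image in [EM L N] is finitely generated because [H] is Noetherian; lifts of its generators
    together with the image of [EM S N] generate. *)
Lemma ext_extension_fg L M S N (i : {linear L -> M}) (p : {linear M -> S}) :
  finitely_generated S -> injective i -> surjective p -> exact_at i p ->
  finitely_generated (EM L N) -> finitely_generated (EM S N) -> finitely_generated (EM M N).
Proof.
move=> fS ii sp ex fL fES.
have [bL hL] := fg_idspan fL; have [bS hS] := fg_idspan fES.
have [g gP gspan] := noetherian_submodule noeth (range_submodule (ext_pullback N i)) (fun e _ => hL e).
have hw (r : EM L N) : exists e : EM M N, r \in g -> ext_pullback N i e = r.
  case: (pselect (r \in g)) => [/gP [e he]|n]; last by exists 0.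
  by exists e.
have [w wP] := choice hw.
apply: (idspan_fg (b := [seq w r | r <- g] ++ [seq ext_pullback N p e | e <- bS])) => x.
have /(fspanP idfun) [c ce] : idspan g (ext_pullback N i x) by apply: gspan; exists x.
pose x1 := \sum_(j < size g) c j *: w g`_j.
have [y ye] : exists y, x - x1 = ext_pullback N p y.
  apply: ext_exact_middle fS ii sp ex _; rewrite linearB ce linear_sum.
  apply/eqP; rewrite subr_eq0; apply/eqP; apply: eq_bigr => j _.
  by rewrite linearZ wP // mem_nth.
rewrite -(subrK x1 x) ye; apply: fspanD.
  apply: fspan_catr; have /(fspanP idfun) [d ->] := hS y.
  rewrite linear_sum; apply: fspan_sum => j _; rewrite linearZ.
  apply: (fspanZ (f := idfun)); apply: fspan_mem; apply: map_f.
  by rewrite mem_nth.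
apply: fspan_catl; apply: fspan_sum => j _; apply: (fspanZ (f := idfun)).
by apply: fspan_mem; apply: map_f; rewrite mem_nth.
Qed.

(** Induction on the dimension of [M]: a simple quotient is a retract of [A / r], and the kernel is
    smaller. *)
Lemma ext_fg M N : finitely_generated (EM (mod_radical A) N) ->
  finitely_generated M -> finitely_generated (EM M N).
Proof.
move=> ftop; have [n] := ubnP (kdim M); elim: n M => // n IH M Mn fM.
case: (pselect (exists m : M, m <> 0)) => [[m0 m0n]|Mz]; last first.
  have M0 m : m = 0 :> M by apply: contrapT => mn; apply: Mz; exists m.
  exists [::] => x; exists (fun=> 0); rewrite big_ord0.
  have [z ->] := ext_class_surj x; rewrite -[RHS](ext_class0 M N); apply: ext_class_val.
  by apply: cochain_ext => s m; rewrite (M0 m); exact: cocycle_zero.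
have h0 : submodule ([set 0] : set M) by split=> // a x y -> ->; rewrite scaler0 addr0.
have [|S [pi [sS spi _]]] := simple_quotient fM h0; first by exists m0.
have [K [i [ii ex]]] := exact_kernel pi.
have fS := fg_surjective spi fM; have fK := fg_sub fM ii.
have ES : finitely_generated (EM S N) := ext_retract_fg (simple_retract sS) ftop.
apply: (ext_extension_fg fS ii spi ex) ES; apply: IH => //.
have [le eq] := kdim_injective fK fM ii.
rewrite -ltnS; apply: leq_trans (Mn : (kdim M < n.+1)%N); rewrite ltnS ltn_neqAle le andbT.
apply/eqP => e; have si := eq e.
have [[s s0] _] := sS; have [m hm] := spi s; have [x hx] := si m.
by apply: s0; rewrite -hm; apply/ex; exists x.
Qed.

End ExtFinite.

Section SubalgebraGrading.
Variables (k : closedFieldType) (A : falgType k) (H : comAlgType k) (iota : {lrmorphism H -> HH A}).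
Hypothesis gr : graded_subalgebra iota.

Lemma subalgebra_comp_exists : exists pH : nat -> H -> H,
  forall n h, iota (pH n h) = hh_comp n (iota h).
Proof.
suff ex (nh : nat * H) : exists g, iota g = hh_comp nh.1 (iota nh.2).
  by have [f hf] := choice ex; exists (fun n h => f (n, h)) => n h; exact: (hf (n, h)).
case: nh => n h /=; have [_ /(_ h) [N [c [-> cd]]]] := gr.
exists (\sum_(i < N | n == i) c i); rewrite !rmorph_sum.
rewrite (big_morph _ (hh_compD n) (hh_comp0 A n)) big_mkcond /=.
by apply: eq_bigr => i _; rewrite (hh_deg_comp n (cd i)); case: ifP.
Qed.

Variable pH : nat -> H -> H.
Hypothesis pHE : forall n h, iota (pH n h) = hh_comp n (iota h).

Lemma iota_inj : injective iota. Proof. by case: gr. Qed.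

Lemma subalgebra_graded : graded pH (pH : nat -> H^o -> H^o).
Proof.
split.
- move=> n x y; apply: iota_inj; rewrite pHE !rmorphD hh_compD; congr (_ + _); exact/esym/pHE.
- move=> x; have [_ /(_ x) [N [c [xE cd]]]] := gr; exists N.
  rewrite {1}xE; apply: eq_bigr => i _; apply: iota_inj; rewrite pHE xE rmorph_sum.
  rewrite (big_morph _ (hh_compD i) (hh_comp0 A i)) (bigD1 i) //= (hh_deg_comp i (cd i)) eqxx.
  rewrite big1 ?addr0 // => j ji; rewrite (hh_deg_comp i (cd j)).
  by rewrite (inj_eq val_inj) eq_sym (negbTE ji).
- move=> m n x; apply: iota_inj; rewrite pHE pHE (hh_deg_comp m (hh_comp_deg n _)).
  by case: ifP => _; rewrite ?rmorph0 ?pHE.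
- move=> d n h x.
  have -> : pH n (pH d h *: (x : H^o)) = pH n (x * pH d h) by rewrite mulrC.
  apply: iota_inj; rewrite pHE rmorphM.
  have -> : iota x * iota (pH d h) = iota x * hh_comp d (iota h).
    by congr (_ * _); exact: pHE.
  rewrite hh_comp_mul; case: ifP => _; last by rewrite rmorph0.
  have -> : pH d h *: (pH (n - d)%N x : H^o) = pH (n - d)%N x * pH d h by rewrite mulrC.
  by rewrite rmorphM; congr (_ * _); apply: esym; exact: pHE.
Qed.

Lemma subalgebra_scalar (c : k) : pH 0%N c%:A = c%:A.
Proof.
apply: iota_inj; rewrite pHE linearZ /= rmorph1.
have d0 : HH_deg 0%N (c *: 1 : HH A).
  exists (c *: hh_one A); first by rewrite hh_classZ.
  by move=> [|a s] //= _; rewrite !fctE /= scaler0.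
by rewrite (hh_deg_comp 0%N d0).
Qed.

Lemma subalgebra_local h : indecomposable_algebra A -> pH 0%N h = h ->
  exists (c : k) n, (h - c%:A) ^+ n = 0.
Proof.
move=> ind h0; have d0 : HH_deg 0%N (iota h) by rewrite -h0 pHE; exact: hh_comp_deg.
have [l [n e]] := HH0_local ind d0; exists l, n; apply: iota_inj.
by rewrite rmorphXn rmorphB /= linearZ /= rmorph1 e rmorph0.
Qed.

Lemma ext_module_graded (M N : lmodType A) :
  graded pH ((fun n => @ext_comp k A M N n) : nat -> ext_module M N iota -> ext_module M N iota).
Proof.
split.
- by move=> n x y; exact: ext_compD.
- by move=> x; exact: ext_comp_sum.
- by move=> m n x; exact: ext_comp_comp.
- move=> d n h x; rewrite -[pH d h *: x]/(HH_act (x : Ext M N) (iota (pH d h))) /HH_act pHE ext_comp_HH ext_comp_yoneda.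
  case: ifP => // _; rewrite -[RHS]/(HH_act (ext_comp (n - d)%N (x : Ext M N)) (iota (pH d h))).
  by rewrite /HH_act pHE ext_comp_HH.
Qed.

End SubalgebraGrading.

(** * Minimal resolutions *)

Section Resolutions.
Variables (k : fieldType) (A : falgType k).
Implicit Types M N P X Y : lmodType A.

(** With [M] in position 0, every stage of a resolution is a cover of [syz M K n], without a special
    case at the start. *)
Definition syz M (K : nat -> lmodType A) (n : nat) : lmodType A := if n is n'.+1 then K n' else M.

Record resolution M (Q K : nat -> lmodType A) := Resolution {
  res_p : forall n, {linear Q n -> syz M K n};
  res_i : forall n, {linear K n -> Q n};
  res_cover : forall n, projective_cover (res_p n);
  res_inj : forall n, injective (res_i n);
  res_exact : forall n, exact_at (res_i n) (res_p n);
  res_fg : forall n, finitely_generated (Q n) }.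

Lemma syz_fg M Q K (r : resolution M Q K) n : finitely_generated (syz M K n).
Proof. by have [_ sp _] := res_cover r n; apply: fg_surjective sp (res_fg r n). Qed.

Record cover_step X := CoverStep {
  step_Q : lmodType A; step_K : lmodType A;
  step_p : {linear step_Q -> X}; step_i : {linear step_K -> step_Q};
  step_cover : projective_cover step_p; step_inj : injective step_i;
  step_exact : exact_at step_i step_p; step_fg : finitely_generated step_Q }.

Lemma cover_step_exists X : finitely_generated X -> exists s : cover_step X, True.
Proof.
move=> fX; have [P [p [cp fP]]] := projective_cover_exists fX.
have [K [i [ii ex]]] := exact_kernel p.
by exists (CoverStep cp ii ex fP).
Qed.

(** The first stage is prescribed so that [split_resolution] can start with a kernel shared by [M]
    and its nonprojective part. *)
Lemma resolution_exists M (Q0 K0 : lmodType A) (p0 : {linear Q0 -> M}) (i0 : {linear K0 -> Q0}) :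
  projective_cover p0 -> injective i0 -> exact_at i0 p0 -> finitely_generated Q0 ->
  exists (Q K : nat -> lmodType A) (r : resolution M Q K), K 0%N = K0.
Proof.
move=> cp ii ex fQ.
pose S := {X : lmodType A | finitely_generated X}.
pose F (X : S) : cover_step (sval X) := sval (cid (cover_step_exists (svalP X))).
have fK (X : S) : finitely_generated (step_K (F X)) := fg_sub (step_fg (F X)) (@step_inj _ (F X)).
(* Finite generation travels with the module, since the choice of the next cover depends on it. *)
pose Y := fix Y n : S := if n is n'.+1 then exist _ _ (fK (Y n')) else exist _ K0 (fg_sub fQ ii).
pose K n := sval (Y n).
pose Q n := if n is n'.+1 then step_Q (F (Y n')) else Q0.
pose p n : {linear Q n -> syz M K n} :=
  match n return {linear Q n -> syz M K n} with
  | 0 => p0 | n'.+1 => step_p (F (Y n')) end.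
pose i n : {linear K n -> Q n} :=
  match n return {linear K n -> Q n} with
  | 0 => i0 | n'.+1 => step_i (F (Y n')) end.
have h1 n : projective_cover (p n) by case: n => [//|n]; exact: step_cover.
have h2 n : injective (i n) by case: n => [//|n]; exact: step_inj.
have h3 n : exact_at (i n) (p n) by case: n => [//|n]; exact: step_exact.
have h4 n : finitely_generated (Q n) by case: n => [//|n]; exact: step_fg.
by exists Q, K, (Resolution h1 h2 h3 h4).
Qed.

Lemma resolution_minimal M Q K (r : resolution M Q K) :
  minimal_projective_resolution (res_p r 0%N : {linear Q 0%N -> M})
    (fun n => res_i r n \o (res_p r n.+1 : {linear Q n.+1 -> K n}) : {linear Q n.+1 -> Q n}).
Proof.
have sp n : surjective (res_p r n) by case: (res_cover r n).
have ex n y : (res_i r n \o res_p r n.+1) y = 0 <-> res_p r n.+1 y = 0.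
  split=> [/= e|/= ->]; last by rewrite linear0.
  by apply: (@res_inj _ _ _ r n); rewrite e linear0.
have exD n y : (exists x, res_i r n x = y) <-> exists x, (res_i r n \o res_p r n.+1) x = y.
  split=> [[x <-]|[x <-]]; last by exists (res_p r n.+1 x).
  by have [z hz] := sp n.+1 x; exists z; rewrite -hz.
split.
- by move=> n; split; [exact: (res_fg r) | case: (res_cover r n)].
- exact: sp.
- by move=> y; rewrite -exD; exact: (@res_exact _ _ _ r 0%N y).
- by move=> n y; rewrite -exD ex; exact: (@res_exact _ _ _ r n.+1 y).
split=> [|n]; first by case: (res_cover r 0%N).
have [_ _ small] := res_cover r n.+1.
move=> U hU hk; apply: small => // q; have [u Uu /ex e] := hk q.
by exists u.
Qed.

(** The covers of the kernels are the differentials with restricted codomain, which changes neither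
    their kernels nor superfluity. *)
Lemma minimal_resolution M (Q : nat -> lmodType A) (e : {linear Q 0%N -> M})
    (d : forall n, {linear Q n.+1 -> Q n}) :
  minimal_projective_resolution e d -> exists K, exists r : resolution M Q K, True.
Proof.
move=> [hQ se ex0 exn [sme smd]].
pose D n : {linear Q n -> syz M Q n} :=
  match n return {linear Q n -> syz M Q n} with 0 => e | n'.+1 => d n' end.
have hker n : exists K : lmodType A, exists i : {linear K -> Q n}, injective i /\ exact_at i (D n).
  exact: exact_kernel.
pose K n := sval (cid (hker n)).
pose i n : {linear K n -> Q n} := sval (cid (svalP (cid (hker n)))).
have ii n : injective (i n) := proj1 (svalP (cid (svalP (cid (hker n))))).
have iex n : exact_at (i n) (D n) := proj2 (svalP (cid (svalP (cid (hker n))))).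
have Dex n : exact_at (d n) (D n) by case: n => [|n]; [exact: ex0 | exact: exn].
have hp n : exists p : {linear Q n.+1 -> K n}, forall x, i n (p x) = d n x.
  apply: (lin_choice (G := fun x y => i n y = d n x)).
  - by move=> x; apply/iex/Dex; exists x.
  - by move=> a x y x' y' e1 e2; rewrite !linearP e1 e2.
  - by move=> y; rewrite linear0 => e0; apply: ii; rewrite e0 linear0.
pose p n : {linear Q n -> syz M K n} :=
  match n return {linear Q n -> syz M K n} with
  | 0 => e | n'.+1 => sval (cid (hp n')) end.
have pE n x : i n (p n.+1 x) = d n x := svalP (cid (hp n)) x.
have p0 n x : p n.+1 x = 0 <-> d n x = 0.
  by rewrite -pE; split=> [->|e0]; [rewrite linear0 | apply: ii; rewrite e0 linear0].
exists K.
have cov n : projective_cover (p n).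
  case: n => [|n]; first by split=> //; case: (hQ 0%N).
  split; first by case: (hQ n.+1).
    move=> y; have /Dex [x hx] : D n (i n y) = 0 by apply/iex; exists y.
    by exists x; apply: ii; rewrite pE.
  move=> U hU hk; apply: (smd n) => // q; have [u Uu /p0 e0] := hk q.
  by exists u.
have pex n : exact_at (i n) (p n).
  case: n => [|n] y; first exact: (iex 0%N y).
  by rewrite p0; exact: (iex n.+1 y).
by exists (Resolution cov ii pex (fun n => proj1 (hQ n))).
Qed.

End Resolutions.

(** * Iterated connecting classes *)

Section Connecting.
Variables (k : fieldType) (A : falgType k).
Implicit Types M N P X Y : lmodType A.

(** Abstracts from the chosen splitting: only these four properties of the extension class are used
    below. *)
Definition is_shift P M (K : lmodType A) (p : {linear P -> M}) (i : {linear K -> P}) (th : Ext M K) : Prop :=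
  [/\ ext_comp 1%N th = th,
      forall (N : lmodType A) (z : ext_cocycle M N), (forall m, z [::] m = 0) ->
        exists y : Ext K N, ext_class z = yoneda y th,
      forall (N : lmodType A) (y : Ext K N), yoneda y th = 0 ->
        exists z : Ext P N, y = yoneda z (hom_class i)
    & forall d (x : HH A), HH_deg d x ->
        yoneda th (HH_to_Ext M x) = yoneda (HH_to_Ext K x) th \/
        yoneda th (HH_to_Ext M x) = - yoneda (HH_to_Ext K x) th].

Lemma shift_exists P M (K : lmodType A) (p : {linear P -> M}) (i : {linear K -> P}) :
  projective P -> finitely_generated P -> surjective p -> injective i -> exact_at i p ->
  exists th, is_shift p i th.
Proof.
move=> pP fP sp ii ex.
have [sg [ka [sgl kal psg ika kai]]] := klinear_section (fg_surjective sp fP) sp ii ex.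
exists (shift_class sgl kal psg ika kai); split.
- exact: shift_comp.
- by move=> N z; exact: shift_surjective.
- by move=> N y; exact: shift_injective.
- by move=> d x; exact: shift_HH_comm.
Qed.

Lemma ext_comp_projective P N n (x : Ext P N) : projective P -> finitely_generated P ->
  ext_comp n.+1 x = 0.
Proof.
move=> pP fP; have [z ->] := ext_class_surj x; rewrite ext_compE.
have [|w Cw e] := @projective_coboundary k A P N (trunc_cocycle n.+1 z) pP fP; first by [].
exact: ext_class_bound Cw e.
Qed.

Lemma hom_class0 M N (u : {linear M -> N}) : hom_class u = 0 -> forall m, u m = 0.
Proof.
have zl : linear ((fun=> 0) : M -> N) by move=> a x y; rewrite scaler0 addr0.
have -> : 0 = hom_class (mklin zl).
  rewrite -(ext_class0 M N); apply: ext_class_val; apply: cochain_ext => -[|a s] m //.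
by move/hom_class_inj => e m; rewrite e.
Qed.

Lemma hom_class_zero M N (u : {linear M -> N}) : (forall m, u m = 0) -> hom_class u = 0.
Proof.
move=> u0; rewrite -(ext_class0 M N); apply: ext_class_val; apply: cochain_ext => -[|a s] m //.
exact: u0.
Qed.

Lemma ext_comp_homr (L : lmodType A) M N n (e : Ext M N) (u : {linear L -> M}) :
  ext_comp n (yoneda e (hom_class u)) = yoneda (ext_comp n e) (hom_class u).
Proof. by rewrite -(ext_comp_hom u) ext_comp_yoneda leq0n subn0. Qed.

Variables (M : lmodType A) (Q K : nat -> lmodType A) (r : resolution M Q K).
Variable th : forall n, Ext (syz M K n) (K n).
Hypothesis thP : forall n, is_shift (res_p r n) (res_i r n) (th n).

(** The iterated extension class in [Ext^n] from [M] to its [n]-th syzygy; multiplication by it is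
    dimension shifting. *)
Fixpoint conn n : Ext M (syz M K n) :=
  match n return Ext M (syz M K n) with
  | 0 => hom_class (@idfun M)
  | n'.+1 => yoneda (th n') (conn n')
  end.

Lemma th_yoneda N n j (e : Ext (K n) N) :
  ext_comp j.+1 (yoneda e (th n)) = yoneda (ext_comp j e) (th n).
Proof. by have [h _ _ _] := thP n; rewrite -h ext_comp_yoneda subn1. Qed.

Lemma conn_surjective N n j (e : Ext M N) : ext_comp (j + n)%N e = e ->
  exists2 e' : Ext (syz M K n) N, ext_comp j e' = e' & e = yoneda e' (conn n).
Proof.
elim: n j => [|n IH] j; first by rewrite addn0 => ej; exists e; rewrite // yoneda_id.
rewrite addnS -addSn => /IH [e1 e1j ->].
have [y hy] : exists y : Ext (K n) N, e1 = yoneda y (th n).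
  have [_ h _ _] := thP n; have [z e1z] := ext_class_surj e1.
  by rewrite -e1j e1z ext_compE; apply: h.
exists (ext_comp j y); first by rewrite ext_comp_comp eqxx.
by rewrite -e1j hy th_yoneda -yonedaAE.
Qed.

(** The kernel of each shift comes from [Ext] out of a projective, which vanishes in positive
    degrees. *)
Lemma conn_injective N n j (e : Ext (syz M K n) N) : ext_comp j.+1 e = e ->
  yoneda e (conn n) = 0 -> e = 0.
Proof.
elim: n j e => [|n IH] j e ej; first by rewrite /= yoneda_id.
rewrite /= -yonedaAE => /(IH j.+1) h0.
have e0 : yoneda (e : Ext (K n) N) (th n) = 0.
  by apply: h0; rewrite th_yoneda (ej : ext_comp j.+1 (e : Ext (K n) N) = e).
have [_ _ h _] := thP n; have [z ez] := h _ _ e0.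
have [pQ _ _] := res_cover r n.
by rewrite -ej ez (@ext_comp_homr (K n)) ext_comp_projective ?yoneda0l //; exact: (res_fg r).
Qed.

(** In degree 0 the kernel consists of maps that extend to the cover. Minimality enters here: maps
    from the cover to [A / r] vanish on the syzygy. *)
Lemma conn_hom_injective n (u : {linear syz M K n -> mod_radical A}) :
  yoneda (hom_class u) (conn n) = 0 -> forall m, u m = 0.
Proof.
case: n u => [|n] u; first by rewrite /= yoneda_id; exact: hom_class0.
rewrite /= -yonedaAE => /(conn_injective (j := 0%N)) h0.
have e0 : yoneda (hom_class u : Ext (K n) (mod_radical A)) (th n) = 0.
  by apply: h0; rewrite th_yoneda (ext_comp_hom (u : {linear K n -> mod_radical A})).
have [_ _ h _] := thP n; have [z uz] := h _ _ e0.
have [v hv] : exists v, ext_comp 0%N z = hom_class v.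
  by apply: ext_comp0_hom; rewrite ext_comp_comp.
have uv : hom_class (u : {linear K n -> mod_radical A}) = hom_class (v \o res_i r n).
  by rewrite -hom_class_comp -hv -ext_comp_homr -uz ext_comp_hom.
move=> m; rewrite (hom_class_inj uv m) /=.
have [_ _ small] := res_cover r n.
by apply: (hom_top_kernel v small); apply/(res_exact r); exists m.
Qed.

Lemma conn_HH d (x : HH A) n : HH_deg d x ->
  yoneda (conn n) (HH_to_Ext M x) = yoneda (HH_to_Ext (syz M K n) x) (conn n) \/
  yoneda (conn n) (HH_to_Ext M x) = - yoneda (HH_to_Ext (syz M K n) x) (conn n).
Proof.
move=> xd; elim: n => [|n IH]; first by left; rewrite /= HH_to_Ext_natural.
have [_ _ _ h] := thP n; have hn := h d x xd.
rewrite /= yonedaAE -[yoneda (HH_to_Ext (K n) x) (yoneda _ _)]yonedaAE.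
case: IH => ->; case: hn => hn.
- by left; rewrite -yonedaAE hn.
- by right; rewrite -yonedaAE hn yonedaNlE.
- by right; rewrite yonedaNrE -yonedaAE hn.
- by left; rewrite yonedaNrE -yonedaAE hn yonedaNlE opprK.
Qed.

End Connecting.

(** * Periodicity *)

Section HomSpan.
Variables (k : fieldType) (A : falgType k).
Implicit Types M N X Y : lmodType A.

(** In coordinates, homomorphisms form a subspace of the matrices, and [subspace_rows] provides a
    spanning family. *)
Lemma hom_span X Y : finitely_generated X -> finitely_generated Y ->
  exists us : nat -> {linear X -> Y}, forall u : {linear X -> Y},
    exists c : nat -> k, forall x, u x = \sum_(i < kdim X * kdim Y) (c i)%:A *: us i x.
Proof.
move=> /kdimP [f [g [fK gK fl]]] /kdimP [f' [g' [fK' gK' fl']]].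
set n := kdim X; set m := kdim Y.
have gl' := kcoord_klinear fK' gK' fl'.
pose W : set 'rV[k]_(n * m) := [set v | exists u : {linear X -> Y}, forall x, f' (u x) = f x *m vec_mx v].
have f0 : f' 0 = 0.
  by apply: (can_inj gK'); rewrite fK' (kcoord_zero gl').
have zl : linear ((fun=> 0) : X -> Y) by move=> a x y; rewrite scaler0 addr0.
have [||B hB] := @subspace_rows k (n * m) W.
- by exists (mklin zl) => x /=; rewrite linear0 mulmx0.
- move=> c v w [u hu] [u' hu'].
  have ul : linear (fun x => scale_hom c u x + u' x).
    by move=> a x y; rewrite !linearP scalerDr addrACA.
  by exists (mklin ul) => x /=; rewrite fl' hu hu' linearP mulmxDr -scalemxAr.
have hus (i : nat) : exists u : {linear X -> Y},
    forall i' : 'I_(n * m), i' = i :> nat -> forall x, f' (u x) = f x *m vec_mx (row i' B).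
  case: (ltnP i (n * m)) => [lt|ge]; last first.
    by exists (mklin zl) => i' e; move: (ltn_ord i'); rewrite e ltnNge ge.
  have /hB [u hu] : (row (Ordinal lt) B <= B)%MS by exact: row_sub.
  by exists u => i' e; have -> : i' = Ordinal lt by apply: val_inj.
have [us husP] := choice hus; exists us => u.
have [F hF] := kcoord_matrix fK gK fl fK' gK' fl' (linear_klinear u).
have /submxP [D hD] : (mxvec F <= B)%MS by apply/hB; exists u => x; rewrite mxvecK.
exists (fun i => if insub i is Some i' then D 0 i' else 0) => x.
apply: (can_inj fK'); rewrite hF -(mxvecK F) hD (mulmx_sum_row D B) linear_sum mulmx_sumr.
have fs (I : Type) (s : seq I) (c : I -> k) (y : I -> Y) :
    f' (\sum_(i <- s) (c i)%:A *: y i) = \sum_(i <- s) c i *: f' (y i).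
  elim: s => [|i s IH]; first by rewrite !big_nil f0.
  by rewrite !big_cons fl' IH.
rewrite fs; apply: eq_bigr => i _.
by rewrite valK linearZ -scalemxAr (husP i i).
Qed.

Lemma hom_class_sum X Y n (c : nat -> k) (us : nat -> {linear X -> Y}) (u : {linear X -> Y}) :
  (forall x, u x = \sum_(i < n) (c i)%:A *: us i x) ->
  hom_class u = \sum_(i < n) hom_class (scale_hom (c i) (us i)).
Proof.
elim: n u => [|n IH] u hu.
  by rewrite big_ord0; apply: hom_class_zero => m; rewrite hu big_ord0.
have vl : linear (fun x => \sum_(i < n) (c i)%:A *: us i x).
  move=> a x y; rewrite scaler_sumr -big_split; apply: eq_bigr => i _.
  by rewrite linearP scalerDr !scalerA scalar_central.
rewrite big_ord_recr /= -(IH (mklin vl)) // -ext_classD; apply: ext_class_val.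
by apply: cochain_ext => -[|a s] m; rewrite /= !fctE /= ?hu ?big_ord_recr //= addr0.
Qed.

Lemma yoneda_suml L M N n (x : 'I_n -> Ext M N) (y : Ext L M) :
  yoneda (\sum_(i < n) x i) y = \sum_(i < n) yoneda (x i) y.
Proof. exact: (big_morph (fun x => yoneda x y) (fun x x' => yonedaDlE x x' y) (yoneda0l N y)). Qed.

Lemma HH_act_scalar_left M N (c : k) (e : Ext M N) :
  HH_act e (c *: 1) = yoneda (hom_class (scale_hom c (@idfun N))) e.
Proof.
have [z ->] := ext_class_surj e.
rewrite /HH_act (HH_to_Ext_scalar (u := scale_hom c (@idfun M))) // !yonedaE.
apply: ext_class_val; rewrite /= yoneda_homl yoneda_homr; last exact: cocycle_zero.
apply: cochain_ext => s m /=; have [_ zl _] := cocycle_cochain z.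
by have := zl s c m 0; rewrite !addr0 cocycle_zero addr0.
Qed.

End HomSpan.

Section Periodicity.
Variables (k : closedFieldType) (A : falgType k) (H : comAlgType k) (iota : {lrmorphism H -> HH A}).
Variables (M : lmodType A) (Q K : nat -> lmodType A) (r : resolution M Q K).
Variable th : forall n, Ext (syz M K n) (K n).
Hypothesis thP : forall n, is_shift (res_p r n) (res_i r n) (th n).

Local Notation top := (mod_radical A).
Local Notation E := (ext_module M top iota : lmodType H).
Local Notation pE := ((fun n => @ext_comp k A M top n) : nat -> E -> E).
Local Notation syzn := (syz M K).
Local Notation con := (@conn k A M K th).
Local Notation kspan := (@fspan k H (in_alg H) E).

Lemma ext_scale_scalar (c : k) (e : E) :
  c%:A *: e = yoneda (hom_class (scale_hom c (@idfun top))) (e : Ext M top).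
Proof. by rewrite -HH_act_scalar_left -[LHS]/(HH_act _ (iota c%:A)) linearZ /= rmorph1. Qed.

Lemma conn_scale n (c : k) (u : {linear syzn n -> top}) :
  c%:A *: (yoneda (hom_class u) (con n) : E) = yoneda (hom_class (scale_hom c u)) (con n).
Proof. by rewrite ext_scale_scalar -yonedaAE hom_class_comp; congr yoneda; exact: hom_class_ext. Qed.

Lemma conn_deg n (u : {linear syzn n -> top}) :
  ext_comp n (yoneda (hom_class u) (con n)) = yoneda (hom_class u) (con n).
Proof.
suff h j (N : lmodType A) (e : Ext (syzn n) N) :
    ext_comp (j + n)%N (yoneda e (con n)) = yoneda (ext_comp j e) (con n).
  by have := h 0%N _ (hom_class u); rewrite ext_comp_hom.
elim: n {u} j N e => [|n IH] j N e; first by rewrite /= !yoneda_id addn0.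
by rewrite /= -!yonedaAE addnS -addSn IH (th_yoneda thP).
Qed.

Lemma ext_degree_hom n (e : E) : pE n e = e ->
  exists u : {linear syzn n -> top}, e = yoneda (hom_class u) (con n).
Proof.
move=> en; have [e' e'0 ->] := conn_surjective thP (j := 0%N) (n := n) en.
by have [u ->] := ext_comp0_hom e'0; exists u.
Qed.

Lemma ext_degree_span n : exists b : seq E,
  size b = (kdim (syzn n) * kdim top)%N /\ forall e, pE n e = e -> kspan b e.
Proof.
have [us hus] := hom_span (syz_fg r n) (top_fg A).
set B := (kdim _ * kdim _)%N in hus *.
exists [seq (yoneda (hom_class (us i)) (con n) : E) | i <- seq.iota 0 B].
split=> [|e /ext_degree_hom [u ->]]; first by rewrite size_map size_iota.
have [c hc] := hus u; rewrite (hom_class_sum hc) yoneda_suml.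
apply: fspan_sum => i _; rewrite -conn_scale; apply: (fspanZ (f := in_alg H)).
by apply: fspan_mem; apply: (map_f (fun j => yoneda (hom_class (us j)) (con n) : E)); rewrite mem_iota /= ltn_ord.
Qed.

(** A spanning family of size [B] in degree [n] makes any [B + 1] maps from the syzygy to [A / r]
    dependent, since [conn] is injective on such maps. *)
Lemma syz_generators n B (b : seq E) : (size b <= B)%N ->
  (forall e, pE n e = e -> kspan b e) ->
  exists f : {linear 'rV[A]_B -> syzn n}, surjective f.
Proof.
move=> sb hb; apply: generators_bound; first exact: (syz_fg r).
move=> u.
have hc (i : 'I_B.+1) : exists c : nat -> k,
    (yoneda (hom_class (u i)) (con n) : E) = \sum_(l < B) (c l)%:A *: b`_l.
  have /fspanP [c ce] := hb _ (conn_deg (u i)).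
  exists (fun l => if (l < size b)%N then c l else 0).
  rewrite ce (big_ord_widen B (fun t => in_alg H (c t) *: b`_t) sb) big_mkcond /=.
  by apply: eq_bigr => t _; case: ifP => // _; rewrite scale0r scale0r.
have [c cP] := choice hc.
pose C : 'M[k]_(B.+1, B) := \matrix_(i, l) c i l.
have : kermx C != 0 by rewrite kermx_eq0 /row_free neq_ltn ltnS rank_leq_col.
case/rowV0Pn => v /sub_kermxP vC v0; exists (v 0); split.
  have /rV0Pn [i vi] := v0; by exists i.
have wl : linear (fun x => \sum_(i < B.+1) (v 0 (inord i))%:A *: u (inord i) x).
  move=> a x y; rewrite scaler_sumr -big_split; apply: eq_bigr => i _.
  by rewrite linearP scalerDr !scalerA scalar_central.
have w0 : yoneda (hom_class (mklin wl)) (con n) = 0.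
  rewrite (@hom_class_sum _ _ _ _ B.+1 (fun i => v 0 (inord i)) (fun i => u (inord i))) //.
  rewrite yoneda_suml.
  have -> : \sum_(i < B.+1) yoneda (hom_class (scale_hom (v 0 (inord i)) (u (inord i)))) (con n)
     = \sum_(i < B.+1) (v 0 i)%:A *: \sum_(l < B) (c i l)%:A *: b`_l :> E.
    by apply: eq_bigr => i _; rewrite inord_val -conn_scale cP.
  under eq_bigr do rewrite scaler_sumr.
  rewrite exchange_big big1 // => l _.
  under eq_bigr do rewrite scalerA -!in_algE -rmorphM.
  rewrite -scaler_suml -rmorph_sum /=.
  have := congr1 (fun X : 'rV_B => X 0 l) vC; rewrite !mxE => h.
  suff -> : \sum_i v 0 i * c i l = 0 by rewrite scale0r scale0r.
  by rewrite -[RHS]h; apply: eq_bigr => i _; rewrite mxE.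
move=> x; have := conn_hom_injective thP w0 x; rewrite /= => e.
by rewrite -[RHS]e; apply: eq_bigr => i _; rewrite inord_val.
Qed.

Lemma syz_bound n B (b : seq E) : (size b <= B)%N ->
  (forall e, pE n e = e -> kspan b e) ->
  (kdim (syzn n) <= kdim 'rV[A]_B)%N /\ (kdim (Q n) <= kdim 'rV[A]_B)%N.
Proof.
move=> sb hb; have [f sf] := syz_generators sb hb.
have [g sg] := cover_generators (res_cover r n) sf.
split; first by have [] := kdim_surjective (free_fg A B) (syz_fg r n) sf.
by have [] := kdim_surjective (free_fg A B) (res_fg r n) sg.
Qed.

Lemma syz_zero n : (forall e, pE n e = e -> e = 0) -> forall q : Q n, q = 0.
Proof.
move=> E0; have s0 (m : syzn n) : m = 0.
  apply: contrapT => m0; have zl : linear ((fun=> 0) : 'rV[A]_0 -> syzn n).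
    by move=> a x y; rewrite scaler0 addr0.
  have [|u [[y uy] _]] := hom_top_separates (phi := mklin zl) (syz_fg r n).
    by move=> /(_ m) [x /esym].
  by apply: uy; apply: (conn_hom_injective thP); apply: E0; exact: conn_deg.
have [_ _ small] := res_cover r n.
apply: (small [set 0]); first by split=> // a x y -> ->; rewrite scaler0 addr0.
by move=> q; exists 0.
Qed.

Lemma zero_degree n : (forall q : Q n, q = 0) -> forall e, pE n e = e -> e = 0.
Proof.
move=> Q0 e /ext_degree_hom [u ->].
have [_ sp _] := res_cover r n.
rewrite hom_class_zero ?yoneda0l // => m; have [q <-] := sp m.
by rewrite (Q0 q) linear0 linear0.
Qed.

(* [x] acts on [Ext^n(M, A/r) = Hom(syz n, A/r)] as composition with a map
   [syz (n + d) -> syz n], which is onto as soon as [x] is injective there. *)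
Lemma injective_surjection n d (x : H) : HH_deg d (iota x) ->
  (forall e, pE n e = e -> x *: e = 0 -> e = 0) ->
  exists phi : {linear syzn (d + n) -> syzn n}, surjective phi.
Proof.
move=> xd inj.
pose w : Ext M (syzn n) := yoneda (HH_to_Ext (syzn n) (iota x)) (con n).
have wd : ext_comp (d + n)%N w = w.
  have hd : ext_comp d (HH_to_Ext (syzn n) (iota x)) = HH_to_Ext (syzn n) (iota x).
    by rewrite -ext_comp_HH (hh_deg_comp d xd) eqxx.
  rewrite /w; move: (HH_to_Ext _ _) hd => h hd.
  have cn : ext_comp n (con n) = con n.
    elim: (n) => [|j IH]; first by rewrite /= ext_comp_hom.
    by rewrite /= -{1}IH ext_comp_yoneda leqnSn subSn // subnn; have [-> _ _ _] := thP j; rewrite IH.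
  by rewrite -{1}cn ext_comp_yoneda leq_addl addnK hd cn.
have [e' e'0 we'] := conn_surjective thP (j := 0%N) (n := (d + n)%N) wd.
have [phi phiE] := ext_comp0_hom e'0; exists phi; apply: contrapT => ns.
have [u [[y uy] u0]] := hom_top_separates (syz_fg r n) ns.
apply: uy; apply: (conn_hom_injective thP).
apply: (inj (yoneda (hom_class u) (con n))); first exact: conn_deg.
rewrite -[LHS]/(HH_act (yoneda (hom_class u) (con n)) (iota x)) /HH_act yonedaAE.
have uw : yoneda (hom_class u) w = 0.
  rewrite we' phiE -yonedaAE hom_class_comp hom_class_zero ?yoneda0l //.
by case: (conn_HH thP n xd) => ->; rewrite ?yonedaNrE uw ?oppr0.
Qed.

Lemma bounded_monotone_stationary (f : nat -> nat) B : (forall j, f j <= f j.+1)%N ->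
  (forall j, f j <= B)%N -> exists j, f j.+1 = f j.
Proof.
move=> mono bd; apply: contrapT => no.
have inc j : (j <= f j)%N.
  elim: j => // j IH; apply: leq_ltn_trans IH _; rewrite ltn_neqAle mono andbT.
  by apply/eqP => e; apply: no; exists j.
by have := leq_trans (inc B.+1) (bd B.+1); rewrite ltnn.
Qed.

(** Along indices in steps of [d] the dimensions do not decrease and stay below [B], so two
    consecutive ones agree, and the surjection between these syzygies is bijective. *)
Lemma syz_iso_exists N d B (x : H) : (0 < d)%N -> HH_deg d (iota x) ->
  (forall n e, (N <= n)%N -> pE n e = e -> x *: e = 0 -> e = 0) ->
  (forall n, kdim (syzn n) <= B)%N ->
  exists n, lmod_iso (syzn (d + n.+1)) (syzn n.+1).
Proof.
move=> d0 xd inj bd.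
(* The successor keeps the index positive, where syzygies have no projective summands. *)
pose a j := (N + j * d).+1.
have aS j : a j.+1 = (d + a j)%N by rewrite /a mulSn addnCA addnS.
have sur j : exists phi : {linear syzn (d + a j) -> syzn (a j)}, surjective phi.
  by apply: (injective_surjection xd) => e; apply: inj; rewrite /a leqW // leq_addr.
have [|j ej] := @bounded_monotone_stationary (fun j => kdim (syzn (a j))) B _ (fun j => bd (a j)).
  move=> j; rewrite aS; have [phi sphi] := sur j.
  by have [] := kdim_surjective (syz_fg r _) (syz_fg r _) sphi.
rewrite aS in ej; have [phi sphi] := sur j.
exists (N + j * d)%N; exists phi; apply: bijectiveP => //.
by have [_] := kdim_surjective (syz_fg r _) (syz_fg r _) sphi; apply; rewrite ej.
Qed.

End Periodicity.

(** * Cancelling syzygies *)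

Section Descent.
Variables (k : closedFieldType) (A : falgType k).
Hypothesis sA : selfinjective A.
Variables (M : lmodType A) (Q K : nat -> lmodType A) (r : resolution M Q K).
Local Notation syzn := (syz M K).

Lemma syz_no_projective n : no_projective_sub (syzn n.+1).
Proof.
by apply: syzygy_no_projective sA (res_cover r n) _ (@res_exact _ _ _ _ _ r n); exact: res_inj.
Qed.

(** Each step cancels one syzygy by [iso_of_syzygies]. It ends at index 1, as [M] at index 0 may
    have projective summands. *)
Lemma syz_descend d n : (0 < d)%N -> lmod_iso (syzn (d + n.+1)) (syzn n.+1) -> lmod_iso (syzn d.+1) (syzn 1%N).
Proof.
move=> d0; elim: n => [|n IH]; first by rewrite addn1.
move=> iso; apply: IH; move: iso; rewrite addnS => iso.
have [p1 s1 _] := res_cover r (d + n.+1)%N; have [p2 s2 _] := res_cover r n.+1.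
have i1 := @res_inj _ _ _ _ _ r (d + n.+1)%N; have i2 := @res_inj _ _ _ _ _ r n.+1.
apply: (iso_of_syzygies sA p1 (res_fg r _) s1 i1 (@res_exact _ _ _ _ _ r _)
  p2 (res_fg r _) s2 i2 (@res_exact _ _ _ _ _ r _)) iso.
  by rewrite addnS; exact: syz_no_projective.
exact: syz_no_projective.
Qed.

Lemma nth_syzygy_syz n j (X : lmodType A) : lmod_iso (syzn (n + j)) X -> is_nth_syzygy n (syzn j) X.
Proof.
elim: n j => [//|n IH] j iso; exists (syzn j.+1).
  by exists (Q j), (res_p r j), (res_i r j); split; [exact: res_cover | exact: (@res_inj _ _ _ _ _ r j) | exact: (@res_exact _ _ _ _ _ r j)].
by apply: IH; rewrite addnS.
Qed.

End Descent.

(** * Splitting off the projective part *)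

Section Summands.
Variables (k : closedFieldType) (A : falgType k).
Implicit Types M X P W : lmodType A.

Lemma prod_fg P W : finitely_generated P -> finitely_generated W -> finitely_generated (P * W)%type.
Proof.
move=> /fg_free_cover [m [f sf]] /fg_free_cover [n [g sg]].
have hl : linear (fun v : 'rV[A]_(m + n) => (f (lsubmx v), g (rsubmx v))).
  by move=> a x y; rewrite !linearP.
apply: (fg_surjective (p := mklin hl)) (free_fg A (m + n)) => -[x y].
have [v <-] := sf x; have [w <-] := sg y.
by exists (row_mx v w); rewrite /= row_mxKl row_mxKr.
Qed.

(** The cover of [M] is the cover of [X] times the identity of [P]. Both have the same kernel, so
    from the first syzygy on [M] and [X] share a resolution. *)
Lemma split_resolution M : selfinjective A -> finitely_generated M ->
  exists (X P : lmodType A) (u : {linear X -> M}) (v : {linear P -> M}),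
    [/\ projective P, no_projective_sub X, bijective (fun xp : X * P => u xp.1 + v xp.2)
      & exists (Q K : nat -> lmodType A) (r : resolution M Q K) (P0 : lmodType A)
          (p : {linear P0 -> X}) (i : {linear K 0%N -> P0}),
          [/\ projective_cover p, finitely_generated P0, injective i & exact_at i p]].
Proof.
move=> sA fM.
have [X [P [u [v [pP nX [fX fP] bij]]]]] := split_projective sA fM.
exists X, P, u, v; split=> //.
have [P0 [p [[pP0 sp small] fP0]]] := projective_cover_exists fX.
have [K0 [i [ii ex]]] := exact_kernel p.
have fl : linear (fun qw : P0 * P => u (p qw.1) + v qw.2).
  by move=> a [q w] [q' w'] /=; rewrite !linearP scalerDr addrACA.
have il : linear (fun x => (i x, 0) : P0 * P).
  by move=> a x y; rewrite linearP; congr (_, _); rewrite /= scaler0 addr0.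
have f0 (q : P0) (w : P) : u (p q) + v w = 0 -> p q = 0 /\ w = 0.
  move=> e; have h : u (p q, w).1 + v (p q, w).2 = u (0 : X, 0 : P).1 + v (0 : X, 0 : P).2.
    by rewrite /= e !linear0 addr0.
  by have [-> ->] := bij_inj bij h.
have cover : projective_cover (mklin fl).
  split; first exact: prod_projective.
    move=> y; have [[x w] <-] := bijective_surjective bij y; have [q <-] := sp x.
    by exists (q, w).
  move=> U [U0 UD] Uk.
  (* A vector of [U] congruent to [(q', 0)] modulo the kernel has second coordinate 0, so
     superfluity in [P0] can be used. *)
  have hU q : U (q, 0).
    apply: (small [set q | U (q, 0)]).
      split=> // a x y Ux Uy; have := UD a _ _ Ux Uy.
      by congr U; congr (_, _); rewrite /= scaler0 addr0.
    move=> q'; have [[a b] Uab e] := Uk (q', 0); exists a.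
      by have [_ /eqP] := f0 _ _ e; rewrite /= sub0r oppr_eq0 => /eqP <-.
    by have [] := f0 _ _ e.
  move=> [q w]; have [[a b] Uab e] := Uk (q, w).
  have [_ /eqP] := f0 _ _ e; rewrite /= subr_eq0 => /eqP ->.
  have := UD 1 _ _ Uab (hU (q - a)); congr U; rewrite scale1r; congr (_, _) => /=.
    by rewrite addrC subrK.
  by rewrite addr0.
have inj : injective (mklin il) by move=> x y [/ii].
have exa : exact_at (mklin il) (mklin fl).
  move=> [q w] /=; split=> [/f0 [/ex [x <-] ->]|[x [<- <-]]]; first by exists x.
  have /ex -> : exists y, i y = i x by exists x.
  by rewrite !linear0 addr0.
have [Q [K [r K0E]]] := resolution_exists cover inj exa (prod_fg fP0 fP).
by subst K0; exists Q, K, r, P0, p, i; split.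
Qed.

(** A single periodic summand is enough, as the nonprojective part is periodic as a whole. *)
Lemma sum_of_periodic_and_projectiveI M X P (u : {linear X -> M}) (v : {linear P -> M}) :
  periodic X -> projective P -> bijective (fun xp : X * P => u xp.1 + v xp.2) ->
  sum_of_periodic_and_projective M.
Proof.
move=> pX pP bij; exists 1%N, (fun=> X), P, (fun=> u), v; split=> //.
have e (xp : ('I_1 -> X) * P) : \sum_i u (xp.1 i) + v xp.2 = u (xp.1 0) + v xp.2.
  by rewrite big_ord1.
apply: bijectiveP => [[x p] [x' p']|y]; rewrite ?e.
  move=> /= h; have [h1 ->] := @bij_inj _ _ _ bij (x 0, p) (x' 0, p') h.
  by congr (_, _); apply/funext => j; rewrite (ord1 j).
have [[x p] <-] := bijective_surjective bij y.
by exists (fun=> x, p); rewrite e.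
Qed.

End Summands.

Import Order.TTheory Num.Theory.

(** * Complexity *)

Section Growth.
Variables (R : realType) (k : fieldType) (A : falgType k).
Implicit Types M X : lmodType A.

Lemma kdim_eq0 M : finitely_generated M -> kdim M = 0%N <-> forall x : M, x = 0.
Proof.
move=> fM; split=> [e x|M0].
  have /(has_kdimP _ fM) [b hb] : 0%N = kdim M by [].
  by have [c [-> _]] := hb x; rewrite big_ord0.
apply/esym/(has_kdimP _ fM); exists (fun=> 0) => x; exists [ffun=> 0].
split; first by rewrite big_ord0.
by move=> c _; apply/ffunP; case.
Qed.

Lemma growth_bound_one (Q : nat -> lmodType A) : (forall n, finitely_generated (Q n)) ->
  growth_bound R Q 1 <-> exists B, forall n, (kdim (Q n) <= B)%N.
Proof.
move=> fQ; split=> [[a ha]|[B hB]]; last first.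
  exists B%:R => n n0; exists (kdim (Q n)); first exact/has_kdimP.
  by rewrite subrr expr0z mulr1 ler_nat.
(* The growth bound concerns positive [n] only, so the dimension of [Q 0] is added. *)
exists (kdim (Q 0%N) + Num.bound `|a|)%N => -[|n]; first exact: leq_addr.
have [d /(has_kdimP _ (fQ _)) ->] := ha n.+1 isT; rewrite subrr expr0z mulr1 => da.
apply: leq_trans (leq_addl _ _); rewrite -(ler_nat R).
by apply: le_trans da (ltW _); apply: le_lt_trans (ler_norm a) _; exact: archi_boundP (normr_ge0 a).
Qed.

(** With exponent -1 the bound reads: dimension times [n] is at most [a]. This forces dimension 0
    once [n] exceeds [a]. *)
Lemma growth_bound_zero (Q : nat -> lmodType A) : (forall n, finitely_generated (Q n)) ->
  growth_bound R Q 0 <-> exists N, forall n, (N <= n)%N -> forall q : Q n, q = 0.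
Proof.
move=> fQ; split=> [[a ha]|[N hN]].
  exists (Num.bound `|a|).+1 => n Nn; have n0 : (0 < n)%N by exact: leq_ltn_trans Nn.
  apply/(kdim_eq0 (fQ n)); have [d /(has_kdimP _ (fQ _)) ->] := ha n n0.
  rewrite sub0r exprN1 ler_pdivlMr ?ltr0n // => da.
  have : (kdim (Q n) * n < n)%N.
    rewrite -(ltr_nat R) natrM; apply: le_lt_trans da _; apply: le_lt_trans (ler_norm a) _.
    by apply: lt_le_trans (archi_boundP (normr_ge0 a)) _; rewrite ler_nat ltnW.
  by rewrite -[X in (_ < X)%N]mul1n ltn_pmul2r // ltnS leqn0 => /eqP.
(* The sum dominates each of the finitely many products [kdim (Q i) * i] that can be nonzero. *)
exists (\sum_(i < N) kdim (Q i) * i)%:R => n n0.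
exists (kdim (Q n)); first exact/has_kdimP.
rewrite sub0r exprN1 ler_pdivlMr ?ltr0n // -natrM ler_nat.
case: (ltnP n N) => [lt|/hN/(kdim_eq0 (fQ n)) -> //].
by rewrite (bigD1 (Ordinal lt)) //= leq_addr.
Qed.

End Growth.

Section Complexity.
Variables (R : realType) (k : closedFieldType) (A : falgType k) (H : comAlgType k).
Variables (iota : {lrmorphism H -> HH A}) (M : lmodType A).
Hypothesis fM : finitely_generated M.
Local Notation E := (ext_module M (mod_radical A) iota : lmodType H).
Local Notation pE := ((fun n => @ext_comp k A M (mod_radical A) n) : nat -> E -> E).

Lemma fg_resolution : exists (Q K : nat -> lmodType A) (r : resolution M Q K), True.
Proof.
have [P [p [cp fP]]] := projective_cover_exists fM.
have [K [i [ii ex]]] := exact_kernel p.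
by have [Q [K' [r _]]] := resolution_exists cp ii ex fP; exists Q, K', r.
Qed.

Section Resolution.
Variables (Q K : nat -> lmodType A) (r : resolution M Q K).

Lemma resolution_shifts : exists th : forall n, Ext (syz M K n) (K n),
  forall n, is_shift (res_p r n) (res_i r n) (th n).
Proof.
have ex n : exists t, is_shift (res_p r n) (res_i r n) t.
  have [pP sp _] := res_cover r n.
  exact: shift_exists pP (res_fg r n) sp (@res_inj _ _ _ _ _ r n) (@res_exact _ _ _ _ _ r n).
by exists (fun n => sval (cid (ex n))) => n; exact: (svalP (cid (ex n))).
Qed.

Lemma resolution_degree_span n : exists b : seq E,
  size b = (kdim (syz M K n) * kdim (mod_radical A))%N /\
  forall e, pE n e = e -> fspan (in_alg H) b e.
Proof. by have [th thP] := resolution_shifts; exact: ext_degree_span thP n. Qed.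

Lemma resolution_eventually_zero :
  (exists N, forall n, (N <= n)%N -> forall q : Q n, q = 0) <-> eventually_zero pE.
Proof.
have [th thP] := resolution_shifts; split=> -[N hN]; exists N.
  by move=> n e Nn; apply: (zero_degree thP); exact: hN.
by move=> n Nn; apply: (syz_zero (iota := iota) thP) => e; exact: hN.
Qed.

Lemma bounded_degrees_syz : bounded_degrees pE ->
  exists B, forall n, (kdim (syz M K n) <= B)%N /\ (kdim (Q n) <= B)%N.
Proof.
move=> [B hB]; exists (kdim 'rV[A]_B) => n; have [th thP] := resolution_shifts.
by have [b [sb hb]] := hB n; exact: (syz_bound thP sb hb).
Qed.

Lemma resolution_bounded : (exists B, forall n, (kdim (Q n) <= B)%N) <-> bounded_degrees pE.
Proof.
split=> [[B hB]|/bounded_degrees_syz [B hB]]; last by exists B => n; have [] := hB n.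
exists (B * kdim (mod_radical A))%N => n; have [b [sb hb]] := resolution_degree_span n.
exists b; split=> //; rewrite sb leq_mul2r orbC; apply/orP; left.
have [_ sp _] := res_cover r n.
by apply: leq_trans (hB n); have [] := kdim_surjective (res_fg r n) (syz_fg r n) sp.
Qed.

End Resolution.

(** Exponents 1 and 0 mean bounded and eventually zero dimensions. Both conditions translate into
    [E] for any minimal resolution, so the given one serves in one direction and a constructed one
    in the other. *)
Lemma complexity_one : complexity R M 1 <-> bounded_degrees pE /\ ~ eventually_zero pE.
Proof.
split=> [[Q [e [d [/minimal_resolution [K [r _]] g1 g0]]]]|[bd nz]].
  split; first by apply/(resolution_bounded r)/(growth_bound_one R (res_fg r)).
  by move=> /(resolution_eventually_zero r)/(growth_bound_zero R (res_fg r))/g0.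
have [Q [K [r _]]] := fg_resolution; exists Q; do 2 eexists; split.
- exact: resolution_minimal r.
- exact/(growth_bound_one R (res_fg r))/(resolution_bounded r).
- case=> // /(growth_bound_zero R (res_fg r)) z.
  by exfalso; apply/nz/(resolution_eventually_zero r).
Qed.

Hypothesis sA : selfinjective A.

(** Descent leaves syzygy [d + 1] isomorphic to syzygy 1. The latter is also the first syzygy of
    [X], so one more cancellation identifies syzygy [d] with [X]. *)
Lemma parameter_periodic (Q K : nat -> lmodType A) (r : resolution M Q K) (X P0 : lmodType A)
    (p : {linear P0 -> X}) (i : {linear K 0%N -> P0}) (x : H) d N :
  no_projective_sub X -> projective_cover p -> finitely_generated P0 -> injective i -> exact_at i p ->
  bounded_degrees pE -> (0 < d)%N -> HH_deg d (iota x) ->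
  (forall n e, (N <= n)%N -> pE n e = e -> x *: e = 0 -> e = 0) -> periodic X.
Proof.
move=> nX cp fP0 ii ex bd d0 xd inj.
have [th thP] := resolution_shifts r; have [B hB] := bounded_degrees_syz r bd.
have [n iso] := syz_iso_exists thP d0 xd inj (fun n => (hB n).1).
have {}iso := syz_descend sA r d0 iso.
case: d d0 iso {xd} => // d _ iso.
exists d.+1 => //; exists (K 0%N); first by exists P0, p, i.
apply: (@nth_syzygy_syz _ _ _ _ _ r d 1 X); rewrite addn1.
have [pP sp _] := cp; have [pQ sQ _] := res_cover r d.+1.
apply: (iso_of_syzygies sA pQ (res_fg r _) sQ (@res_inj _ _ _ _ _ r _) (@res_exact _ _ _ _ _ r _)
  pP fP0 sp ii ex (@syz_no_projective _ _ sA _ _ _ r d) nX iso).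
Qed.

End Complexity.

Theorem theorem4p3 (R : realType) (k : closedFieldType) (L : falgType k)
    (H : comAlgType k) (iota : {lrmorphism H -> HH L}) (M : lmodType L) :
  indecomposable_algebra L ->
  selfinjective L ->
  graded_subalgebra iota ->
  noetherian H ->
  contains_HH0 iota ->
  Ext_finitely_generated iota (mod_radical L) (mod_radical L) ->
  finitely_generated M ->
  (is_line (support_variety iota M) <-> complexity R M 1) /\
  (is_line (support_variety iota M) -> sum_of_periodic_and_projective M).
Proof.
move=> ind sA gr noeth _ fgtop fM.
have [pH pHE] := subalgebra_comp_exists gr.
have grH := subalgebra_graded gr pHE.
have pH_scalar := subalgebra_scalar gr pHE.
have local0 h := @subalgebra_local _ _ _ _ gr _ pHE h ind.
pose E : lmodType H := ext_module M (mod_radical L) iota.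
pose pE : nat -> E -> E := fun n => @ext_comp k L M (mod_radical L) n.
have grE : graded pH pE := ext_module_graded pHE M (mod_radical L).
have fgE : finitely_generated E := ext_fg noeth fgtop fM.
have finE n : exists b : seq E, forall e, pE n e = e -> fspan (in_alg H) b e.
  have [Q [K [r _]]] := fg_resolution fM.
  by have [b [_ hb]] := resolution_degree_span iota r n; exists b.
have line : is_line (support_variety iota M) <-> has_parameter pH pE /\ ~ eventually_zero pE.
  by have h := line_parameter grH pH_scalar noeth local0 grE fgE finE; exact: h.
have par : has_parameter pH pE -> bounded_degrees pE := parameter_bounded grE finE.
split=> [|/line [hp _]].
  rewrite line (complexity_one R iota fM); split=> -[hp nz]; split=> //; first exact: par.
  exact: bounded_has_parameter grH pH_scalar noeth _ _ grE fgE hp.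
(* The parameter acts on the cohomology of [M], while periodicity is wanted for [X]; the shared
   first syzygy links the two. *)
have [X [P [u [v [pP nX bij [Q [K [r [P0 [p [i [cp fP0 ii ex]]]]]]]]]]]] := split_resolution sA fM.
apply: sum_of_periodic_and_projectiveI pP bij.
have [x [d [d0 xd xpar]]] := hp.
have [N inj] := parameter_injective noeth grE fgE d0 xd xpar.
apply: (parameter_periodic sA r nX cp fP0 ii ex (par hp) d0) inj.
by rewrite -xd pHE; exact: hh_comp_deg.
Qed.
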